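(* For $i\in\mathbb{N}=\{1,2,\dots\}$, let $\mathcal{R}_{5,i}$ be the relative structure on the isomorphism classes of $B_n$-persistence modules in which $\mathcal{T}$ is a singleton $\{s\}$, $X_s$ is the collection of all $n$-filtrations, $d_s=d_{SI}$ is the strong interleaving distance, and $f_s(X)=H_i(X)$. If $k=\mathbb{Q}$ or $k=\mathbb{Z}/p\mathbb{Z}$ for some prime $p$, then the interleaving distance $d_I$ is $\mathcal{R}_{5,i}$-optimal.
   Context: $\mathbb{R}^n$ carries the product partial order. An $n$-filtration $X$ is a collection of topological spaces $\{X_a\}_{a\in\mathbb{R}^n}$ with continuous maps $\phi_X(a,b):X_a\to X_b$ for $a\le b$ such that $\phi_X(b,c)\circ\phi_X(a,b)=\phi_X(a,c)$ for $a\le b\le c$ (and $\phi_X(a,a)=\mathrm{id}$). A morphism $f:X\to Y$ is a collection of continuous maps $f_a:X_a\to Y_a$ commuting with the transition maps. For $\epsilon\ge0$, $\vec\epsilon=(\epsilon,\dots,\epsilon)$, $X(\epsilon)$ is the $n$-filtration with $X(\epsilon)_a=X_{a+\vec\epsilon}$ and shifted transition maps; $f(\epsilon)_a=f_{a+\vec\epsilon}$; $S(X,\epsilon):X\to X(\epsilon)$ has $S(X,\epsilon)_a=\phi_X(a,a+\vec\epsilon)$. $X,Y$ are strongly $\epsilon$-interleaved if there are morphisms $f:X\to Y(\epsilon)$, $g:Y\to X(\epsilon)$ with $g(\epsilon)\circ f=S(X,2\epsilon)$ and $f(\epsilon)\circ g=S(Y,2\epsilon)$. $d_{SI}(X,Y)=\inf\{\epsilon\ge0: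 X,Y\text{ are strongly }\epsilon\text{-interleaved}\}\in[0,\infty]$. $B_n=k[\mathbb{R}_{\ge0}^n]$ is the monoid ring of $(\mathbb{R}^n_{\ge0},+)$. A $B_n$-persistence module is a $B_n$-module $M$ with a $k$-vector space decomposition $M=\bigoplus_{a\in\mathbb{R}^n}M_a$ such that $x_i^{\alpha}(M_a)\subset M_{a+\alpha \mathbf{e}_i}$ for all $a$, $\alpha\ge0$; morphisms are grading-preserving module homomorphisms. For $a\le b$, $\varphi_M(a,b):M_a\to M_b$ is multiplication by $x_1^{b_1-a_1}\cdots x_n^{b_n-a_n}$. With $M(\epsilon)_a=M_{a+\vec\epsilon}$, $f(\epsilon)_a=f_{a+\vec\epsilon}$, $S(M,\epsilon)_a=\varphi_M(a,a+\vec\epsilon)$, $M,N$ are $\epsilon$-interleaved if there are morphisms $f:M\to N(\epsilon)$, $g:N\to M(\epsilon)$ with $g(\epsilon)\circ f=S(M,2\epsilon)$ and $f(\epsilon)\circ g=S(N,2\epsilon)$; $d_I(M,N)=\inf\{\epsilon\ge0: M,N\text{ are }\epsilon\text{-interleaved}\}\in[0,\infty]$. $H_i(X)$ is the $B_n$-persistence module with $H_i(X)_a=H_i(X_a;k)$ (singular homology) and transition maps induced by $\phi_X(a,b)$. A relative structure on a set (or class) $Y$ is a triple $\mathcal{R}=(\mathcal{T},X_{\mathcal{T}},f_{\mathcal{T}})$ with $\mathcal{T}$ an index set (or class), $X_{\mathcal{T}}=\{(X_s,d_s)\}_{s\in\mathcal{T}}$ pseudometric spaces and $f_{\mathcal{T}}=\{f_s:X_s\to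 Y\}_{s\in\mathcal{T}}$ functions; $\mathrm{im}(f_{\mathcal{T}})=\bigcup_s\mathrm{im}(f_s)$. Pseudometrics take values in $[0,\infty]$. A pseudometric $d$ on $Y$ is $\mathcal{R}$-stable if $d(f_s(x_1),f_s(x_2))\le d_s(x_1,x_2)$ for all $s\in\mathcal{T}$, $x_1,x_2\in X_s$. It is $\mathcal{R}$-optimal if it is $\mathcal{R}$-stable and every $\mathcal{R}$-stable pseudometric $d'$ on $Y$ satisfies $d'(y_1,y_2)\le d(y_1,y_2)$ for all $y_1,y_2\in\mathrm{im}(f_{\mathcal{T}})$. *)

(* Defs.v *)
(* MathComp world, with MathComp-Analysis for the topology and multinomials'
   [monalg] for monoid algebras and free modules.  [monalg] is imported without
   its notations: they clash with those of MathComp-Analysis. *)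
From HB Require Import structures.
From mathcomp Require Import all_boot all_order all_algebra.
From mathcomp Require Import all_classical all_reals.
From mathcomp Require Import ereal topology normedtype.
From mathcomp Require Import finmap.
From mathcomp Require monalg.
Import -(notations) monalg.

Set Implicit Arguments.
Unset Strict Implicit.
Unset Printing Implicit Defensive.

Import Order.TTheory GRing.Theory Num.Theory.
Import numFieldNormedType.Exports.
Local Open Scope classical_set_scope.
Local Open Scope ring_scope.

Section ProductOrder.
Context {R : realType} {n : nat}.
Implicit Types a b c v : 'rV[R]_n.

Definition vle a b : bool := [forall i, a ord0 i <= b ord0 i].

Lemma vleP a b : reflect (forall i, a ord0 i <= b ord0 i) (vle a b).
Proof. exact: forallP. Qed.

Lemma vle_refl a : vle a a.
Proof. by apply/vleP. Qed.

Lemma vle_trans a b c : vle a b -> vle b c -> vle a c.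
Proof.
by move=> /vleP ab /vleP bc; apply/vleP => i; exact: le_trans (ab i) (bc i).
Qed.

Lemma vle_add2r c a b : vle a b -> vle (a + c) (b + c).
Proof. by move=> /vleP ab; apply/vleP => i; rewrite !mxE lerD2r. Qed.

Lemma vle_addr a v : vle 0 v -> vle a (a + v).
Proof.
by move=> /vleP v0; apply/vleP => i; have := v0 i; rewrite !mxE lerDl.
Qed.

Lemma vle_subr a v : vle 0 v -> vle (a - v) a.
Proof.
by move=> /vleP v0; apply/vleP => i; have := v0 i; rewrite !mxE gerBl.
Qed.

Definition epsv (e : {nonneg R}) : 'rV[R]_n := const_mx e%:num.

Lemma epsv_ge0 e : vle 0 (epsv e).
Proof. by apply/vleP => i; rewrite !mxE. Qed.

Lemma vle_epsv a e : vle a (a + epsv e).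
Proof. exact/vle_addr/epsv_ge0. Qed.

Lemma vle_epsv2 a e : vle a (a + epsv e + epsv e).
Proof. exact: vle_trans (vle_epsv _ _) (vle_epsv _ _). Qed.

End ProductOrder.

Section MonoidRing.
Context (R : realType) (n : nat).

Record expo := Expo { expo_val :> 'rV[R]_n; _ : vle 0 expo_val }.

HB.instance Definition _ := [isSub for expo_val].
HB.instance Definition _ := [Choice of expo by <:].

Lemma expoP (u : expo) : vle 0 (u : 'rV[R]_n).
Proof. by case: u. Qed.

Lemma expo_add_subproof (u v : expo) : vle 0 (expo_val u + expo_val v).
Proof. exact: vle_trans (expoP u) (vle_addr _ (expoP v)). Qed.

Definition expo_zero : expo := Expo (vle_refl 0).
Definition expo_add (u v : expo) : expo := Expo (expo_add_subproof u v).

Lemma expo_addA : associative expo_add.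
Proof. by move=> u v w; apply/val_inj/addrA. Qed.

Lemma expo_addC : commutative expo_add.
Proof. by move=> u v; apply/val_inj/addrC. Qed.

Lemma expo_add0 : left_id expo_zero expo_add.
Proof. by move=> u; apply/val_inj/add0r. Qed.

Lemma expo_addr0 : right_id expo_zero expo_add.
Proof. by move=> u; apply/val_inj/addr0. Qed.

Lemma expo_unit u v : expo_add u v = expo_zero -> u = expo_zero /\ v = expo_zero.
Proof.
move=> /(congr1 expo_val)/rowP /= uv0.
have uv i : (u : 'rV[R]_n) ord0 i = 0 /\ (v : 'rV[R]_n) ord0 i = 0.
  have := uv0 i; have := vleP _ _ (expoP u) i; have := vleP _ _ (expoP v) i.
  rewrite !mxE => v0 u0 /eqP; rewrite paddr_eq0 // => /andP[/eqP -> /eqP ->] //.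
by split; apply/val_inj/rowP => i; rewrite mxE; case: (uv i).
Qed.

HB.instance Definition _ := Choice_isMonomialDef.Build expo
  expo_addA expo_add0 expo_addr0 expo_unit.
HB.instance Definition _ := MonomialDef_isConomialDef.Build expo expo_addC.

End MonoidRing.

Definition Bring (R : realType) (n : nat) (k : fieldType) : comNzRingType :=
  malg (expo R n) k.

Section Monomials.
Context {R : realType} {n : nat} {k : fieldType}.

(* x_1^{v_1} ... x_n^{v_n}; only meaningful for v >= 0 (junk value 1 otherwise) *)
Definition xpow (v : 'rV[R]_n) : Bring R n k :=
  mkmalgU (insubd (expo_zero R n) v) 1.

(* the structure map k -> B_n *)
Definition Bconst (c : k) : Bring R n k := mkmalgU (expo_zero R n) c.

Lemma xpowE (u : expo R n) : xpow u = mkmalgU u 1.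
Proof. by rewrite /xpow valKd. Qed.

Lemma xpowD (u v : 'rV[R]_n) : vle 0 u -> vle 0 v ->
  xpow (u + v) = xpow u * xpow v.
Proof.
move=> u0 v0; rewrite -[u]/(expo_val (Expo u0)) -[v]/(expo_val (Expo v0)).
rewrite -[_ + _]/(expo_val (expo_add _ _)) !xpowE.
by rewrite [RHS]malgM_def fgmulUU mulr1.
Qed.

End Monomials.

Section PersistenceModules.
Variables (R : realType) (n : nat) (k : fieldType).
Local Notation vec := 'rV[R]_n.
Local Notation B := (Bring R n k).

(* [pgr a] is the homogeneous summand M_a, a k-subspace of M (the scalars of k
   act through k -> B_n); [pgr_direct] says that M is their internal direct
   sum, [pgr_act] that x_i^t M_a is contained in M_(a + t e_i). *)
Record persmod := Persmod {
  pcarrier :> lmodType B;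
  pgr : vec -> set pcarrier;
  pgr0 : forall a, pgr a 0;
  pgr_lin : forall a (c : k) x y,
    pgr a x -> pgr a y -> pgr a (Bconst c *: x + y);
  pgr_direct : forall x, exists! f : vec -> pcarrier,
    [/\ forall a, pgr a (f a), finite_set [set a | f a != 0]
      & x = \sum_(a \in [set: vec]) f a];
  pgr_act : forall a i (t : R) x, 0 <= t -> pgr a x ->
    pgr (a + t *: delta_mx ord0 i) (xpow (t *: delta_mx ord0 i) *: x)
}.

Arguments pgr : clear implicits.

Record pmor (M N : persmod) := Pmor {
  pmor_fun :> {linear M -> N};
  pmor_gr : forall a x, pgr M a x -> pgr N a (pmor_fun x)
}.

Definition piso (M N : persmod) : Prop :=
  exists (f : pmor M N) (g : pmor N M), cancel f g /\ cancel g f.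

Section Shift.
Variables (M : persmod) (e : {nonneg R}).

Let sgr (a : vec) : set M := pgr M (a + epsv e).

Lemma pshift_direct (x : M) : exists! f : vec -> M,
    [/\ forall a, sgr a (f a), finite_set [set a | f a != 0]
      & x = \sum_(a \in [set: vec]) f a].
Proof.
have bijT (v : vec) : set_bij [set: vec] [set: vec] (fun a => a + v).
  split=> //; first by move=> a b _ _; exact: addIr.
  by move=> b _; exists (b - v) => //; rewrite subrK.
have fin (f : vec -> M) v : finite_set [set a | f a != 0] ->
    finite_set [set a | f (a + v) != 0].
  move=> /(finite_image (fun a => a - v)); apply: sub_finite_set => a /= fa.
  by exists (a + v) => //; rewrite addrK.
have [f [[fgr ffin ->] funi]] := pgr_direct x.
exists (fun a => f (a + epsv e)); split.
  split => [a| |]; [exact: fgr|exact: fin|].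
  by rewrite (reindex_fsbig (fun a => a + epsv e) setT).
move=> h [hgr hfin hsum]; apply/funext => a.
rewrite (funi (fun b => h (b - epsv e))) ?addrK//; split => [b| |].
- by have := hgr (b - epsv e); rewrite /sgr subrK.
- exact: fin.
- by rewrite hsum (reindex_fsbig (fun a => a - epsv e) setT).
Qed.

Lemma pshift_act a i (t : R) x : 0 <= t -> sgr a x ->
  sgr (a + t *: delta_mx ord0 i) (xpow (t *: delta_mx ord0 i) *: x).
Proof. by move=> t0 ax; rewrite /sgr addrAC; exact: pgr_act. Qed.

(* M(e) *)
Definition pshift : persmod :=
  @Persmod M sgr (fun a => pgr0 M _) (fun a => @pgr_lin M _)
    pshift_direct pshift_act.

End Shift.

Lemma pgr_xpow (M : persmod) (a v : vec) (x : M) : vle 0 v -> pgr M a x ->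
  pgr M (a + v) (xpow v *: x).
Proof.
move=> v0 ax; suff H (s : seq 'I_n) :
    let w := \sum_(i <- s) v ord0 i *: delta_mx ord0 i : vec in
    vle 0 w /\ pgr M (a + w) (xpow w *: x).
  by rewrite [v]row_sum_delta; case: (H (index_enum 'I_n)).
have d0 i : vle 0 (v ord0 i *: delta_mx ord0 i : vec).
  by apply/vleP => j; rewrite !mxE mulr_ge0 //; have /vleP/(_ i) := v0; rewrite mxE.
elim: s => [|i s [w0 aw]] /=; first rewrite big_nil.
  split; first exact: vle_refl.
  by rewrite addr0 (xpowE (expo_zero R n)) -[mkmalgU _ _]/(1 : B) scale1r.
rewrite big_cons addrC; set w := \sum_(j <- s) _ in w0 aw *.
split; first exact: vle_trans w0 (vle_addr _ (d0 i)).
rewrite addrA xpowD // mulrC -scalerA; apply: pgr_act => //.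
by have /vleP/(_ i) := v0; rewrite mxE.
Qed.

(* phi_M(a, b) is multiplication by x^(b - a), so on each summand M_a the map
   S(M, e)_a = phi_M(a, a + (e, ..., e)) is multiplication by x^(e, ..., e) *)
Section Smoothing.
Variables (M : persmod) (e : {nonneg R}).

Definition psmooth_fun (x : M) : M := xpow (epsv e) *: x.

Lemma psmooth_linear : linear psmooth_fun.
Proof. by move=> c x y; rewrite /psmooth_fun scalerDr !scalerA mulrC. Qed.

HB.instance Definition _ :=
  GRing.isLinear.Build B M M *:%R psmooth_fun psmooth_linear.

Lemma psmooth_gr (a : vec) (x : M) : pgr M a x -> pgr M (a + epsv e) (psmooth_fun x).
Proof. exact/pgr_xpow/epsv_ge0. Qed.

Definition psmooth : pmor M (pshift M e) := @Pmor M (pshift M e) psmooth_fun psmooth_gr.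

End Smoothing.

(* On underlying modules f(e) = f and g(e) = g. *)
Definition pinterleaved (e : {nonneg R}) (M N : persmod) : Prop :=
  exists (f : pmor M (pshift N e)) (g : pmor N (pshift M e)),
    (forall x : M, g (f x) = psmooth M (2 * e%:num)%:nng x) /\
    (forall y : N, f (g y) = psmooth N (2 * e%:num)%:nng y).

End PersistenceModules.

Arguments pgr {R n k} p a _.

Section Pseudometrics.
Variable R : realType.

Record pseudometric (T : Type) := Pseudometric {
  pdist :> T -> T -> \bar R;
  pdist_ge0 : forall x y, (0 <= pdist x y)%E;
  pdist_refl : forall x, pdist x x = 0%E;
  pdist_sym : forall x y, pdist x y = pdist y x;
  pdist_triangle : forall x y z, (pdist x z <= pdist x y + pdist y z)%E
}.

Section InfDistance.
Variables (T : Type) (I : {nonneg R} -> T -> T -> Prop).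
Hypotheses (I_refl : forall x, I 0%:nng x x)
  (I_sym : forall e x y, I e x y -> I e y x)
  (I_trans : forall d e x y z, I d x y -> I e y z ->
     I (d%:num + e%:num)%:nng x z).

Definition inf_dist (x y : T) : \bar R :=
  ereal_inf [set (e%:num)%:E | e in [set e : {nonneg R} | I e x y]].

Lemma inf_dist_ge0 x y : (0 <= inf_dist x y)%E.
Proof. by apply: le_ereal_inf_tmp => _ [e _ <-]; rewrite lee_fin. Qed.

Lemma inf_dist_refl x : inf_dist x x = 0%E.
Proof.
apply/eqP; rewrite eq_le inf_dist_ge0 andbT.
by apply: ereal_inf_lbound; exists 0%:nng => //; exact: I_refl.
Qed.

Lemma inf_dist_sym x y : inf_dist x y = inf_dist y x.
Proof.
by congr ereal_inf; apply/seteqP; split=> _ [e Ie <-]; exists e => //; exact: I_sym.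
Qed.

Lemma inf_dist_triangle x y z :
  (inf_dist x z <= inf_dist x y + inf_dist y z)%E.
Proof.
have [->|xy] := eqVneq (inf_dist x y) +oo%E.
  by rewrite addye ?leey // gt_eqF // (lt_le_trans _ (inf_dist_ge0 _ _)) ?ltNy0.
have [->|yz] := eqVneq (inf_dist y z) +oo%E.
  by rewrite addey ?leey // gt_eqF // (lt_le_trans _ (inf_dist_ge0 _ _)) ?ltNy0.
have fxy : inf_dist x y \is a fin_num by rewrite ge0_fin_numE ?inf_dist_ge0 ?ltey.
have fyz : inf_dist y z \is a fin_num by rewrite ge0_fin_numE ?inf_dist_ge0 ?ltey.
apply/lee_addgt0Pr => r r0; have r20 : 0 < r / 2 by rewrite divr_gt0.
have [_ [d Id <-] dlt] := lb_ereal_inf_adherent r20 fxy.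
have [_ [e Ie <-] elt] := lb_ereal_inf_adherent r20 fyz.
apply: (@le_trans _ _ (d%:num + e%:num)%:E).
  by apply: ereal_inf_lbound; exists (d%:num + e%:num)%:nng => //; exact: I_trans Id Ie.
by rewrite (splitr r) !EFinD addeACA; exact: leeD (ltW dlt) (ltW elt).
Qed.

Definition inf_pseudometric : pseudometric T :=
  Pseudometric inf_dist_ge0 inf_dist_refl inf_dist_sym inf_dist_triangle.

End InfDistance.

(* A relative structure on Y, and stable and optimal pseudometrics. *)
Record relative_structure (Y : Type) := RelativeStructure {
  rs_index : Type;
  rs_space : rs_index -> Type;
  rs_dist : forall s, pseudometric (rs_space s);
  rs_fun : forall s, rs_space s -> Y
}.

Section Optimality.
Variables (Y : Type) (RS : relative_structure Y).

Definition rs_im (y : Y) : Prop := exists (s : rs_index RS) (x : rs_space s), rs_fun x = y.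

Definition rs_stable (d : pseudometric Y) : Prop :=
  forall (s : rs_index RS) (x1 x2 : rs_space s),
    (d (rs_fun x1) (rs_fun x2) <= rs_dist s x1 x2)%E.

Definition rs_optimal (d : pseudometric Y) : Prop :=
  rs_stable d /\
  forall d' : pseudometric Y, rs_stable d' ->
    forall y1 y2, rs_im y1 -> rs_im y2 -> (d' y1 y2 <= d y1 y2)%E.

End Optimality.
End Pseudometrics.

Section InterleavingDistance.
Variables (R : realType) (n : nat) (k : fieldType).
Local Notation persmod := (persmod R n k).
Implicit Types M N P : persmod.

Record isoclass := IsoClass {
  isoclass_mem :> persmod -> Prop;
  isoclassP : exists M, isoclass_mem = piso M
}.

Definition isoclass_of M : isoclass := IsoClass (ex_intro _ M erefl).

(* Interleaving is invariant under isomorphism (see [interleaved_of]), so the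
   choice of representatives is immaterial. *)
Definition interleaved (e : {nonneg R}) (c d : isoclass) : Prop :=
  exists M N, [/\ c M, d N & pinterleaved e M N].

Lemma pmor_comp_gr M N P (f : pmor M N) (g : pmor N P) a x :
  pgr M a x -> pgr P a ((g \o f) x).
Proof. by move=> ax; apply/pmor_gr/pmor_gr. Qed.

Definition pmor_comp M N P (f : pmor M N) (g : pmor N P) : pmor M P :=
  Pmor (@pmor_comp_gr _ _ _ f g).

Definition pmor_id M : pmor M M := @Pmor _ _ _ M M idfun (fun _ _ h => h).

Lemma piso_refl M : piso M M.
Proof. by exists (pmor_id M), (pmor_id M). Qed.

Lemma piso_sym M N : piso M N -> piso N M.
Proof. by move=> [f [g [fg gf]]]; exists g, f. Qed.

Lemma piso_trans M N P : piso M N -> piso N P -> piso M P.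
Proof.
move=> [f [g [fg gf]]] [f' [g' [fg' gf']]].
by exists (pmor_comp f f'), (pmor_comp g' g); split=> x /=; rewrite ?fg' ?gf.
Qed.

Lemma pshift_mor_subproof e M N (f : pmor M N) a x :
  pgr (pshift M e) a x -> pgr (pshift N e) a (pmor_fun f x).
Proof. exact: (@pmor_gr _ _ _ _ _ f (a + epsv e)). Qed.

(* f(e) *)
Definition pshift_mor e M N (f : pmor M N) : pmor (pshift M e) (pshift N e) :=
  @Pmor _ _ _ (pshift M e) (pshift N e) (pmor_fun f) (@pshift_mor_subproof e M N f).

Lemma pinterleaved_iso e M M' N N' :
  piso M M' -> piso N N' -> pinterleaved e M N -> pinterleaved e M' N'.
Proof.
move=> [p [p' [pp' p'p]]] [q [q' [qq' q'q]]] [f [g [gf fg]]].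
exists (pmor_comp (pmor_comp p' f) (pshift_mor e q)).
exists (pmor_comp (pmor_comp q' g) (pshift_mor e p)).
split=> x /=.
  by rewrite qq' gf /= /psmooth_fun linearZ /= p'p.
by rewrite pp' fg /= /psmooth_fun linearZ /= q'q.
Qed.

Lemma isoclass_iso (c : isoclass) M N : c M -> c N -> piso M N.
Proof.
by have [P ->] := isoclassP c => PM PN; exact: piso_trans (piso_sym PM) PN.
Qed.

Lemma interleaved_of e M N :
  interleaved e (isoclass_of M) (isoclass_of N) <-> pinterleaved e M N.
Proof.
split=> [[M' [N' [MM' NN' i]]]|i]; last by exists M, N; split=> //; exact: piso_refl.
exact: pinterleaved_iso (piso_sym MM') (piso_sym NN') i.
Qed.

Lemma pinterleaved_trans d e M N P : pinterleaved d M N -> pinterleaved e N P ->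
  pinterleaved (d%:num + e%:num)%:nng M P.
Proof.
move=> [f [g [gf fg]]] [f' [g' [gf' fg']]].
have Eeps a : a + epsv (d%:num + e%:num)%:nng = a + epsv d + epsv e :> 'rV[R]_n.
  by rewrite -addrA; congr (_ + _); apply/rowP => i; rewrite !mxE.
have h1 a x : pgr M a x -> pgr (pshift P (d%:num + e%:num)%:nng) a ((f' \o f) x).
  by move=> /(pmor_gr f) /(@pmor_gr _ _ _ _ _ f' (a + epsv d)); rewrite /= Eeps.
have h2 a x : pgr P a x -> pgr (pshift M (d%:num + e%:num)%:nng) a ((g \o g') x).
  by move=> /(pmor_gr g') /(@pmor_gr _ _ _ _ _ g (a + epsv e)); rewrite /= Eeps addrAC.
have scaleCA (V : lmodType (Bring R n k)) b c (x : V) : b *: (c *: x) = (c * b) *: x.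
  by rewrite scalerA mulrC.
have c0 (r : {nonneg R}) : vle 0 (const_mx (2 * r%:num) : 'rV[R]_n).
  exact: (epsv_ge0 (2 * r%:num)%:nng).
have Exp : xpow (const_mx (2 * (d%:num + e%:num)) : 'rV[R]_n) =
    xpow (const_mx (2 * d%:num)) * xpow (const_mx (2 * e%:num)) :> Bring R n k.
  rewrite (_ : const_mx (2 * (d%:num + e%:num)) =
    const_mx (2 * d%:num) + const_mx (2 * e%:num)); first exact: xpowD.
  by apply/rowP => i; rewrite !mxE mulrDr.
exists (@Pmor _ _ _ M (pshift P _) _ h1), (@Pmor _ _ _ P (pshift M _) _ h2).
split=> x /=.
  rewrite gf' /= /psmooth_fun linearZ /= gf /= /psmooth_fun /epsv /= Exp.
  exact: scaleCA.
rewrite fg /= /psmooth_fun linearZ /= fg' /= /psmooth_fun /epsv /= Exp.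
exact: scalerA.
Qed.

Lemma pinterleaved_refl M : pinterleaved 0%:nng M M.
Proof.
have E0 : epsv 0%:nng = 0 :> 'rV[R]_n by apply/rowP => i; rewrite !mxE.
have h a x : pgr M a x -> pgr (pshift M 0%:nng) a (idfun x).
  by rewrite /= E0 addr0.
exists (@Pmor _ _ _ M (pshift M _) _ h), (@Pmor _ _ _ M (pshift M _) _ h).
have E x : psmooth_fun (2 * 0%:nng%:num)%:nng x = x :> M.
  rewrite /psmooth_fun (_ : epsv _ = expo_zero R n).
    by rewrite xpowE -[mkmalgU _ _]/(1 : Bring R n k) scale1r.
  by apply/rowP => i; rewrite !mxE /= mulr0.
by split=> x /=; rewrite E.
Qed.

Lemma interleaved_refl c : interleaved 0%:nng c c.
Proof.
have [M cM] := isoclassP c.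
have cMM : c M by rewrite cM; exact: piso_refl.
by exists M, M; split=> //; exact: pinterleaved_refl.
Qed.

Lemma interleaved_sym e c d : interleaved e c d -> interleaved e d c.
Proof.
by move=> [M [N [cM dN [f [g [gf fg]]]]]]; exists N, M; split=> //; exists g, f.
Qed.

Lemma interleaved_trans e e' c c' c'' :
  interleaved e c c' -> interleaved e' c' c'' ->
  interleaved (e%:num + e'%:num)%:nng c c''.
Proof.
move=> [M [N [cM cN i]]] [N' [P [cN' cP j]]]; exists M, P; split=> //.
apply: pinterleaved_trans i (pinterleaved_iso _ (piso_refl _) j).
exact: isoclass_iso cN' cN.
Qed.

Definition dI : pseudometric R isoclass :=
  inf_pseudometric interleaved_refl interleaved_sym interleaved_trans.

Lemma dIE M N : dI (isoclass_of M) (isoclass_of N) =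
  ereal_inf [set (e%:num)%:E | e in [set e | pinterleaved e M N]].
Proof.
congr ereal_inf; congr image.
by apply/funext => e; apply/propext/interleaved_of.
Qed.

End InterleavingDistance.

Section Filtrations.
Variables (R : realType) (n : nat).
Local Notation vec := 'rV[R]_n.

Record filtration := Filtration {
  fspace :> vec -> topologicalType;
  ftrans : forall a b, vle a b -> continuousType (fspace a) (fspace b);
  ftrans_id : forall a (aa : vle a a), ftrans aa =1 id;
  ftrans_comp : forall a b c (ab : vle a b) (bc : vle b c) (ac : vle a c),
    ftrans bc \o ftrans ab =1 ftrans ac
}.

Record fmor (X Y : filtration) := Fmor {
  fmor_fun :> forall a, continuousType (X a) (Y a);
  fmor_trans : forall a b (ab : vle a b),
    fmor_fun b \o ftrans X ab =1 ftrans Y ab \o fmor_fun a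
}.

(* X(e) *)
Definition fshift (X : filtration) (e : {nonneg R}) : filtration :=
  @Filtration (fun a => X (a + epsv e))
    (fun a b ab => ftrans X (vle_add2r (epsv e) ab))
    (fun a aa => ftrans_id _)
    (fun a b c ab bc ac => ftrans_comp _ _ _).

(* S(X, 2e) is valued in X_(a + 2e), and g(e) \o f in X_((a + e) + e): equal but
   not convertible indices.  They are identified by taking the transition map
   of X from a to (a + e) + e for S(X, 2e)_a. *)
Definition finterleaved (e : {nonneg R}) (X Y : filtration) : Prop :=
  exists (f : fmor X (fshift Y e)) (g : fmor Y (fshift X e)), forall a,
    g (a + epsv e) \o f a =1 ftrans X (vle_epsv2 a e) /\
    f (a + epsv e) \o g a =1 ftrans Y (vle_epsv2 a e).

Lemma ftrans_merge (X : filtration) a b c (ab : vle a b) (bc : vle b c) x :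
  ftrans X bc (ftrans X ab x) = ftrans X (vle_trans ab bc) x.
Proof. exact: ftrans_comp. Qed.

Lemma ftrans_irr (X : filtration) a b (h h' : vle a b) : ftrans X h = ftrans X h'.
Proof. by congr ftrans; exact: bool_irrelevance. Qed.

Lemma ftransC (X : filtration) a b c d (ab : vle a b) (bd : vle b d)
    (ac : vle a c) (cd : vle c d) x :
  ftrans X bd (ftrans X ab x) = ftrans X cd (ftrans X ac x).
Proof.
have ad := vle_trans ab bd.
by have /= -> := ftrans_comp ab bd ad x; have /= -> := ftrans_comp ac cd ad x.
Qed.

Lemma vle_eq (a b : vec) : a = b -> vle a b.
Proof. by move=> ->; exact: vle_refl. Qed.

Lemma fsmooth_trans X e a b (ab : vle a b) :
  ftrans X (vle_epsv b e) \o ftrans X ab =1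
    ftrans (fshift X e) ab \o ftrans X (vle_epsv a e).
Proof. by move=> x; exact: ftransC. Qed.

(* S(X, e) *)
Definition fsmooth X e : fmor X (fshift X e) :=
  @Fmor X (fshift X e) (fun a => ftrans X (vle_epsv a e)) (@fsmooth_trans X e).

Lemma finterleaved_refl X : finterleaved 0%:nng X X.
Proof.
by exists (fsmooth X _), (fsmooth X _) => a; split=> x /=; exact: ftrans_comp.
Qed.

Lemma finterleaved_sym e X Y : finterleaved e X Y -> finterleaved e Y X.
Proof. by move=> [f [g fg]]; exists g, f => a; have [? ?] := fg a. Qed.

Lemma epsvD (d e : {nonneg R}) (a : vec) :
  a + epsv d + epsv e = a + epsv (d%:num + e%:num)%:nng.
Proof. by rewrite -addrA; congr (_ + _); apply/rowP => i; rewrite !mxE. Qed.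

Lemma epsvDC (d e : {nonneg R}) (a : vec) :
  a + epsv e + epsv d = a + epsv (d%:num + e%:num)%:nng.
Proof. by rewrite -epsvD addrAC. Qed.

Section Comp.
Variables (d e : {nonneg R}) (X Y Z : filtration).
Variables (f : fmor X (fshift Y d)) (f' : fmor Y (fshift Z e)).
Variable r : {nonneg R}.
Hypothesis der : forall a : vec, a + epsv d + epsv e = a + epsv r.

Definition fcomp_fun a : continuousType (X a) (fshift Z r a) :=
  ftrans Z (vle_eq (der a)) \o (f' (a + epsv d) \o f a).

Lemma fcomp_trans a b (ab : vle a b) :
  fcomp_fun b \o ftrans X ab =1 ftrans (fshift Z r) ab \o fcomp_fun a.
Proof.
move=> x /=; have /= -> := fmor_trans f ab x.
have /= -> := fmor_trans f' (vle_add2r (epsv d) ab) (f a x).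
exact: ftransC.
Qed.

Definition fcomp : fmor X (fshift Z r) := Fmor fcomp_trans.
End Comp.

Lemma fcomp_smooth d e X Y Z (f : fmor X (fshift Y d)) (g : fmor Y (fshift X d))
    (f' : fmor Y (fshift Z e)) (g' : fmor Z (fshift Y e)) r
    (der : forall a, a + epsv d + epsv e = a + epsv r)
    (edr : forall a, a + epsv e + epsv d = a + epsv r) :
  (forall a, g (a + epsv d) \o f a =1 ftrans X (vle_epsv2 a d)) ->
  (forall a, g' (a + epsv e) \o f' a =1 ftrans Y (vle_epsv2 a e)) ->
  forall a, fcomp g' g edr (a + epsv r) \o fcomp f f' der a
    =1 ftrans X (vle_epsv2 a r).
Proof.
move=> gf gf' a x.
rewrite [LHS](fmor_trans (fcomp g' g edr) (vle_eq (der a)) _) /=.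
have /= -> := gf' (a + epsv d) (f a x).
have /= -> := fmor_trans g (vle_epsv2 (a + epsv d) e) (f a x).
have /= -> := gf a x.
by rewrite !ftrans_merge; congr (_ x); congr (Continuous.sort _); exact: ftrans_irr.
Qed.

Lemma finterleaved_trans d e X Y Z : finterleaved d X Y -> finterleaved e Y Z ->
  finterleaved (d%:num + e%:num)%:nng X Z.
Proof.
move=> [f [g fg]] [f' [g' fg']].
exists (fcomp f f' (epsvD d e)), (fcomp g' g (epsvDC d e)) => a; split.
  by apply: fcomp_smooth => b; [case: (fg b)|case: (fg' b)].
by apply: fcomp_smooth => b; [case: (fg' b)|case: (fg b)].
Qed.

Definition dSI : pseudometric R filtration :=
  inf_pseudometric finterleaved_refl finterleaved_sym finterleaved_trans.

End Filtrations.

Section FreeModules.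
Variable k : fieldType.

(* the k-linear extension of a map of bases *)
Definition free_map (K L : choiceType) (h : K -> L) (c : malg K k) : malg L k :=
  \sum_(s <- msupp c) mkmalgU (h s) (mcoeff s c).

Section Theory.
Variables (K L : choiceType) (h : K -> L).

Lemma free_mapEw (d : {fset K}) (c : malg K k) : (msupp c `<=` d)%fset ->
  free_map h c = \sum_(s <- d) mkmalgU (h s) (mcoeff s c).
Proof.
move=> cd; rewrite /free_map (big_fset_incl _ cd) //= => s _ /mcoeff_outdom ->.
exact: raddf0.
Qed.

Lemma free_map_linear : linear (free_map h).
Proof.
move=> a c c'; pose d := (msupp c `|` msupp c' `|` msupp (a *: c + c'))%fset.
rewrite !(@free_mapEw d).
  rewrite scaler_sumr -big_split /=; apply: eq_bigr => s _.
  by apply/malgP => t; rewrite !(mcoeffD, mcoeffZ, mcoeffU) mulrnDl mulrnAr.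
all: by apply/fsubsetP => s sc; rewrite !in_fsetU sc ?orbT.
Qed.

HB.instance Definition _ :=
  GRing.isLinear.Build k (malg K k) (malg L k) *:%R (free_map h) free_map_linear.

Lemma free_mapU s x : free_map h (mkmalgU s x) = mkmalgU (h s) x.
Proof. by rewrite (@free_mapEw [fset s]%fset) ?msuppU_le// big_seq_fset1 mcoeffUU. Qed.

End Theory.

Lemma free_map_comp (K L M : choiceType) (h : K -> L) (h' : L -> M) c :
  free_map h' (free_map h c) = free_map (h' \o h) c.
Proof.
rewrite [free_map h c]/free_map raddf_sum; apply: eq_bigr => s _; exact: free_mapU.
Qed.

Lemma free_map_id (K : choiceType) (c : malg K k) : free_map id c = c.
Proof. by rewrite [RHS]monalgE. Qed.

Lemma eq_free_map (K L : choiceType) (h h' : K -> L) : h =1 h' ->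
  free_map h =1 free_map h'.
Proof. by move=> hh c; apply: eq_bigr => s _; rewrite hh. Qed.

End FreeModules.

Section Homology.
Variables (k : fieldType) (C2 C1 C0 : lmodType k).
Variables (d2 : {linear C2 -> C1}) (d1 : {linear C1 -> C0}).

Definition cycle_pred : {pred C1} := fun c => d1 c == 0.

Lemma cycle_submod_closed : submod_closed cycle_pred.
Proof.
split; rewrite ?unfold_in ?linear0 // => a x y; rewrite !unfold_in.
by move=> /eqP dx /eqP dy; rewrite linearP dx dy scaler0 addr0.
Qed.

HB.instance Definition _ :=
  GRing.isSubmodClosed.Build k C1 cycle_pred cycle_submod_closed.

Record cycles := Cycles { cycle_val : C1; _ : cycle_val \in cycle_pred }.
HB.instance Definition _ := [isSub for cycle_val].
HB.instance Definition _ := [Choice of cycles by <:].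
HB.instance Definition _ := [SubChoice_isSubLmodule of cycles by <:].

Definition boundary_pred : {pred cycles} := fun z => `[< exists c, val z = d2 c >].

Lemma boundary_submod_closed : submod_closed boundary_pred.
Proof.
split; rewrite ?unfold_in; first by apply/asboolP; exists 0; rewrite !linear0.
move=> a x y; rewrite !unfold_in => /asboolP[c xc] /asboolP[c' yc'].
by apply/asboolP; exists (a *: c + c'); rewrite !linearP /= xc yc'.
Qed.

HB.instance Definition _ :=
  GRing.isSubmodClosed.Build k cycles boundary_pred boundary_submod_closed.

(* ker d1 / (im d2 :&: ker d1) *)
Definition homology := Quotient.quot boundary_pred.
HB.instance Definition _ := GRing.Zmodule.on homology.
HB.instance Definition _ := Quotient.on homology.

Definition hclass (z : cycles) : homology := (\pi_homology z)%qT.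

Lemma hclass_eq z z' : hclass z = hclass z' <-> exists c, val z - val z' = d2 c.
Proof.
split.
  by move=> /eqP; rewrite -Quotient.idealrBE => /asboolP [c]; rewrite linearB; exists c.
move=> [c zz']; apply/eqP; rewrite -Quotient.idealrBE; apply/asboolP.
by exists c; rewrite linearB.
Qed.

Lemma hclassD : {morph hclass : x y / x + y}.
Proof. by move=> x y; rewrite /hclass !piE. Qed.

Lemma hreprK (x : homology) : hclass (repr x) = x.
Proof. exact: reprK. Qed.

Definition hscale (a : k) (x : homology) : homology := hclass (a *: repr x).

Lemma hclassZ a z : hclass (a *: z) = hscale a (hclass z).
Proof.
apply/hclass_eq; have /hclass_eq[c zc] : hclass z = hclass (repr (hclass z)) by rewrite hreprK.
by exists (a *: c); rewrite [RHS]linearZ /= -zc scalerBr.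
Qed.

Lemma hscaleA a b x : hscale a (hscale b x) = hscale (a * b) x.
Proof. by rewrite -[x]hreprK -!hclassZ scalerA. Qed.

Lemma hscale1 : left_id 1 hscale.
Proof. by move=> x; rewrite -[x]hreprK -!hclassZ scale1r. Qed.

Lemma hscaleDr : right_distributive hscale +%R.
Proof.
by move=> a x y; rewrite -[x]hreprK -[y]hreprK -hclassD -!hclassZ scalerDr hclassD.
Qed.

Lemma hscaleDl x : {morph hscale^~ x : a b / a + b}.
Proof. by move=> a b; rewrite -[x]hreprK -!hclassZ scalerDl hclassD. Qed.

HB.instance Definition _ := GRing.Zmodule_isLmodule.Build k homology
  hscaleA hscale1 hscaleDr hscaleDl.

End Homology.

Section HomologyMap.
Variables (k : fieldType) (C2 C1 C0 D2 D1 D0 : lmodType k).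
Variables (c2 : {linear C2 -> C1}) (c1 : {linear C1 -> C0}).
Variables (d2 : {linear D2 -> D1}) (d1 : {linear D1 -> D0}).
Variables (f2 : {linear C2 -> D2}) (f1 : {linear C1 -> D1}) (f0 : {linear C0 -> D0}).
Hypotheses (f2P : forall x, f1 (c2 x) = d2 (f2 x))
           (f1P : forall x, f0 (c1 x) = d1 (f1 x)).

Lemma cycle_map_subproof (z : cycles c1) : f1 (val z) \in cycle_pred d1.
Proof. by case: z => z /= /eqP z0; rewrite unfold_in -f1P z0 linear0. Qed.

Definition cycle_map (z : cycles c1) : cycles d1 := Cycles (cycle_map_subproof z).

Definition homology_map (x : homology c2 c1) : homology d2 d1 :=
  hclass d2 (cycle_map (repr x)).

Lemma homology_mapE z : homology_map (hclass c2 z) = hclass d2 (cycle_map z).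
Proof.
apply/hclass_eq; have /hclass_eq[c zc] : hclass c2 (repr (hclass c2 z)) = hclass c2 z.
  exact: hreprK.
by exists (f2 c); rewrite -f2P -zc linearB.
Qed.

Lemma homology_map_linear : linear homology_map.
Proof.
move=> a x y; rewrite -[x]hreprK -[y]hreprK.
rewrite -[a *: _]/(hscale a _) -hclassZ -hclassD !homology_mapE.
rewrite -[a *: _ in RHS]/(hscale a _) -hclassZ -hclassD; congr (hclass _ _).
by apply/val_inj; rewrite /= linearP.
Qed.

End HomologyMap.

Section SingularHomology.
Variables (R : realType) (k : fieldType).

Definition simplex (m : nat) : set 'rV[R]_m.+1 :=
  [set x | (forall i, 0 <= x ord0 i) /\ \sum_i x ord0 i = 1].
Arguments simplex : clear implicits.

Definition Delta (m : nat) : topologicalType := set_type (simplex m).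

(* the j-th face of Delta^(m+1): insert a zero j-th barycentric coordinate *)
Definition face_vec m (j : 'I_m.+2) (x : 'rV[R]_m.+1) : 'rV[R]_m.+2 :=
  \row_i oapp (x ord0) 0 (unlift j i).

Lemma face_vec_simplex m j x : x \in simplex m -> face_vec j x \in simplex m.+1.
Proof.
move=> /set_mem[x0 x1]; apply/mem_set; split=> [i|].
  by rewrite mxE; case: unliftP => [i'|] _ //=.
rewrite (bigD1_ord j) //= mxE unlift_none /= add0r -x1.
by apply: eq_bigr => i _; rewrite mxE liftK.
Qed.

Definition face_fun m (j : 'I_m.+2) (x : Delta m) : Delta m.+1 :=
  exist _ (face_vec j (sval x)) (face_vec_simplex j (svalP x)).

Lemma face_vec_continuous m (j : 'I_m.+2) : continuous (@face_vec m j).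
Proof.
move=> x A [P Px PA].
have : \forall y \near x, forall i, P ord0 i (face_vec j y ord0 i).
  apply: (@filter_forall _ _ (fun i y => P ord0 i (face_vec j y ord0 i)) _ (nbhs_filter x)) => i.
  have := Px ord0 i; rewrite mxE.
  case E: (unlift j i) => [i'|] /= Pi.
    have := coord_continuous (i := ord0) (j := i') Pi.
    by apply: (@filterS _ (nbhs x) (nbhs_filter x)) => y /=; rewrite mxE E.
  apply: (@filterE _ (nbhs x) (nbhs_filter x)) => y.
  by rewrite mxE E; exact: nbhs_singleton Pi.
by apply: (@filterS _ (nbhs x) (nbhs_filter x)) => y Py; apply: PA => a b; rewrite [a]ord1.
Qed.

Lemma face_continuous m (j : 'I_m.+2) : continuous (@face_fun m j).
Proof.
apply: continuous_comp_initial => x.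
apply: (@continuous_comp _ _ _ set_val (@face_vec m j)).
  exact: initial_continuous.
exact: face_vec_continuous.
Qed.

Definition face m (j : 'I_m.+2) : continuousType (Delta m) (Delta m.+1) :=
  mkcts (@face_continuous m j).

Section Chains.
Variable X : topologicalType.

Definition sing (m : nat) : choiceType := continuousType (Delta m) X.

Definition chain (m : nat) : lmodType k := malg (sing m) k.

Definition sface m (j : 'I_m.+2) (s : sing m.+1) : sing m := s \o face j.

(* the boundary C_(m+1) -> C_m, and the zero map for m = 0 *)
Definition boundary_succ m (c : chain m.+1) : chain m :=
  \sum_(j < m.+2) (-1) ^+ j *: free_map (sface j) c.

Definition boundary m : chain m -> chain m.-1 :=
  match m with 0%N => fun=> 0 | m'.+1 => @boundary_succ m' end.

Lemma boundary_succ_linear m : linear (@boundary_succ m).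
Proof.
move=> a c c'; rewrite /boundary_succ scaler_sumr -big_split /=.
by apply: eq_bigr => j _; rewrite linearP scalerDr !scalerA mulrC.
Qed.

Lemma boundary_linear m : linear (@boundary m).
Proof.
case: m => [|m]; last exact: boundary_succ_linear.
by move=> a c c'; rewrite /= scaler0 addr0.
Qed.

HB.instance Definition _ m :=
  GRing.isLinear.Build k (chain m) (chain m.-1) *:%R (@boundary m) (@boundary_linear m).

(* H_i(X; k) *)
Definition sing_homology (i : nat) : lmodType k :=
  homology (@boundary i.+1) (@boundary i).

End Chains.

Section Functoriality.
Variables (X Y : topologicalType) (f : continuousType X Y).

Definition sing_map m (s : sing X m) : sing Y m := f \o s.

Definition chain_map m : chain X m -> chain Y m := free_map (@sing_map m).
HB.instance Definition _ m := GRing.Linear.on (@chain_map m).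

Lemma chain_map_boundary m c :
  chain_map (@boundary X m c) = boundary (@chain_map m c).
Proof.
case: m c => [|m] c; first exact: linear0.
rewrite /= /boundary_succ linear_sum; apply: eq_bigr => j _.
rewrite linearZ /= /chain_map !free_map_comp; congr (_ *: _).
by apply: eq_free_map => s; apply/continuousEP.
Qed.

Definition sing_homology_map i : sing_homology X i -> sing_homology Y i :=
  @homology_map k _ _ _ _ _ _ (@boundary X i.+1) (@boundary X i)
    (@boundary Y i.+1) (@boundary Y i)
    (@chain_map i) (@chain_map i.-1) (@chain_map_boundary i).

Lemma sing_homology_map_linear i : linear (@sing_homology_map i).
Proof.
exact: (@homology_map_linear k _ _ _ _ _ _ _ _ _ _ (@chain_map i.+1) _ _
  (@chain_map_boundary i.+1)).
Qed.

HB.instance Definition _ i := GRing.isLinear.Build k (sing_homology X i)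
  (sing_homology Y i) *:%R (@sing_homology_map i) (@sing_homology_map_linear i).

Lemma sing_homology_mapE i (z : cycles (@boundary X i)) (z' : cycles (@boundary Y i)) :
  chain_map (val z) = val z' ->
  sing_homology_map (hclass (@boundary X i.+1) z) = hclass (@boundary Y i.+1) z'.
Proof.
move=> zz'; rewrite /sing_homology_map.
rewrite (@homology_mapE k _ _ _ _ _ _ _ _ _ _ (@chain_map i.+1) _ _
  (@chain_map_boundary i.+1)).
by congr hclass; apply/val_inj.
Qed.

End Functoriality.

Lemma sing_homology_map_id (X : topologicalType) (f : continuousType X X) i : f =1 id ->
  @sing_homology_map X X f i =1 id.
Proof.
move=> f1 x; rewrite -[x]hreprK; apply: sing_homology_mapE.
rewrite -[RHS]free_map_id; apply: eq_free_map => s.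
by apply/continuousEP => t /=; rewrite f1.
Qed.

Lemma sing_homology_map_comp (X Y Z : topologicalType) (f : continuousType X Y)
    (g : continuousType Y Z) (h : continuousType X Z) i : g \o f =1 h ->
  @sing_homology_map _ _ g i \o @sing_homology_map _ _ f i =1 @sing_homology_map _ _ h i.
Proof.
move=> gf x; rewrite -[x]hreprK /=; set z := repr x.
have bP (U V : topologicalType) (p : continuousType U V) c :=
  cycle_map_subproof (@chain_map_boundary _ _ p i) c.
rewrite (@sing_homology_mapE _ _ f i z (Cycles (bP _ _ f z))) //.
rewrite (@sing_homology_mapE _ _ h i z (Cycles (bP _ _ h z))) //.
apply: sing_homology_mapE; rewrite /= /chain_map free_map_comp.
by apply: eq_free_map => s; apply/continuousEP => t; exact: gf.
Qed.

End SingularHomology.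

Section DirectSum.
Variables (R : realType) (n : nat) (k : fieldType).
Local Notation vec := 'rV[R]_n.
Local Notation B := (Bring R n k).

(* an R^n-indexed diagram of k-vector spaces *)
Record vdiagram := Vdiagram {
  dspace :> vec -> lmodType k;
  dtrans : forall a b, vle a b -> {linear dspace a -> dspace b};
  dtrans_id : forall a (aa : vle a a), dtrans aa =1 id;
  dtrans_comp : forall a b c (ab : vle a b) (bc : vle b c) (ac : vle a c),
    dtrans bc \o dtrans ab =1 dtrans ac
}.

Variable D : vdiagram.

(* the B_n-module with underlying space the direct sum of the D a *)
Record dsum := Dsum {
  dsum_fun :> forall a, D a;
  dsum_fin : finite_set [set a | dsum_fun a != 0]
}.

Lemma dsumP (f g : dsum) : (forall a, f a = g a) -> f = g.
Proof.
case: f g => [f ff] [g gf] /= fg.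
have E : f = g by exact: functional_extensionality_dep.
by rewrite E in ff *; congr Dsum; exact: Prop_irrelevance.
Qed.

HB.instance Definition _ := gen_eqMixin dsum.
HB.instance Definition _ := gen_choiceMixin dsum.

Definition dsum_zero : dsum.
Proof.
exists (fun a => 0); apply: sub_finite_set (finite_set0 _) => a /=; exact/negP/negPn.
Defined.

Definition dsum_opp (f : dsum) : dsum.
Proof.
exists (fun a => - f a); apply: sub_finite_set (dsum_fin f) => a /=.
by rewrite oppr_eq0.
Defined.

Definition dsum_add (f g : dsum) : dsum.
Proof.
exists (fun a => f a + g a).
have : finite_set ([set a | f a != 0] `|` [set a | g a != 0]).
  by rewrite finite_setU; split; exact: dsum_fin.
apply: sub_finite_set => a /= fga; apply/orP; apply: contraNT fga.
by rewrite negb_or !negbK => /andP[/eqP -> /eqP ->]; rewrite addr0.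
Defined.

Lemma dsum_addA : associative dsum_add.
Proof. by move=> f g h; apply: dsumP => a /=; rewrite addrA. Qed.
Lemma dsum_addC : commutative dsum_add.
Proof. by move=> f g; apply: dsumP => a /=; rewrite addrC. Qed.
Lemma dsum_add0 : left_id dsum_zero dsum_add.
Proof. by move=> f; apply: dsumP => a /=; rewrite add0r. Qed.
Lemma dsum_addN : left_inverse dsum_zero dsum_opp dsum_add.
Proof. by move=> f; apply: dsumP => a /=; rewrite addNr. Qed.

HB.instance Definition _ :=
  GRing.isZmodule.Build dsum dsum_addA dsum_addC dsum_add0 dsum_addN.

(* x^u maps the summand D (b - u) to D b *)
Definition dpull (u : expo R n) (f : forall a, D a) (b : vec) : D b :=
  dtrans D (vle_subr b (expoP u)) (f (b - expo_val u)).

Definition dscale_fun (p : B) (f : forall a, D a) (b : vec) : D b :=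
  \sum_(u <- msupp p) mcoeff u p *: dpull u f b.

Lemma dscale_fin p (f : dsum) : finite_set [set b | dscale_fun p f b != 0].
Proof.
have : finite_set (\bigcup_(u in [set` msupp p])
    [set a + expo_val u | a in [set a | f a != 0]]).
  by apply: bigcup_finite => // u _; exact/finite_image/dsum_fin.
apply: sub_finite_set => b /= pfb; apply: contrapT => nb.
case/eqP: pfb; rewrite /dscale_fun big_seq big1 // => u up.
suff -> : dpull u f b = 0 by rewrite scaler0.
rewrite /dpull (_ : f _ = 0) ?linear0 //; apply/eqP/negPn/negP => fbu.
by apply: nb; exists u => //; exists (b - expo_val u) => //; rewrite subrK.
Qed.

Definition dscale (p : B) (f : dsum) : dsum := Dsum (dscale_fin p f).

Lemma dscale_funEw (d : {fset expo R n}) (p : B) f b : (msupp p `<=` d)%fset ->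
  dscale_fun p f b = \sum_(u <- d) mcoeff u p *: dpull u f b.
Proof.
move=> pd; rewrite /dscale_fun (big_fset_incl _ pd) //= => u _ /mcoeff_outdom ->.
exact: scale0r.
Qed.

Lemma dscaleDr : right_distributive dscale +%R.
Proof.
move=> p f g; apply: dsumP => b /=; rewrite /dscale_fun -big_split /=.
by apply: eq_bigr => u _; rewrite -scalerDr /dpull linearD.
Qed.

Lemma dscaleU u c f b : dscale_fun (mkmalgU u c) f b = c *: dpull u f b.
Proof. by rewrite (@dscale_funEw [fset u]%fset) ?msuppU_le // big_seq_fset1 mcoeffUU. Qed.

Lemma dpull_eq (u : expo R n) (f : forall a, D a) a b (ab : vle a b) :
  b - expo_val u = a ->
  dpull u f b = dtrans D ab (f a).
Proof.
by move=> bua; subst a; rewrite /dpull; congr (GRing.Linear.sort (dtrans _ _) _); exact: bool_irrelevance.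
Qed.

Lemma dscale1 : left_id 1 dscale.
Proof.
move=> f; apply: dsumP => b; rewrite [LHS]dscaleU scale1r.
by rewrite (@dpull_eq _ _ b b (vle_refl b)) ?dtrans_id //= subr0.
Qed.

Lemma dpull_comp u v f b : dpull u (dpull v f) b = dpull (expo_add u v) f b.
Proof.
have uvb := vle_trans (vle_subr (b - expo_val u) (expoP v)) (vle_subr b (expoP u)).
rewrite (dpull_eq f uvb); last by rewrite /= opprD addrA.
exact: dtrans_comp.
Qed.

Lemma dscale_funD f b : {morph (fun p => dscale_fun p f b) : p q / p + q}.
Proof.
move=> p q; pose d := (msupp p `|` msupp q `|` msupp (p + q))%fset.
rewrite !(@dscale_funEw d).
  by rewrite -big_split /=; apply: eq_bigr => u _; rewrite mcoeffD scalerDl.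
all: by apply/fsubsetP => s sc; rewrite !in_fsetU sc ?orbT.
Qed.

Lemma dscale_fun0 f b : dscale_fun 0 f b = 0.
Proof. by rewrite /dscale_fun msupp0 big_seq_fset0. Qed.

Lemma dscaleA p q f : dscale p (dscale q f) = dscale (p * q) f.
Proof.
apply: dsumP => b /=; rewrite malgME (big_morph _ (dscale_funD f b) (dscale_fun0 f b)).
rewrite {1}/dscale_fun; apply: eq_bigr => u _.
rewrite (big_morph _ (dscale_funD f b) (dscale_fun0 f b)).
rewrite {1}/dpull {1}/dscale_fun linear_sum scaler_sumr; apply: eq_bigr => v _.
by rewrite dscaleU linearZ /= scalerA -dpull_comp.
Qed.

Lemma dscaleDl f : {morph dscale^~ f : p q / p + q}.
Proof. by move=> p q; apply: dsumP => b; exact: dscale_funD. Qed.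

HB.instance Definition _ := GRing.Zmodule_isLmodule.Build B dsum
  dscaleA dscale1 dscaleDr dscaleDl.

Definition dgr (a : vec) : set dsum := [set f | forall b, b != a -> f b = 0].

Lemma dgr0 a : dgr a 0.
Proof. by []. Qed.

Lemma BconstE c (f : dsum) b : (Bconst c *: f) b = c *: f b.
Proof.
rewrite [LHS]dscaleU (@dpull_eq _ _ b b (vle_refl b)) ?dtrans_id //= subr0 //.
Qed.

Lemma dgr_lin a c f g : dgr a f -> dgr a g -> dgr a (Bconst c *: f + g).
Proof.
move=> fa ga b ba; rewrite [LHS]/= -[X in X + _]/((Bconst c *: f) b).
by rewrite BconstE fa // ga // scaler0 addr0.
Qed.

Lemma dgr_act a i (t : R) f : 0 <= t -> dgr a f ->
  dgr (a + t *: delta_mx ord0 i) (xpow (t *: delta_mx ord0 i) *: f).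
Proof.
move=> t0 fa b ba.
have v0 : vle 0 (t *: delta_mx ord0 i : vec).
  by apply/vleP => j; rewrite !mxE mulr_ge0.
rewrite -[t *: _]/(expo_val (Expo v0)) in ba *.
rewrite xpowE [LHS]dscaleU scale1r /dpull fa ?linear0 //.
by apply: contra_neq ba => <-; rewrite subrK.
Qed.

(* the inclusion D a -> dsum *)
Definition dincl_fun (a : vec) (x : D a) (b : vec) : D b :=
  if pselect (a = b) is left e then eq_rect a (fun c => D c : Type) x b e else 0.

Lemma dincl_funE a (x : D a) : dincl_fun x a = x.
Proof.
rewrite /dincl_fun; case: pselect => // e.
by rewrite (Prop_irrelevance e erefl).
Qed.

Lemma dincl_fun0 a (x : D a) b : b != a -> dincl_fun x b = 0.
Proof.
by move=> ba; rewrite /dincl_fun; case: pselect => // e; rewrite e eqxx in ba.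
Qed.

Lemma dincl_fin a (x : D a) : finite_set [set b | dincl_fun x b != 0].
Proof.
apply: sub_finite_set (finite_set1 a) => b /= xb; apply/eqP.
by apply: contraNT xb => ba; rewrite dincl_fun0.
Qed.

Definition dincl a (x : D a) : dsum := Dsum (dincl_fin x).

Lemma dsum_sumE (I : Type) (r : seq I) (F : I -> dsum) b :
  (\sum_(i <- r) F i) b = \sum_(i <- r) F i b.
Proof. by apply: (big_morph (fun f : dsum => f b)). Qed.

Lemma fsum_dsumE (F : vec -> dsum) b : finite_set [set a | F a != 0] ->
  (forall a, dgr a (F a)) -> (\sum_(a \in [set: vec]) F a) b = F b b.
Proof.
move=> fin Fgr; pose S := [set a | F a != 0] `|` [set b].
have finS : finite_set S by rewrite finite_setU.
rewrite (fsbigTE (fset_set S)) => [|a]; last first.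
  rewrite in_fset_set // notin_setE => /not_orP[Fa _].
  by apply/eqP; apply: contra_notT Fa.
rewrite dsum_sumE (bigD1_seq b) ?fset_uniq //=; last first.
  by rewrite in_fset_set //; apply/mem_set; right.
by rewrite big1 ?addr0 // => a ab; apply: Fgr; rewrite eq_sym.
Qed.

Lemma dgr_direct f : exists! c : vec -> dsum,
  [/\ forall a, dgr a (c a), finite_set [set a | c a != 0]
    & f = \sum_(a \in [set: vec]) c a].
Proof.
have dinclgr a : dgr a (dincl (f a)) by move=> b ba; exact: dincl_fun0.
have fin : finite_set [set a | dincl (f a) != 0].
  apply: sub_finite_set (dsum_fin f) => a /=; apply: contra_neq => fa0.
  by apply: dsumP => b; rewrite /= /dincl_fun fa0; case: pselect => // e; subst b.
exists (fun a => dincl (f a)); split.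
  by split => //; apply: dsumP => b; rewrite fsum_dsumE //= dincl_funE.
move=> c [cgr cfin fc]; apply/funext => a; apply: dsumP => b.
have [-> {b}|ba] := eqVneq b a; last by rewrite cgr //= dincl_fun0.
by rewrite /= dincl_funE fc fsum_dsumE.
Qed.

Definition dsum_persmod : persmod R n k :=
  @Persmod R n k dsum dgr dgr0 dgr_lin dgr_direct dgr_act.

Lemma dincl_act a b (ab : vle a b) (x : D a) :
  xpow (b - a) *: (dincl x : dsum_persmod) = dincl (dtrans D ab x).
Proof.
have v0 : vle 0 (b - a).
  by have /vleP h := ab; apply/vleP => i; rewrite !mxE subr_ge0.
rewrite -[b - a]/(expo_val (Expo v0)) xpowE; apply: dsumP => c.
rewrite [LHS]dscaleU scale1r; have [->|cb] := eqVneq c b.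
  by rewrite (@dpull_eq (Expo v0) _ a b ab (subKr b a)) /= !dincl_funE.
rewrite /dpull /= !dincl_fun0 ?linear0 //.
by apply: contra_neq cb => cba; rewrite -[c](subrK (b - a)) cba addrC subrK.
Qed.

End DirectSum.

Section HomologyModule.
Variables (R : realType) (n : nat) (k : fieldType) (i : nat).

Section Diagram.
Variable X : filtration R n.

Definition hom_space (a : 'rV[R]_n) : lmodType k := sing_homology R k (X a) i.

Definition hom_trans a b (ab : vle a b) : {linear hom_space a -> hom_space b} :=
  @sing_homology_map R k (X a) (X b) (ftrans X ab) i.

Lemma hom_trans_id a (aa : vle a a) : hom_trans aa =1 id.
Proof. exact/sing_homology_map_id/ftrans_id. Qed.

Lemma hom_trans_comp a b c (ab : vle a b) (bc : vle b c) (ac : vle a c) :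
  hom_trans bc \o hom_trans ab =1 hom_trans ac.
Proof. exact/sing_homology_map_comp/ftrans_comp. Qed.

Definition hom_diagram : vdiagram R n k := Vdiagram hom_trans_id hom_trans_comp.

End Diagram.

(* H_i(X) *)
Definition persistent_homology (X : filtration R n) : persmod R n k :=
  dsum_persmod (hom_diagram X).

(* index set a singleton, space all n-filtrations with d_SI, map H_i *)
Definition R5 : relative_structure R (isoclass R n k) :=
  @RelativeStructure R (isoclass R n k) unit (fun=> filtration R n)
    (fun=> dSI R n) (fun _ X => isoclass_of (persistent_homology X)).

End HomologyModule.

(* Main.v *)
Require Import Defs.
From HB Require Import structures.
From mathcomp Require Import all_boot all_order all_algebra.
From mathcomp Require Import all_classical all_reals.
From mathcomp Require Import ereal topology normedtype sequences.
From mathcomp Require Import finmap.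
From mathcomp Require monalg.
Import -(notations) monalg.

(** For a prime field k, an additive map between k-spaces is k-linear.  This makes
    possible a functor F_i from k-spaces to topological spaces with H_i(F_i V) = V
    naturally in V.  Applying F_i pointwise to the diagram of H_i(X) gives a
    filtration with the same persistent homology, and by functoriality an
    e-interleaving of modules becomes a strong e-interleaving of filtrations, so a
    stable distance is bounded by d_I.

    F_1 V is a finite-dimensional cell complex with first homology
    V = <[a] | [a] + [b] = [a + b]>, and F_(i+1) is the suspension of F_i.  Both
    carry non-Hausdorff topologies (face poset, non-Hausdorff suspension) in which
    some points have a smallest open neighbourhood.  A simplex lying in it cones
    off to the point, continuity at the apex being automatic; thus no homotopy
    invariance is needed, and homology is computed from chains that are small with
    respect to such neighbourhoods, by barycentric subdivision. *)

Set Implicit Arguments.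
Unset Strict Implicit.
Unset Printing Implicit Defensive.

Import Order.TTheory GRing.Theory Num.Theory.
Import numFieldNormedType.Exports.
Local Open Scope classical_set_scope.
Local Open Scope ring_scope.

(** * Free modules *)

(** Filtrations and interleavings demand strict identities between maps of spaces. A space built
    from a basis of V would be functorial only up to homotopy, so F_1 takes every vector as a
    generator and every sum as a relation; a linear map then sends cells to cells on the nose. The
    price is that such a space sees V only as an abelian group: its first homology over k is the
    tensor product of V and k over the integers, which is V when k is prime. A face poset is a
    faithful model of a complex when the faces of each cell are distinct, which rules out the
    obvious complex with one vertex and a loop per vector. Three vertices joined by labelled edges
    repair this, and the vector a is represented by the loop that goes out along an edge labelled a
    and returns along the parallel edge labelled 0. *)

Lemma linear_comb (k : fieldType) (U V : lmodType k) (f : {linear U -> V})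
    (I : Type) (r : seq I) (a : I -> k) (F : I -> U) :
  f (\sum_(i <- r) a i *: F i) = \sum_(i <- r) a i *: f (F i).
Proof. by rewrite linear_sum; apply: eq_bigr => i _; rewrite linearZ. Qed.

Section FreeExtension.
Context {k : fieldType} {K : choiceType}.

Definition gen (s : K) : malg K k := mkmalgU s 1.

Definition supported (P : K -> Prop) (c : malg K k) := forall s, s \in msupp c -> P s.

Lemma chain_ind (P : K -> Prop) (Q : malg K k -> Prop) :
  Q 0 -> (forall a x y, Q x -> Q y -> Q (a *: x + y)) ->
  (forall s, P s -> Q (gen s)) -> forall c, supported P c -> Q c.
Proof.
move=> Q0 Qlin Qgen c cP; rewrite [c]monalgE big_seq.
apply: (big_ind Q) => // [x y Qx Qy|s /cP Ps].
  by have := Qlin 1 x y Qx Qy; rewrite scale1r.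
have -> : mkmalgU s (mcoeff s c) = mcoeff s c *: gen s + 0.
  by rewrite addr0; apply/malgP => t; rewrite mcoeffZ !mcoeffU mulrnAr mulr1.
by apply: Qlin => //; exact: Qgen.
Qed.

Lemma linear_genP (V : lmodType k) (f g : {linear malg K k -> V}) :
  (forall s, f (gen s) = g (gen s)) -> f =1 g.
Proof.
move=> fg c; apply: (@chain_ind (fun=> True) (fun c => f c = g c)) => //.
  by rewrite !linear0.
by move=> a x y fx fy; rewrite !linearP fx fy.
Qed.

Lemma linear_gen0 (V : lmodType k) (f : {linear malg K k -> V}) :
  (forall s, f (gen s) = 0) -> forall c, f c = 0.
Proof.
move=> f0 c; apply: (@chain_ind (fun=> True) (fun c => f c = 0)) => //.
  by rewrite linear0.
by move=> a x y fx fy; rewrite linearP fx fy scaler0 addr0.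
Qed.

Lemma supported0 P : supported P 0.
Proof. by move=> s; rewrite msupp0 in_fset0. Qed.

Lemma supportedZ P a c : supported P c -> supported P (a *: c).
Proof. by move=> cP s /(fsubsetP (msuppZ_le a c)); exact: cP. Qed.

Lemma supportedD P c c' : supported P c -> supported P c' -> supported P (c + c').
Proof.
move=> cP c'P s /(fsubsetP (msuppD_le c c')); rewrite in_fsetU.
by case/orP; [exact: cP|exact: c'P].
Qed.

Lemma supportedN P c : supported P c -> supported P (- c).
Proof. by rewrite -scaleN1r; exact: supportedZ. Qed.

Lemma supportedB P c c' : supported P c -> supported P c' -> supported P (c - c').
Proof. by move=> ? ?; apply: supportedD => //; exact: supportedN. Qed.

Lemma supported_sum P (I : Type) (r : seq I) (F : I -> malg K k) :
  (forall i, supported P (F i)) -> supported P (\sum_(i <- r) F i).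
Proof.
move=> FP; apply: (big_ind (supported P)) => //.
  exact: supported0.
exact: supportedD.
Qed.

Lemma supported_gen (P : K -> Prop) s : P s -> supported P (gen s).
Proof. by move=> Ps t; rewrite msuppU oner_eq0 in_fset1 => /eqP ->. Qed.

Lemma supportedW (P Q : K -> Prop) c : (forall s, P s -> Q s) ->
  supported P c -> supported Q c.
Proof. by move=> PQ cP s /cP/PQ. Qed.

(** The universal property of the free module. It is needed besides [free_map] because subdivision
    sends a simplex to a chain, not to a simplex. *)
Definition lext (V : lmodType k) (h : K -> V) (c : malg K k) : V :=
  \sum_(s <- msupp c) mcoeff s c *: h s.

Section Lext.
Variables (V : lmodType k) (h : K -> V).

Lemma lextEw (d : {fset K}) (c : malg K k) : (msupp c `<=` d)%fset ->
  lext h c = \sum_(s <- d) mcoeff s c *: h s.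
Proof.
move=> cd; rewrite /lext (big_fset_incl _ cd) //= => s _ /mcoeff_outdom ->.
exact: scale0r.
Qed.

Lemma lext_linear : linear (lext h).
Proof.
move=> a c c'; pose d := (msupp c `|` msupp c' `|` msupp (a *: c + c'))%fset.
rewrite !(@lextEw d).
  rewrite scaler_sumr -big_split /=; apply: eq_bigr => s _.
  by rewrite mcoeffD mcoeffZ scalerDl scalerA.
all: by apply/fsubsetP => s sc; rewrite !in_fsetU sc ?orbT.
Qed.

HB.instance Definition _ :=
  GRing.isLinear.Build k (malg K k) V *:%R (lext h) lext_linear.

Lemma lext_gen s : lext h (gen s) = h s.
Proof. by rewrite (@lextEw [fset s]%fset) ?msuppU_le// big_seq_fset1 mcoeffUU scale1r. Qed.

End Lext.

Lemma supported_in (P Q : K -> Prop) c : supported P c -> supported Q c ->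
  supported (fun s => P s /\ Q s) c.
Proof. by move=> cP cQ s sc; split; [exact: cP|exact: cQ]. Qed.

Lemma supported_split (P Q : K -> Prop) c : supported (fun s => P s \/ Q s) c ->
  exists c1 c2, [/\ c = c1 + c2, supported P c1 & supported Q c2].
Proof.
pose S c := exists c1 c2, [/\ c = c1 + c2, supported P c1 & supported Q c2].
apply: (@chain_ind _ S) => [|a x y [x1 [x2 [-> x1P x2Q]]] [y1 [y2 [-> y1P y2Q]]]|s].
- by exists 0, 0; split; rewrite ?addr0//; exact: supported0.
- exists (a *: x1 + y1), (a *: x2 + y2); split.
  + by rewrite scalerDr addrACA.
  + by apply: supportedD => //; exact: supportedZ.
  + by apply: supportedD => //; exact: supportedZ.
- case=> [Ps|Qs]; [exists (gen s), 0|exists 0, (gen s)].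
    by split; rewrite ?addr0//; [exact: supported_gen|exact: supported0].
  by split; rewrite ?add0r//; [exact: supported0|exact: supported_gen].
Qed.

End FreeExtension.

Section FreeExtensionMap.
Context {k : fieldType} {K L : choiceType}.

Lemma free_map_gen (h : K -> L) s : free_map h (gen s : malg K k) = gen (h s).
Proof. exact: free_mapU. Qed.

Lemma supported_lext (P : K -> Prop) (Q : L -> Prop) (h : K -> malg L k) c :
  (forall s, P s -> supported Q (h s)) -> supported P c -> supported Q (lext h c).
Proof.
move=> hP cP; apply: (@chain_ind _ _ P (fun c => supported Q (lext h c))) => //.
- by rewrite linear0; exact: supported0.
- by move=> a x y xQ yQ; rewrite linearP; apply: supportedD => //; exact: supportedZ.
- by move=> s Ps; rewrite lext_gen; exact: hP.
Qed.

Lemma supported_free_map (P : K -> Prop) (Q : L -> Prop) (h : K -> L) (c : malg K k) :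
  (forall s, P s -> Q (h s)) -> supported P c -> supported Q (free_map h c).
Proof.
move=> hP cP; apply: (@chain_ind _ _ P (fun c => supported Q (free_map h c))) => //.
- by rewrite linear0; exact: supported0.
- by move=> a x y xQ yQ; rewrite linearP; apply: supportedD => //; exact: supportedZ.
- by move=> s Ps; rewrite free_map_gen; apply: supported_gen; exact: hP.
Qed.

End FreeExtensionMap.

(** * Affine chains *)

Section StochasticMatrices.
Context {R : realType}.

Definition stoch (j m : nat) (W : 'M[R]_(j, m)) : bool :=
  [forall i, forall l, 0 <= W i l] && [forall i, \sum_l W i l == 1].

Lemma stochP j m (W : 'M[R]_(j, m)) :
  reflect ((forall i l, 0 <= W i l) /\ (forall i, \sum_l W i l = 1)) (stoch W).
Proof.
apply: (iffP andP) => [[/forallP W0 /forallP W1]|[W0 W1]]; split.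
- by move=> i l; have /forallP := W0 i.
- by move=> i; exact/eqP.
- by apply/forallP => i; apply/forallP.
- by apply/forallP => i; apply/eqP.
Qed.

(* The rows of a [smx j m] are j points of Delta^m.  The case j = 0 is included:
   it makes the complex of affine chains below augmented. *)
Record smx (j m : nat) := Smx { smx_val :> 'M[R]_(j, m.+1); _ : stoch smx_val }.
HB.instance Definition _ j m := [isSub for @smx_val j m].
HB.instance Definition _ j m := [Choice of smx j m by <:].

Lemma smx_ge0 j m (W : smx j m) i l : 0 <= (W : 'M__) i l.
Proof. by case: W => W /= /stochP[]. Qed.

Lemma smx_sum1 j m (W : smx j m) i : \sum_l (W : 'M__) i l = 1.
Proof. by case: W => W /= /stochP[]. Qed.

Lemma smx_le1 j m (W : smx j m) i l : (W : 'M__) i l <= 1.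
Proof.
rewrite -(smx_sum1 W i) (bigD1 l) //= lerDl.
by apply: sumr_ge0 => l' _; exact: smx_ge0.
Qed.

Lemma smx_mul_subproof p j m (A : smx p j) (W : smx j.+1 m) :
  stoch (smx_val A *m smx_val W).
Proof.
apply/stochP; split=> [i l|i].
  by rewrite mxE; apply: sumr_ge0 => r _; rewrite mulr_ge0 // smx_ge0.
under eq_bigr do rewrite mxE.
rewrite exchange_big /=; under eq_bigr do rewrite -mulr_sumr smx_sum1 mulr1.
exact: smx_sum1.
Qed.
Definition smx_mul p j m (A : smx p j) (W : smx j.+1 m) : smx p m :=
  Smx (smx_mul_subproof A W).

Lemma smx_one_subproof m : stoch (1%:M : 'M[R]_(m.+1, m.+1)).
Proof.
apply/stochP; split=> [i l|i]; first by rewrite mxE ler0n.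
by rewrite (bigD1 i) //= big1 ?mxE ?eqxx ?addr0// => l li; rewrite mxE eq_sym (negPf li).
Qed.
Definition smx_one m : smx m.+1 m := Smx (smx_one_subproof m).

Lemma smx_del_subproof j m (i : 'I_j.+1) (W : smx j.+1 m) : stoch (row' i (smx_val W)).
Proof.
apply/stochP; split=> [r l|r]; first by rewrite mxE smx_ge0.
by under eq_bigr do rewrite mxE; exact: smx_sum1.
Qed.
Definition smx_del j m (i : 'I_j.+1) (W : smx j.+1 m) : smx j m :=
  Smx (smx_del_subproof i W).

Lemma smx_cone_subproof j m (b : smx 1 m) (W : smx j m) :
  stoch (col_mx (smx_val b) (smx_val W)).
Proof.
apply/stochP; split=> [r l|r]; case: (@split_ordP 1 j r) => r' ->.
- by rewrite col_mxEu smx_ge0.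
- by rewrite col_mxEd smx_ge0.
- by under eq_bigr do rewrite col_mxEu; exact: smx_sum1.
- by under eq_bigr do rewrite col_mxEd; exact: smx_sum1.
Qed.
Definition smx_cone j m (b : smx 1 m) (W : smx j m) : smx j.+1 m :=
  Smx (smx_cone_subproof b W).

Lemma smx_coneEu j m (b : smx 1 m) (W : smx j m) r l :
  smx_val (smx_cone b W) (lshift j r : 'I_(1 + j)) l = smx_val b r l.
Proof. exact: (@col_mxEu R 1 j). Qed.

Lemma smx_coneEd j m (b : smx 1 m) (W : smx j m) r l :
  smx_val (smx_cone b W) (rshift 1 r : 'I_(1 + j)) l = smx_val W r l.
Proof. exact: (@col_mxEd R 1 j). Qed.

Lemma bary_row_subproof j : stoch (const_mx (j.+1%:R^-1) : 'M[R]_(1, j.+1)).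
Proof.
apply/stochP; split=> [i l|i]; first by rewrite mxE invr_ge0 ler0n.
under eq_bigr do rewrite mxE.
by rewrite sumr_const card_ord -[LHS]mulr_natl mulfV // pnatr_eq0.
Qed.
Definition bary_row j : smx 1 j := Smx (bary_row_subproof j).
Definition bary j m (W : smx j.+1 m) : smx 1 m := smx_mul (bary_row j) W.

Lemma smx_mulA p q j m (A : smx p q) (B : smx q.+1 j) (W : smx j.+1 m) :
  smx_mul A (smx_mul B W) = smx_mul (smx_mul A B) W.
Proof. by apply/val_inj; rewrite /= mulmxA. Qed.

Lemma smx_mul1 j m (W : smx j.+1 m) : smx_mul (smx_one j) W = W.
Proof. by apply/val_inj; rewrite /= mul1mx. Qed.

Lemma smx_del_mul p j m (i : 'I_p.+1) (A : smx p.+1 j) (W : smx j.+1 m) :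
  smx_del i (smx_mul A W) = smx_mul (smx_del i A) W.
Proof.
apply/val_inj/matrixP => r l /=; rewrite !mxE.
by apply: eq_bigr => q _; rewrite !mxE.
Qed.

Lemma smx_cone_mul p j m (b : smx 1 j) (A : smx p j) (W : smx j.+1 m) :
  smx_mul (smx_cone b A) W = smx_cone (smx_mul b W) (smx_mul A W).
Proof.
by apply/val_inj; exact: (@mul_col_mx R 1 p j.+1 m.+1 (smx_val b) (smx_val A) (smx_val W)).
Qed.

Lemma smx_del_cone0 j m (b : smx 1 m) (W : smx j m) :
  smx_del ord0 (smx_cone b W) = W.
Proof.
apply/val_inj/matrixP => r l /=; rewrite !mxE.
case: splitP => [r' /=|r' /= [rr']]; first by rewrite ord1.
by congr (smx_val W _ _); apply/val_inj.
Qed.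

Lemma smx_del_coneS j m (b : smx 1 m) (W : smx j.+1 m) (i : 'I_j.+1) :
  smx_del (lift ord0 i) (smx_cone b W) = smx_cone b (smx_del i W).
Proof.
apply/val_inj/matrixP => r l /=; rewrite mxE !mxE.
case: splitP => s /= sE; case: splitP => t /= tE.
- by rewrite ord1 [t]ord1.
- by move: sE; rewrite /= tE ord1 /bump /= !add1n => /eqP; rewrite /bump; case: leqP.
- by move: sE; rewrite tE ord1 /bump.
- rewrite !mxE; congr (smx_val W _ _); apply/val_inj => /=.
  by move: sE; rewrite tE /bump leq0n !add1n ltnS addnS => -[->].
Qed.

Lemma smx_coneE j m (W : smx j.+1 m) : exists b W', W = smx_cone b W' :> smx j.+1 m.
Proof.
have b_sub : stoch (usubmx (smx_val W : 'M_(1 + j, _))).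
  apply/stochP; split=> [i l|i]; first by rewrite mxE smx_ge0.
  by under eq_bigr do rewrite mxE; exact: smx_sum1.
have W'_sub : stoch (dsubmx (smx_val W : 'M_(1 + j, _))).
  apply/stochP; split=> [i l|i]; first by rewrite mxE smx_ge0.
  by under eq_bigr do rewrite mxE; exact: smx_sum1.
by exists (Smx b_sub), (Smx W'_sub); apply/val_inj; rewrite /= vsubmxK.
Qed.

End StochasticMatrices.
Arguments smx : clear implicits.

Section LinearChains.
Context (R : realType) (k : fieldType) (m : nat).
Local Notation smx := (smx R).

Definition lchain (j : nat) : lmodType k := malg (smx j m) k.

Definition lbd j (c : lchain j.+1) : lchain j :=
  \sum_(i < j.+1) (-1) ^+ i *: free_map (smx_del i) c.

Lemma lbd_linear j : linear (@lbd j).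
Proof.
move=> a c c'; rewrite /lbd scaler_sumr -big_split /=.
by apply: eq_bigr => i _; rewrite linearP scalerDr !scalerA mulrC.
Qed.
HB.instance Definition _ j :=
  GRing.isLinear.Build k (lchain j.+1) (lchain j) *:%R (@lbd j) (@lbd_linear j).

Definition lcone (b : smx 1 m) j : lchain j -> lchain j.+1 :=
  free_map (@smx_cone R j m b).
HB.instance Definition _ b j := GRing.Linear.on (@lcone b j).

Lemma lbd_cone0 b (c : lchain 0) : lbd (lcone b c) = c.
Proof.
rewrite /lbd big_ord1 scale1r [lcone b c]/lcone free_map_comp -[RHS]free_map_id.
by apply: eq_free_map => W; exact: smx_del_cone0.
Qed.

(** Deleting the apex returns the base, which is the term [c]; deleting any other vertex commutes
    with coning and shifts the sign by one. *)
Lemma lbd_coneS b j (c : lchain j.+1) : lbd (lcone b c) = c - lcone b (lbd c).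
Proof.
rewrite {1}/lbd big_ord_recl scale1r [lcone b c]/lcone free_map_comp.
rewrite [X in X + _](_ : _ = c); last first.
  by rewrite -[RHS]free_map_id; apply: eq_free_map => W; exact: smx_del_cone0.
congr (_ + _); rewrite /lbd (linear_comb (@lcone b j)) /= -sumrN; apply: eq_bigr => i _.
rewrite -scaleNr /lcone !free_map_comp /bump leq0n add1n exprS mulN1r.
by apply: (congr1 (GRing.scale _)); apply: eq_free_map => W; exact: smx_del_coneS.
Qed.

(* Every simplex is the cone over its 0-th face, so [lbd_coneS] yields this by induction. *)
Lemma lbd_lbd j (c : lchain j.+2) : lbd (lbd c) = 0.
Proof.
elim: j c => [|j IHj] c.
  apply: (linear_gen0 (f := @lbd 0 \o @lbd 1)) => W /=.
  have [b [W' ->]] := smx_coneE W.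
  by rewrite -[gen _](free_map_gen (smx_cone b)) lbd_coneS linearB /= lbd_cone0 subrr.
apply: (linear_gen0 (f := @lbd j.+1 \o @lbd j.+2)) => W /=.
have [b [W' ->]] := smx_coneE W.
rewrite -[gen _](free_map_gen (smx_cone b)) lbd_coneS linearB /= lbd_coneS IHj.
by rewrite linear0 subr0 subrr.
Qed.

(* [lsd] is barycentric subdivision, [lhtp] its chain homotopy to the identity. *)
Fixpoint lsd j : lchain j -> lchain j :=
  match j with
  | 0 => id
  | j'.+1 => lext (fun W : smx j'.+1 m => lcone (bary W) (@lsd j' (lbd (gen W))))
  end.

Lemma lsd_linear j : linear (@lsd j).
Proof. by case: j => [|j] //; exact: lext_linear. Qed.
HB.instance Definition _ j :=
  GRing.isLinear.Build k (lchain j) (lchain j) *:%R (@lsd j) (@lsd_linear j).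

#[global] Arguments lsd : simpl never.

Lemma lsd0 (c : lchain 0) : lsd c = c.
Proof. by []. Qed.

Lemma lsd_gen j (W : smx j.+1 m) :
  lsd (gen W : lchain _) = lcone (bary W) (lsd (lbd (gen W))).
Proof. exact: lext_gen. Qed.

(** The cone formula leaves sd dW minus the cone on d sd dW, and by induction d sd dW = sd d dW =
    0. *)
Lemma lbd_lsd j (c : lchain j.+1) : lbd (lsd c) = lsd (lbd c).
Proof.
elim: j c => [|j IHj] c.
  apply: (@linear_genP _ _ _ (@lbd 0 \o @lsd 1) (@lsd 0 \o @lbd 0)) => W.
  by rewrite -[LHS]/(lbd (lsd (gen W))) lsd_gen !lsd0 lbd_cone0.
apply: (@linear_genP _ _ _ (@lbd j.+1 \o @lsd j.+2) (@lsd j.+1 \o @lbd j.+1)) => W.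
by rewrite -[LHS]/(lbd (lsd (gen W))) -[RHS]/(lsd (lbd (gen W))) lsd_gen lbd_coneS
  IHj lbd_lbd !linear0 addr0.
Qed.

Fixpoint lhtp j : lchain j -> lchain j.+1 :=
  match j with
  | 0 => fun=> 0
  | j'.+1 => lext (fun W : smx j'.+1 m =>
      lcone (bary W) (gen W - @lhtp j' (lbd (gen W))))
  end.

Lemma lhtp_linear j : linear (@lhtp j).
Proof.
case: j => [|j]; last exact: lext_linear.
by move=> a c c'; rewrite /= scaler0 addr0.
Qed.
HB.instance Definition _ j :=
  GRing.isLinear.Build k (lchain j) (lchain j.+1) *:%R (@lhtp j) (@lhtp_linear j).

#[global] Arguments lhtp : simpl never.

Lemma lhtp0 (c : lchain 0) : lhtp c = 0.
Proof. by []. Qed.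

Lemma lhtp_gen j (W : smx j.+1 m) :
  lhtp (gen W : lchain _) = lcone (bary W) (gen W - lhtp (lbd (gen W))).
Proof. exact: lext_gen. Qed.

(** For T W = b (W - T dW) the cone formula produces the term b (dW - d T dW); by induction the
    bracket is sd dW, whose cone is sd W. *)
Lemma lbd_lhtp j (c : lchain j.+1) : lbd (lhtp c) = c - lsd c - lhtp (lbd c).
Proof.
elim: j c => [|j IHj] c; apply: (@linear_genP _ _ _ (@lbd _ \o @lhtp _)
    ((idfun \- @lsd _) \- (@lhtp _ \o @lbd _))) => W;
    rewrite -[LHS]/(lbd (lhtp (gen W)))
      -[RHS]/(gen W - lsd (gen W) - lhtp (lbd (gen W))) lhtp_gen.
  by rewrite lbd_coneS lsd_gen lsd0 !lhtp0 !subr0.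
rewrite lbd_coneS (linearB (@lbd j.+1)) /= IHj lbd_lbd linear0 subr0 subKr lsd_gen.
by rewrite addrAC.
Qed.

Lemma supported_lbd j (P : smx j.+1 m -> Prop) (Q : smx j m -> Prop) (c : lchain j.+1) :
  (forall i W, P W -> Q (smx_del i W)) -> supported P c -> supported Q (lbd c).
Proof.
move=> PQ cP; apply: supported_sum => i; apply: supportedZ.
by apply: supported_free_map cP => W; exact: PQ.
Qed.

End LinearChains.

Section LinearChainsNaturality.
Context (R : realType) (k : fieldType) (m q : nat) (A : smx R m.+1 q).

(** Pushforward along the affine map from Delta^m to Delta^q whose vertices are the rows of [A].
    Affine maps preserve barycenters, hence commute with subdivision. *)
Definition lmulr j : lchain R k m j -> lchain R k q j :=
  free_map (fun W => smx_mul W A).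
HB.instance Definition _ j := GRing.Linear.on (@lmulr j).

Lemma lmulr_lbd j (c : lchain R k m j.+1) : lmulr (lbd c) = lbd (lmulr c).
Proof.
rewrite /lbd (linear_comb (@lmulr j)); apply: eq_bigr => i _; rewrite /= /lmulr !free_map_comp.
by apply: (congr1 (GRing.scale _)); apply: eq_free_map => W /=; rewrite smx_del_mul.
Qed.

Lemma lmulr_lcone b j (c : lchain R k m j) :
  lmulr (lcone b c) = lcone (smx_mul b A) (lmulr c).
Proof.
rewrite /lmulr /lcone !free_map_comp.
by apply: eq_free_map => W /=; rewrite smx_cone_mul.
Qed.

Lemma bary_mul j (W : smx R j.+1 m) : smx_mul (bary W) A = bary (smx_mul W A).
Proof. by rewrite /bary smx_mulA. Qed.

Lemma lmulr_lsd j (c : lchain R k m j) : lmulr (lsd c) = lsd (lmulr c).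
Proof.
elim: j c => [|j IHj] // c.
apply: (@linear_genP _ _ _ (@lmulr _ \o @lsd _ _ _ _) (@lsd _ _ _ _ \o @lmulr _)) => W.
rewrite -[LHS]/(lmulr (lsd (gen W))) -[RHS]/(lsd (lmulr (gen W))) lsd_gen
  lmulr_lcone IHj lmulr_lbd bary_mul.
by rewrite [lmulr (gen W)]free_map_gen lsd_gen.
Qed.

Lemma lmulr_lhtp j (c : lchain R k m j) : lmulr (lhtp c) = lhtp (lmulr c).
Proof.
elim: j c => [|j IHj] c; first by rewrite linear0.
apply: (@linear_genP _ _ _ (@lmulr _ \o @lhtp _ _ _ _) (@lhtp _ _ _ _ \o @lmulr _)) => W.
rewrite -[LHS]/(lmulr (lhtp (gen W))) -[RHS]/(lhtp (lmulr (gen W))) lhtp_gen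
  lmulr_lcone (linearB (@lmulr _)) /= IHj lmulr_lbd bary_mul.
by rewrite [lmulr (gen W)]free_map_gen lhtp_gen.
Qed.

End LinearChainsNaturality.

(** * Subdivision of singular chains *)

Section RealLemmas.
Context {R : realType}.

Lemma eq_continuous_at (T U : topologicalType) (f g : T -> U) x :
  g =1 f -> continuous_at x f -> continuous_at x g.
Proof. by move=> /funext ->. Qed.

Lemma cvg_rowP (T : topologicalType) (n : nat) (f : T -> 'rV[R]_n) (x : T) :
  (forall i, continuous_at x (fun y => f y ord0 i)) -> continuous_at x f.
Proof.
move=> fc A [P Px PA].
have : \forall y \near x, forall i, P ord0 i (f y ord0 i).
  apply: (@filter_forall _ _ (fun i y => P ord0 i (f y ord0 i)) _ (nbhs_filter x)) => i.
  exact: (fc i _ (Px ord0 i)).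
by apply: (@filterS _ (nbhs x) (nbhs_filter x)) => y Py; apply: PA => a b; rewrite [a]ord1.
Qed.

Lemma cvg_sumr (T : topologicalType) (I : Type) (r : seq I) (F : I -> T -> R) (x : T) :
  (forall i, continuous_at x (F i)) ->
  continuous_at x (fun y => \sum_(i <- r) F i y).
Proof.
move=> Fc; elim: r => [|i r IHr].
  apply: (@eq_continuous_at _ _ (cst 0)); last exact: cst_continuous.
  by move=> y; rewrite big_nil.
apply: (@eq_continuous_at _ _ (F i \+ (fun y => \sum_(j <- r) F j y))).
  by move=> y; rewrite big_cons.
exact: cvgD (Fc i) IHr.
Qed.

Lemma mulmx_continuous (m n : nat) (W : 'M[R]_(m, n)) :
  continuous (fun y : 'rV[R]_m => y *m W).
Proof.
move=> x; apply: cvg_rowP => i.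
have -> : (fun y : 'rV_m => (y *m W) ord0 i) = (fun y => \sum_l y ord0 l * W l i).
  by apply/funext => y; rewrite mxE.
apply: cvg_sumr => l.
apply: (@continuousM R _ (fun y : 'rV[R]_m => y ord0 l) (cst (W l i)) x).
  exact: coord_continuous.
exact: cst_continuous.
Qed.

Lemma simplex_compact m : compact (@simplex R m).
Proof.
pose C := [set v : 'rV[R]_m.+1 | forall i, `[0%R, 1%R]%classic (v ord0 i)].
have cC : compact C 
  by apply: (@rV_compact R m.+1 (fun=> `[0%R, 1%R]%classic)) => i; exact: segment_compact.
apply: subclosed_compact cC _; last first.
  move=> v [v0 v1] i /=; rewrite in_itv /= v0 /= -v1 (bigD1 i) //= lerDl.
  by apply: sumr_ge0 => l _.
have -> : simplex (R := R) (m := m) =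
    (\bigcap_(i in [set: 'I_m.+1]) [set v : 'rV[R]_m.+1 | 0 <= v ord0 i])
    `&` [set v : 'rV[R]_m.+1 | \sum_i v ord0 i = 1].
  apply/seteqP; split=> [v [v0 v1]|v [v0 v1]]; split=> // i.
    by move=> _; exact: v0.
  exact: (v0 i I).
apply: closedI.
  apply: closed_bigI => i _.
  apply: (@closed_comp _ _ (fun v : 'rV[R]_m.+1 => v ord0 i) [set y | 0 <= y]).
    by move=> v _; exact: coord_continuous.
  exact: closed_ge.
apply: (@closed_comp _ _ (fun v : 'rV[R]_m.+1 => \sum_i v ord0 i) [set y | y = 1]).
  by move=> v _; apply: cvg_sumr => i; exact: coord_continuous.
exact: closed_eq.
Qed.

Lemma into_Delta_continuous (T : topologicalType) m (f : T -> Delta R m) (x : T) :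
  continuous_at x (fun y => sval (f y)) -> continuous_at x f.
Proof.
move=> fc A; rewrite nbhsE => -[O [[O' oO' <-] O'fx] OA].
have : nbhs (sval (f x)) O' by apply: open_nbhs_nbhs; split.
by move=> /fc; apply: (@filterS _ (nbhs x) (nbhs_filter x)) => y O'y; exact: OA.
Qed.

Lemma sval_Delta_continuous m : continuous (fun x : Delta R m => sval x).
Proof. exact: initial_continuous. Qed.

End RealLemmas.

Section Realization.
Context {R : realType}.

Lemma aff_subproof j m (W : smx R j.+1 m) (x : Delta R j) :
  sval x *m smx_val W \in simplex (R := R) (m := m).
Proof.
have [x0 x1] := set_mem (svalP x); apply/mem_set; split=> [i|].
  by rewrite mxE; apply: sumr_ge0 => l _; rewrite mulr_ge0 ?smx_ge0.
under eq_bigr do rewrite mxE.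
rewrite exchange_big /= -x1; apply: eq_bigr => l _.
by rewrite -mulr_sumr smx_sum1 mulr1.
Qed.

Definition aff_fun j m (W : smx R j.+1 m) (x : Delta R j) : Delta R m :=
  exist _ (sval x *m smx_val W) (aff_subproof W x).

Lemma aff_continuous j m (W : smx R j.+1 m) : continuous (aff_fun W).
Proof.
move=> x; apply: into_Delta_continuous.
apply: (@continuous_comp _ _ _ (fun x : Delta R j => sval x) (fun y => y *m _)).
  exact: sval_Delta_continuous.
exact: mulmx_continuous.
Qed.

Definition aff j m (W : smx R j.+1 m) : continuousType (Delta R j) (Delta R m) :=
  mkcts (@aff_continuous j m W).

Lemma Delta_eq m (x y : Delta R m) : (forall i, sval x ord0 i = sval y ord0 i) -> x = y.
Proof. by move=> xy; apply/val_inj/rowP. Qed.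

Lemma face_vecE m (j : 'I_m.+2) (x : 'rV[R]_m.+1) i : face_vec j x ord0 (lift j i) = x ord0 i.
Proof. by rewrite mxE liftK. Qed.

Lemma face_vec0 m (j : 'I_m.+2) (x : 'rV[R]_m.+1) : face_vec j x ord0 j = 0.
Proof. by rewrite mxE unlift_none. Qed.

Lemma aff_face j m (W : smx R j.+2 m) (i : 'I_j.+2) (x : Delta R j) :
  aff W (face R i x) = aff (smx_del i W) x.
Proof.
apply: Delta_eq => l; rewrite !mxE (bigD1_ord i) //= face_vec0 mul0r add0r.
by apply: eq_bigr => r _; rewrite face_vecE mxE.
Qed.

Lemma aff_mul p j m (A : smx R p.+1 j) (W : smx R j.+1 m) (x : Delta R p) :
  aff W (aff A x) = aff (smx_mul A W) x.
Proof. by apply/val_inj; rewrite /= mulmxA. Qed.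

Lemma aff_one m (x : Delta R m) : aff (smx_one m) x = x.
Proof. by apply/val_inj; rewrite /= mulmx1. Qed.

End Realization.

#[global] Arguments boundary : simpl never.

Section SingularSubdivision.
Context (R : realType) (k : fieldType).
Local Notation chain := (chain R k).
Local Notation lchain := (lchain R k).

Section Real.
Variables (X : topologicalType) (m : nat).

Definition real_sing (s : sing R X m) j (W : smx R j.+1 m) : sing R X j := s \o aff W.

(** The index shifts because [j.+1] points span a [j]-simplex. The augmentation degree of affine
    chains has no singular counterpart, so [real_lbd] starts at index [j.+2]. *)
Definition real (s : sing R X m) j : lchain m j.+1 -> chain X j := free_map (@real_sing s j).
HB.instance Definition _ s j := GRing.Linear.on (@real s j).

Lemma real_lbd (s : sing R X m) j (c : lchain m j.+2) :
  boundary (real s c) = real s (lbd c).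
Proof.
rewrite /boundary /boundary_succ /lbd (linear_comb (@real s j)); apply: eq_bigr => i _.
rewrite /= /real !free_map_comp; apply: (congr1 (GRing.scale _)).
by apply: eq_free_map => W; apply/continuousEP => x /=; rewrite -aff_face.
Qed.

Lemma real_one (s : sing R X m) : real s (gen (smx_one m)) = gen s.
Proof.
rewrite [LHS]free_map_gen; congr gen; apply/continuousEP => x.
by rewrite /= aff_one.
Qed.

Lemma real_real (s : sing R X m) p (W : smx R p.+1 m) j (c : lchain p j.+1) :
  real s (lmulr W c) = free_map (fun A => real_sing s W \o aff A : sing R X j) c.
Proof.
rewrite /real /lmulr free_map_comp; apply: eq_free_map => A.
by apply/continuousEP => x /=; rewrite aff_mul.
Qed.

End Real.

Lemma real_realE (X : topologicalType) m (s : sing R X m) p (W : smx R p.+1 m) j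
    (c : lchain p j.+1) : real (real_sing s W) c = real s (lmulr W c).
Proof. by rewrite real_real. Qed.

Variable X : topologicalType.

Lemma boundaryD m : {morph @boundary R k X m : x y / x + y}.
Proof. exact: linearD. Qed.
Lemma boundaryB m : {morph @boundary R k X m : x y / x - y}.
Proof. exact: linearB. Qed.
Lemma boundaryN m : {morph @boundary R k X m : x / - x}.
Proof. exact: linearN. Qed.
(* A simplex s is the image of the identity of Delta^m, where [lbd_lbd] applies. *)
Lemma boundary_boundary m (c : chain X m.+2) : boundary (boundary c) = 0.
Proof.
apply: (linear_gen0 (f := @boundary R k X m.+1 \o @boundary R k X m.+2)) => s.
rewrite -[LHS]/(boundary (boundary (gen s))) -(real_one s) real_lbd real_lbd lbd_lbd.
exact: linear0.
Qed.

Definition sdiv m : chain X m -> chain X m :=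
  lext (fun s : sing R X m => real s (lsd (gen (smx_one m)))).
HB.instance Definition _ m := GRing.Linear.on (@sdiv m).

Definition shtp m : chain X m -> chain X m.+1 :=
  lext (fun s : sing R X m => real s (lhtp (gen (smx_one m)))).
HB.instance Definition _ m := GRing.Linear.on (@shtp m).

Lemma lmulr_one m q (W : smx R m.+1 q) :
  lmulr W (gen (smx_one m)) = gen W :> lchain q m.+1.
Proof. by rewrite [LHS]free_map_gen smx_mul1. Qed.

(** By definition [sdiv] subdivides only the identity of Delta^m; the naturality [lmulr_lsd] extends
    this to every affine simplex. Identities about [sdiv] thereby reduce to affine ones. *)
Lemma sdiv_real m (s : sing R X m) j (c : lchain m j.+1) :
  sdiv (real s c) = real s (lsd c).
Proof.
apply: (@linear_genP _ _ _ (@sdiv j \o @real X m s j) (@real X m s j \o @lsd _ _ _ _)) => W.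
rewrite -[LHS]/(sdiv (real s (gen W))) -[RHS]/(real s (lsd (gen W))).
rewrite [real s (gen W)]free_map_gen [LHS]lext_gen.
by rewrite real_realE lmulr_lsd lmulr_one.
Qed.

Lemma shtp_real m (s : sing R X m) j (c : lchain m j.+1) :
  shtp (real s c) = real s (lhtp c).
Proof.
apply: (@linear_genP _ _ _ (@shtp j \o @real X m s j) (@real X m s j.+1 \o @lhtp _ _ _ _)) => W.
rewrite -[LHS]/(shtp (real s (gen W))) -[RHS]/(real s (lhtp (gen W))).
rewrite [real s (gen W)]free_map_gen [LHS]lext_gen.
by rewrite real_realE lmulr_lhtp lmulr_one.
Qed.

Lemma boundary_sdiv m (c : chain X m.+1) : boundary (sdiv c) = sdiv (boundary c).
Proof.
apply: (@linear_genP _ _ _ (@boundary R k X m.+1 \o @sdiv m.+1)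
  (@sdiv m \o @boundary R k X m.+1)) => s.
rewrite -[LHS]/(boundary (sdiv (gen s))) -[RHS]/(sdiv (boundary (gen s))).
by rewrite -(real_one s) sdiv_real !real_lbd sdiv_real lbd_lsd.
Qed.

Lemma boundary_shtp m (c : chain X m.+1) :
  boundary (shtp c) = c - sdiv c - shtp (boundary c).
Proof.
apply: (@linear_genP _ _ _ (@boundary R k X m.+2 \o @shtp m.+1)
  ((idfun \- @sdiv m.+1) \- (@shtp m \o @boundary R k X m.+1))) => s.
rewrite -[LHS]/(boundary (shtp (gen s))).
rewrite -[RHS]/(gen s - sdiv (gen s) - shtp (boundary (gen s))).
by rewrite -(real_one s) shtp_real sdiv_real !real_lbd shtp_real lbd_lhtp !linearB.
Qed.

End SingularSubdivision.

(** * Small chains *)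

Section Mesh.
Context {R : realType} {k : fieldType} {m : nat}.
Local Notation lchain := (lchain R k m).

Definition mesh (d : R) j (W : smx R j m) : Prop :=
  forall i i' l, `|(W : 'M__) i l - (W : 'M__) i' l| <= d.

Definition within (l : 'I_m.+1) (b e : R) j (W : smx R j m) : Prop :=
  forall i, `|(W : 'M__) i l - b| <= e.

Lemma convex_within j (a : smx R 1 j) (W : smx R j.+1 m) l b e :
  within l b e W -> `|(smx_mul a W : 'M__) ord0 l - b| <= e.
Proof.
move=> We; rewrite mxE.
have -> : \sum_r (a : 'M__) ord0 r * (W : 'M__) r l - b =
    \sum_r (a : 'M__) ord0 r * ((W : 'M__) r l - b).
  under [RHS]eq_bigr do rewrite mulrBr.
  by rewrite sumrB -mulr_suml smx_sum1 mul1r.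
apply: le_trans (ler_norm_sum _ _ _) _.
rewrite -[leRHS]mul1r -(smx_sum1 a ord0) mulr_suml; apply: ler_sum => r _.
by rewrite normrM ger0_norm ?smx_ge0 // ler_wpM2l ?smx_ge0.
Qed.

Lemma within_cone l b e j (p : smx R 1 m) (W : smx R j m) :
  `|(p : 'M__) ord0 l - b| <= e -> within l b e W -> within l b e (smx_cone p W).
Proof.
move=> pe We i; case: (@split_ordP 1 j i) => r ->.
  by rewrite smx_coneEu ord1.
by rewrite smx_coneEd.
Qed.

Lemma within_del l b e j (W : smx R j.+1 m) (i : 'I_j.+1) :
  within l b e W -> within l b e (smx_del i W).
Proof. by move=> We r; rewrite mxE. Qed.

Lemma mesh_del d j (W : smx R j.+1 m) (i : 'I_j.+1) : mesh d W -> mesh d (smx_del i W).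
Proof. by move=> Wd r r' l; rewrite !mxE. Qed.

(** A slab in one coordinate is convex, so it contains the barycenters of the simplices inside it
    and subdivision cannot leave it. *)
Lemma within_lsd l b e j (c : lchain j) :
  supported (@within l b e j) c -> supported (@within l b e j) (lsd c).
Proof.
elim: j c => // j IHj c; apply: supported_lext => W We.
apply: (@supported_free_map _ _ _ (@within l b e j)).
  by move=> W' W'e; apply: within_cone => //; exact: convex_within.
apply: IHj; apply: (@supported_lbd _ _ _ _ (@within l b e j.+1)).
  by move=> i W'; exact: within_del.
exact: supported_gen.
Qed.

(** The difference between a vertex and the barycenter is the mean of its [j.+1] differences to the
    vertices, one of which is zero; hence the factor j / (j + 1), bounded here by [r]. *)
Lemma bary_within d j (W : smx R j.+1 m) (r : R) l : j%:R <= r * j.+1%:R -> 0 <= d ->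
  mesh d W -> within l ((bary W : 'M__) ord0 l) (r * d) W.
Proof.
move=> jr d0 Wd i; rewrite mxE.
have -> : (W : 'M__) i l - \sum_a (bary_row j : 'M[R]__) ord0 a * (W : 'M__) a l =
    j.+1%:R^-1 * \sum_a ((W : 'M__) i l - (W : 'M__) a l).
  rewrite sumrB sumr_const card_ord mulrBr -(mulr_natl (smx_val W i l)) mulKf ?pnatr_eq0//.
  by rewrite mulr_sumr; congr (_ - _); apply: eq_bigr => a _; rewrite mxE.
rewrite normrM ger0_norm ?invr_ge0 ?ler0n // mulrC ler_pdivrMr ?ltr0n //.
rewrite (bigD1 i) //= subrr add0r.
apply: le_trans (ler_norm_sum _ _ _) _.
apply: (@le_trans _ _ (\sum_(a < j.+1 | a != i) d)); first exact: ler_sum.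
rewrite sumr_const (_ : #|_| = j); last first.
  by rewrite (eq_card (B := predC1 i)) // cardC1 card_ord.
by rewrite -(mulr_natl d) mulrAC ler_wpM2r.
Qed.

(** The ratio [r] is fixed in advance because the induction passes to faces, whose own ratio is
    smaller: a bound for the top dimension serves them all. *)
Lemma mesh_lsd (r d : R) j (c : lchain j.+1) : 0 <= r <= 1 -> 0 <= d ->
  j%:R <= r * j.+1%:R ->
  supported (@mesh d j.+1) c -> supported (@mesh (r * d) j.+1) (lsd c).
Proof.
move=> /andP[r0 r1] d0.
have step i (c' : lchain i) : i.-1%:R <= r * i%:R ->
    supported (@mesh d i) c' -> supported (@mesh (r * d) i) (lsd c').
  elim: i c' => [|i IHi] c' ir; first by move=> _ W _ [].
  apply: supported_lext => W Wd.
  (* Lowering the dimension takes 1 off the left-hand side and [r], which is at most 1, off the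
     right-hand side. *)
  have ir' : i.-1%:R <= r * i%:R.
    case: i ir {IHi W Wd c'} => [|i] ir; first by rewrite mulr0.
    move: ir; rewrite /= -[i.+2%:R]natr1 -[i.+1%:R in leLHS]natr1 mulrDr mulr1 => ir.
    by rewrite -(lerD2r 1) (le_trans ir) // lerD2l.
  (* An edge of the cone lies in the base or joins the apex to a vertex of the base; [P] bounds both
     kinds. *)
  pose P (W' : smx R i m) := mesh (r * d) W' /\
    forall l, within l ((bary W : 'M__) ord0 l) (r * d) W'.
  apply: (@supported_free_map _ _ _ P).
    move=> W' [W'd W'b] a a' l; case: (@split_ordP 1 i a) => s ->;
      case: (@split_ordP 1 i a') => s' ->; rewrite ?smx_coneEu ?smx_coneEd ?[s]ord1 ?[s']ord1.
    - by rewrite subrr normr0 mulr_ge0.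
    - by rewrite distrC; exact: W'b.
    - exact: W'b.
    - exact: W'd.
  move=> W' W'c; split.
    apply: IHi W'c => //; apply: (@supported_lbd _ _ _ _ (@mesh d i.+1)).
      by move=> a V; exact: mesh_del.
    exact: supported_gen.
  move=> l; move: W' W'c; apply: within_lsd.
  apply: (@supported_lbd _ _ _ _ (@within l ((bary W : 'M__) ord0 l) (r * d) i.+1)).
    by move=> a V; exact: within_del.
  by apply: supported_gen; exact: bary_within.
by move=> jr; exact: step.
Qed.

Lemma mesh_iter_lsd (c : lchain m.+1) n :
  supported (@mesh ((m%:R / m.+1%:R) ^+ n) m.+1) (iter n (@lsd _ _ _ _) c).
Proof.
have r0 : 0 <= m%:R / m.+1%:R :> R by rewrite divr_ge0.
have r1 : m%:R / m.+1%:R <= 1 :> R by rewrite ler_pdivrMr ?ltr0n // mul1r ler_nat.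
elim: n => [|n IHn] /=.
  (* Coordinates lie in [0, 1], so every affine simplex has mesh at most 1. *)
  move=> W _ i i' l; rewrite expr0 ler_norml; apply/andP; split.
    by rewrite lerBrDl (le_trans (_ : _ <= 0 :> R)) ?smx_ge0 ?subr_le0 ?smx_le1.
  by rewrite lerBlDr (le_trans (smx_le1 _ _ _)) // lerDl smx_ge0.
rewrite exprS; apply: mesh_lsd => //; first by rewrite r0 r1.
by rewrite mulfVK ?pnatr_eq0.
Qed.

End Mesh.

Section SmallChains.
Context (R : realType) (k : fieldType) (X : topologicalType).
Variable U : set (set X).
Hypothesis U_open : forall A, U A -> open A.
Hypothesis U_cover : forall x, exists2 A, U A & A x.
Local Notation chain := (chain R k X).

Definition small m (s : sing R X m) : Prop := exists2 A, U A & forall t, A (s t).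

(** Compactness in its near-covering form makes one [d] work for all base points of the simplex at
    once. *)
Lemma lebesgue_number m (s : sing R X m) : exists2 d : R, 0 < d &
  forall j (W : smx R j.+1 m), mesh d W -> small (real_sing s W).
Proof.
pose P (d : R) (x : 'rV[R]_m.+1) := exists2 A, U A &
  forall y : Delta R m, (forall l, `|sval y ord0 l - x ord0 l| <= d) -> A (s y).
have /near_covering_withinP cov := (compact_near_coveringP _).1 (@simplex_compact R m).
have /cov : forall x, simplex (R := R) (m := m) x ->
    \forall x' \near x & d \near (0 : R)^'+, simplex x' -> P d x'.
  move=> x /mem_set xD; pose x' : Delta R m := exist _ x xD.
  have [A UA Ax] := U_cover (s x').
  have : nbhs x' (s @^-1` A).
    by apply: (@cts_fun _ _ s); apply: open_nbhs_nbhs; split=> //; exact: U_open.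
  rewrite nbhsE => -[O [[O' oO' <-] O'x] OA].
  have /nbhs_ballP[e /= e0 eO'] : nbhs x O' by exact: open_nbhs_nbhs.
  (* One half of [e] pays for moving the base point from [x] to [z], the other for the distance from
     [z]. *)
  have e20 : 0 < e / 2 by rewrite divr_gt0.
  exists (ball x (e / 2), [set d | d < e / 2]).
    by split; [exact: nbhsx_ballx|exact: nbhs_right_lt].
  move=> [z d] [/= [_ xz] de] _; exists A => // y yz; apply: OA; apply: eO'; split=> // i l.
  rewrite /ball /= [i]ord1 (splitr e).
  rewrite -(subrKA (z ord0 l)); apply: le_lt_trans (ler_normD _ _) _.
  apply: ltrD; first exact: xz.
  by rewrite distrC (le_lt_trans (yz l)).
move=> {}cov; have [d [d0 dP]] : exists d : R, 0 < d /\ simplex (R:=R) (m:=m) `<=` P d.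
  have /filter_ex[d [d0 dP]] : \forall d \near (0 : R)^'+, 0 < d /\
      (simplex (R:=R) (m:=m) `<=` P d).
    by apply: filterI; [exact: nbhs_right_gt|exact: cov].
  by exists d.
exists d => // j W Wd.
(* The first vertex serves as base point: all vertices are within [d] of it, hence by convexity so
   is every point of the affine simplex. *)
have row0 : row ord0 (smx_val W) \in simplex (R := R) (m := m).
  apply/mem_set; split=> [l|]; first by rewrite mxE smx_ge0.
  by under eq_bigr do rewrite mxE; exact: smx_sum1.
have [A UA AP] := dP _ (set_mem row0); exists A => // t; apply: AP => l.
have [t0 t1] := set_mem (svalP t).
have tst : stoch (sval t).
  by apply/stochP; split=> i; [move=> l'|]; rewrite [i]ord1.
have := @convex_within R m j (Smx tst) W l ((W : 'M__) ord0 l) d (fun i => Wd i ord0 l).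
by rewrite !mxE.
Qed.

Lemma supported_small_real m (s : sing R X m) j (c : lchain R k m j.+1) :
  small s -> supported (@small j) (real s c).
Proof.
move=> [A UA As]; apply: (@supported_free_map _ _ _ (fun=> True)) => // W _.
by exists A => // t; exact: As.
Qed.

Lemma supported_small_sdiv m (c : chain m) :
  supported (@small m) c -> supported (@small m) (sdiv c).
Proof. by apply: supported_lext => s; exact: supported_small_real. Qed.

Lemma supported_small_shtp m (c : chain m) :
  supported (@small m) c -> supported (@small m.+1) (shtp c).
Proof. by apply: supported_lext => s; exact: supported_small_real. Qed.

Lemma iter_sdiv_real m (s : sing R X m) n (c : lchain R k m m.+1) :
  iter n (@sdiv R k X m) (real s c) = real s (iter n (@lsd _ _ _ _) c).
Proof. by elim: n => //= n ->; rewrite sdiv_real. Qed.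

Lemma iter_sdiv_linear m n a (x y : chain m) :
  iter n (@sdiv R k X m) (a *: x + y) =
  a *: iter n (@sdiv R k X m) x + iter n (@sdiv R k X m) y.
Proof. by elim: n => //= n ->; rewrite linearP. Qed.

(** Smallness is claimed for all large [n], so that the bounds for two chains can be joined by a
    maximum. *)
Lemma iter_sdiv_small m (c : chain m) : exists N, forall n, (N <= n)%N ->
  supported (@small m) (iter n (@sdiv R k X m) c).
Proof.
apply: (@chain_ind k (sing R X m) (fun=> True) (fun c : chain m => exists N, forall n,
  (N <= n)%N -> supported (@small m) (iter n (@sdiv R k X m) c))) => //.
- exists 0 => n _; elim: n => [|n IHn] /=; first exact: supported0.
  exact: supported_small_sdiv.
- move=> a x y [N1 xN1] [N2 yN2]; exists (maxn N1 N2) => n; rewrite geq_max => /andP[n1 n2].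
  rewrite iter_sdiv_linear; apply: supportedD; last exact: yN2.
  by apply: supportedZ; exact: xN1.
move=> s _; have [d d0 dP] := lebesgue_number s.
have : (m%:R / m.+1%:R : R) ^+ n @[n --> \oo] --> 0.
  apply: cvg_expr; rewrite ger0_norm ?divr_ge0// ltr_pdivrMr ?ltr0n//.
  by rewrite mul1r ltr_nat.
move=> /cvgrPdist_le/(_ d d0)[N _ NP]; exists N => n Nn.
rewrite -(real_one k s) iter_sdiv_real.
apply: (@supported_free_map _ _ _ (@mesh R m d m.+1)); first exact: dP.
have := @mesh_iter_lsd R k m (gen (smx_one m)) n.
apply: supportedW => W Wn i i' l; apply: le_trans (Wn i i' l) _.
by have := NP n Nn; rewrite /= sub0r normrN ger0_norm // exprn_ge0 // divr_ge0.
Qed.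

(* Chains modulo small chains are acyclic.  For a cycle c this makes c homologous
   to a small cycle; for a chain c with small boundary it makes that boundary the
   boundary of a small chain. *)
Theorem small_chains m (c : chain m.+1) : supported (@small m) (boundary c) ->
  exists e : chain m.+2, supported (@small m.+1) (c - boundary e).
Proof.
move=> bc; have [N NP] := iter_sdiv_small c.
have bn n : supported (@small m) (boundary (iter n (@sdiv R k X m.+1) c)).
  elim: n => [|n IHn]; first exact: bc.
  by rewrite iterS boundary_sdiv; exact: supported_small_sdiv.
(* Telescoping [boundary_shtp] over the iterates: c - sd^n c is a boundary plus terms T (d sd^i c),
   which are small because d c is. *)
suff H n : exists e : chain m.+2,
    supported (@small m.+1) (c - boundary e - iter n (@sdiv R k X m.+1) c).
  have [e eP] := H N; exists e; rewrite -[X in supported _ X](subrK (iter N (@sdiv R k X m.+1) c)).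
  by apply: supportedD => //; exact: NP.
elim: n => [|n [e IHn]].
  by exists 0; rewrite linear0 subr0 subrr; exact: supported0.
set c' := iter n _ c in IHn; exists (e + shtp c').
have -> : c - boundary (e + shtp c') - iter n.+1 (@sdiv R k X m.+1) c =
    (c - boundary e - c') + shtp (boundary c').
  rewrite boundaryD boundary_shtp -[iter n.+1 _ _]/(sdiv c').
  by rewrite opprD !opprB !addrA [LHS]addrAC addrK addrAC.
by apply: supportedD => //; apply: supported_small_shtp; exact: bn.
Qed.

End SmallChains.

(** * Cones over minimal neighbourhoods *)

Section Cone.
Context {R : realType}.

Definition ne1 m : set (Delta R m.+1) := [set t : Delta R m.+1 | sval t ord0 ord0 != 1].

Lemma vertex_subproof m (i : 'I_m.+1) : delta_mx ord0 i \in simplex (R := R) (m := m).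
Proof.
apply/mem_set; split=> [l|]; first by rewrite mxE ler0n.
by rewrite (bigD1 i) //= big1 ?mxE ?eqxx ?addr0// => l li; rewrite mxE (negPf li) andbF.
Qed.
Definition vertex m (i : 'I_m.+1) : Delta R m := exist _ (delta_mx ord0 i) (vertex_subproof i).

Definition link_vec m (x : 'rV[R]_m.+2) : 'rV[R]_m.+1 :=
  \row_i (x ord0 (lift ord0 i) / (1 - x ord0 ord0)).

Lemma link_vec_simplex m (t : Delta R m.+1) : ne1 t ->
  link_vec (sval t) \in simplex (R := R) (m := m).
Proof.
move=> t1; have [t0 ts] := set_mem (svalP t).
have s1 : \sum_(i < m.+1) sval t ord0 (lift ord0 i) = 1 - sval t ord0 ord0.
  by rewrite -ts [in RHS]big_ord_recl addrAC subrr add0r.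
have d0 : 0 <= 1 - sval t ord0 ord0.
  by rewrite -s1; apply: sumr_ge0 => i _.
apply/mem_set; split=> [i|]; first by rewrite mxE divr_ge0.
under eq_bigr do rewrite mxE.
by rewrite -mulr_suml s1 divff // subr_eq0 eq_sym.
Qed.

(* Radial projection from the vertex 0 onto the opposite face (junk at the vertex). *)
Definition link m (t : Delta R m.+1) : Delta R m :=
  match pselect (ne1 t) with
  | left t1 => exist _ (link_vec (sval t)) (link_vec_simplex t1)
  | right _ => vertex ord0
  end.

Lemma linkE m (t : Delta R m.+1) : ne1 t -> sval (link t) = link_vec (sval t).
Proof. by rewrite /link; case: pselect. Qed.

Lemma Delta_coord_continuous m (i : 'I_m.+1) :
  continuous (fun t : Delta R m => sval t ord0 i).
Proof.
move=> t; apply: (@continuous_comp _ _ _ (fun x : Delta R m => sval x)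
  (fun v : 'rV[R]_m.+1 => v ord0 i)).
  exact: sval_Delta_continuous.
exact: coord_continuous.
Qed.

Lemma near_ne1 m (t : Delta R m.+1) : ne1 t -> \near t, ne1 t.
Proof.
move=> t1; apply: (@Delta_coord_continuous m.+1 ord0 t [set y : R | y != 1]).
by apply: open_nbhs_nbhs; split=> //; exact: open_neq.
Qed.

Lemma link_continuous m (t : Delta R m.+1) : ne1 t -> continuous_at t (@link m).
Proof.
move=> t1; apply: into_Delta_continuous => A; rewrite linkE // => tA.
have : continuous_at t (fun y : Delta R m.+1 => link_vec (sval y)).
  apply: cvg_rowP => i.
  have -> : (fun y : Delta R m.+1 => link_vec (sval y) ord0 i) =
      (fun y => sval y ord0 (lift ord0 i) * (1 - sval y ord0 ord0)^-1).
    by apply/funext => y; rewrite mxE.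
  apply: (@continuousM R _ (fun y : Delta R m.+1 => sval y ord0 (lift ord0 i))
    (fun y => (1 - sval y ord0 ord0)^-1) t).
    exact: Delta_coord_continuous.
  apply: (@continuousV R _ (fun y : Delta R m.+1 => 1 - sval y ord0 ord0) t).
    by rewrite subr_eq0 eq_sym.
  apply: (@continuousB R R^o (Delta R m.+1) (cst 1) (fun y => sval y ord0 ord0) t).
    exact: cst_continuous.
  exact: Delta_coord_continuous.
move=> /(_ A tA); apply: (@filterS2 _ (nbhs t) (nbhs_filter t)) (near_ne1 t1).
by move=> y y1 /= yA; rewrite linkE.
Qed.

Section Apex.
Variables (Y : topologicalType) (a : Y).

(* The smallest neighbourhood of a when there is one; every simplex inside it
   can be coned off to a. *)
Definition core : set Y := [set y | forall A, open A -> A a -> A y].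

Definition incore m (s : sing R Y m) : Prop := forall t, core (s t).

Definition tcone_fun m (s : sing R Y m) (t : Delta R m.+1) : Y :=
  if sval t ord0 ord0 == 1 then a else s (link t).

(** An open set containing [a] contains [core a], hence the image of the whole cone; away from the
    apex the cone is [s] after the radial projection. *)
Lemma tcone_continuous m (s : sing R Y m) : incore s -> continuous (tcone_fun s).
Proof.
move=> sa t A; rewrite {1}/tcone_fun; case: ifPn => [t1|t1].
  rewrite nbhsE => -[O [oO Oa] OA].
  apply: (@filterE _ (nbhs t) (nbhs_filter t)) => y; apply: OA.
  by rewrite /tcone_fun; case: ifP => // _; exact: sa.
move=> At; have : nbhs (link t) (s @^-1` A) by exact: (@cts_fun _ _ s (link t) A At).
move=> /(link_continuous t1).
apply: (@filterS2 _ (nbhs t) (nbhs_filter t)) (near_ne1 t1).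
by move=> y y1 /=; rewrite /tcone_fun (negPf y1).
Qed.

(** [ccone] extends a function defined on all simplices, so those that leave the core get a default
    value, the constant simplex at [a]. *)
Definition tcone m (s : sing R Y m) : sing R Y m.+1 :=
  match pselect (incore s) with
  | left h => mkcts (tcone_continuous h)
  | right _ => cst a
  end.

Lemma tconeE m (s : sing R Y m) t : incore s ->
  tcone s t = if sval t ord0 ord0 == 1 then a else s (link t).
Proof. by rewrite /tcone; case: pselect. Qed.

Lemma core_refl : core a.
Proof. by []. Qed.

Lemma incore_tcone m (s : sing R Y m) : incore s -> incore (tcone s).
Proof. by move=> sa t; rewrite tconeE //; case: ifP => // _; exact: core_refl. Qed.

Lemma incore_sface m (s : sing R Y m.+1) j : incore s -> incore (sface j s).
Proof. by move=> sa t; exact: sa. Qed.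

Lemma sface0_tcone m (s : sing R Y m) : incore s -> sface ord0 (tcone s) = s.
Proof.
move=> sa; apply/continuousEP => t; rewrite /= tconeE //= face_vec0.
rewrite eq_sym oner_eq0; congr (s _); apply: Delta_eq => i.
rewrite linkE /ne1 /= ?face_vec0 1?eq_sym ?oner_eq0// mxE face_vec0 subr0 divr1.
by rewrite face_vecE.
Qed.

Lemma sfaceS_tcone m (s : sing R Y m.+1) j : incore s ->
  sface (lift ord0 j) (tcone s) = tcone (sface j s).
Proof.
move=> sa; apply/continuousEP => t; rewrite /= !tconeE //=; last exact: incore_sface.
have E : face_vec (lift ord0 j) (sval t) ord0 ord0 = sval t ord0 ord0.
  have -> : ord0 = lift (lift ord0 j) ord0 :> 'I_m.+3 by apply/val_inj.
  by rewrite face_vecE; congr (sval t _ _); apply/val_inj.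
rewrite E; case: ifPn => // t1; congr (s _); apply: Delta_eq => i.
rewrite linkE /ne1 /= ?E// mxE E mxE.
case: (unliftP j i) => [i' ->|->] /=.
  have -> : lift ord0 (lift j i') = lift (lift ord0 j) (lift ord0 i').
    by apply/val_inj; rewrite /= /bump !leq0n !add1n ltnS addnS.
  by rewrite liftK /= face_vecE linkE // mxE.
by rewrite unlift_none face_vec0 mul0r.
Qed.

(** In dimension 0 the second face of the cone is the apex; it gives the augmentation term in
    [boundary_ccone0]. *)
Lemma sface1_tcone (s : sing R Y 0) : incore s -> sface (lift ord0 ord0) (tcone s) = cst a.
Proof.
move=> sa; apply/continuousEP => t; rewrite /= tconeE //=.
have -> : ord0 = lift (lift ord0 ord0) ord0 :> 'I_2 by apply/val_inj.
rewrite face_vecE; have [_] := set_mem (svalP t); rewrite big_ord1 => ->.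
by rewrite eqxx.
Qed.

End Apex.

Lemma core_map (Y Z : topologicalType) (f : continuousType Y Z) a y :
  core a y -> core (f a) (f y).
Proof.
move=> ay A oA Afa; apply: (ay (f @^-1` A)) => //.
by apply: open_comp => // x _; exact: cts_fun.
Qed.

(** Cones are given by a formula, so continuous maps preserve them strictly; naturality of the
    isomorphisms below can therefore be checked on chains. *)
Lemma tcone_map (Y Z : topologicalType) (f : continuousType Y Z) a m (s : sing R Y m) :
  incore a s -> sing_map f (tcone a s) = tcone (f a) (sing_map f s).
Proof.
move=> sa; apply/continuousEP => t; rewrite /= !tconeE //=; first by case: ifP.
by move=> u; exact: core_map.
Qed.

End Cone.

Section ConeChains.
Context {R : realType} {k : fieldType} {Y : topologicalType}.
Local Notation chain := (chain R k Y).

Lemma boundary_gen m (s : sing R Y m.+1) :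
  boundary (gen s : chain m.+1) = \sum_(j < m.+2) (-1) ^+ j *: gen (sface j s).
Proof.
by rewrite /boundary /boundary_succ; apply: eq_bigr => j _; rewrite free_map_gen.
Qed.

Lemma supported_boundary m (P : sing R Y m.+1 -> Prop) (Q : sing R Y m -> Prop)
    (c : chain m.+1) :
  (forall j s, P s -> Q (sface j s)) -> supported P c -> supported Q (boundary c).
Proof.
move=> PQ cP; apply: supported_sum => j; apply: supportedZ.
by apply: supported_free_map cP => s; exact: PQ.
Qed.

Definition ccone (a : Y) m : chain m -> chain m.+1 := free_map (@tcone R Y a m).
HB.instance Definition _ a m := GRing.Linear.on (@ccone a m).

Lemma ccone_gen a m (s : sing R Y m) : ccone a (gen s) = gen (tcone a s).
Proof. exact: free_map_gen. Qed.

Lemma boundary_ccone a m (c : chain m.+1) : supported (@incore R Y a m.+1) c ->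
  boundary (ccone a c) = c - ccone a (boundary c).
Proof.
apply: (@chain_ind _ _ _ (fun c : chain m.+1 => boundary (ccone a c) =
   c - ccone a (boundary c))) => [|b x y xE yE|s sa].
- by rewrite !linear0 addr0.
- rewrite (linearP (@ccone a m.+1)) (linearP (@boundary R k Y m.+2)) /= xE yE.
  rewrite (linearP (@boundary R k Y m.+1)) (linearP (@ccone a m)) /=.
  by rewrite scalerBr opprD addrACA.
rewrite ccone_gen !boundary_gen big_ord_recl scale1r sface0_tcone //.
rewrite (linear_comb (@ccone a m)) -sumrN; congr (_ + _); apply: eq_bigr => j _.
rewrite sfaceS_tcone // -ccone_gen -scaleNr /= /bump leq0n add1n exprS mulN1r.
by [].
Qed.

Lemma boundary_ccone0 a (s : sing R Y 0) : incore a s ->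
  boundary (ccone a (gen s)) = gen s - gen (cst a : sing R Y 0).
Proof.
move=> sa; rewrite ccone_gen boundary_gen !big_ord_recl big_ord0 addr0 scale1r.
by rewrite sface0_tcone // sface1_tcone // expr1 scaleN1r.
Qed.

Lemma supported_ccone a m (c : chain m) : supported (@incore R Y a m) c ->
  supported (@incore R Y a m.+1) (ccone a c).
Proof. by apply: supported_free_map => s; exact: incore_tcone. Qed.

Lemma supported_incore_boundary a m (c : chain m.+1) :
  supported (@incore R Y a m.+1) c -> supported (@incore R Y a m) (boundary c).
Proof. by apply: supported_boundary => j s; exact: incore_sface. Qed.

End ConeChains.

Lemma ccone_map (R : realType) (k : fieldType) (Y Z : topologicalType)
    (f : continuousType Y Z) a m (c : chain R k Y m) : supported (@incore R Y a m) c ->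
  chain_map f (ccone a c) = ccone (f a) (chain_map f c).
Proof.
apply: (@chain_ind _ _ _ (fun c : chain R k Y m => chain_map f (ccone a c) =
   ccone (f a) (chain_map f c))) => [|b x y xE yE|s sa].
- by rewrite !linear0.
- rewrite (linearP (@ccone R k Y a m)) (linearP (@chain_map R k _ _ f m.+1)) /= xE yE.
  by rewrite (linearP (@chain_map R k _ _ f m)) (linearP (@ccone R k Z (f a) m)).
by rewrite ccone_gen /chain_map !free_map_gen ccone_gen tcone_map.
Qed.

(** * Suspension *)

Section FreeMapInj.
Context {k : fieldType} {K L : choiceType} (h : K -> L).
Hypothesis h_inj : injective h.

Lemma mcoeff_free_map (c : malg K k) s : mcoeff (h s) (free_map h c) = mcoeff s c.
Proof.
apply: (@chain_ind _ _ (fun=> True) (fun c => mcoeff (h s) (free_map h c) = mcoeff s c)).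
- by rewrite linear0 !mcoeff0.
- by move=> a x y xE yE; rewrite linearP !mcoeffD !mcoeffZ xE yE.
- by move=> t _; rewrite free_map_gen !mcoeffU (inj_eq h_inj).
- by [].
Qed.

Lemma free_map_inj : injective (free_map h : malg K k -> malg L k).
Proof.
by move=> c c' cc'; apply/malgP => s; rewrite -!mcoeff_free_map cc'.
Qed.

End FreeMapInj.

(* The non-Hausdorff suspension: the only neighbourhood of a pole inside the
   complement of the other pole is that whole complement. *)
Definition susp (X : topologicalType) : Type := (X + bool)%type.

Section SuspTopology.
Variable X : topologicalType.

HB.instance Definition _ := Choice.on (susp X).

Definition susp_open (O : set (susp X)) : Prop :=
  open [set x | O (inl x)] /\ forall b, O (inr b) -> forall x, O (inl x).

Lemma susp_openT : susp_open setT.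
Proof. by split=> //; exact: openT. Qed.

Lemma susp_openI : setI_closed susp_open.
Proof.
move=> A B [oA A'] [oB B']; split; first exact: openI oA oB.
by move=> b [Ab Bb] x; split; [exact: A' Ab x|exact: B' Bb x].
Qed.

Lemma susp_open_bigU (I : Type) (f : I -> set (susp X)) :
  (forall i, susp_open (f i)) -> susp_open (\bigcup_i f i).
Proof.
move=> fo; split.
  have := @bigcup_open X I setT (fun i => [set x | f i (inl x)]) (fun i _ => (fo i).1).
  by [].
by move=> b [i _ fb] x; exists i => //; exact: (fo i).2 b fb x.
Qed.

HB.instance Definition _ := isOpenTopological.Build (susp X)
  susp_openT susp_openI susp_open_bigU.

Lemma open_suspE (O : set (susp X)) : open O <-> susp_open O.
Proof. by []. Qed.

Definition pole (b : bool) : susp X := inr b.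

Definition equator_fun (x : X) : susp X := inl x.

Lemma equator_continuous : continuous equator_fun.
Proof. by apply/continuousP => O /open_suspE[]. Qed.

Definition equator : continuousType X (susp X) := mkcts equator_continuous.

Lemma core_poleP b y : core (pole b) y <-> y <> pole (~~ b).
Proof.
split=> [h e|yb O /open_suspE[oO Ob] Opole].
  pose A := [set z : susp X | z <> pole (~~ b)].
  suff : A y by rewrite e.
  apply: (h A).
    apply/open_suspE; split=> //.
    rewrite (_ : [set x | _] = setT); first exact: openT.
    by apply/seteqP; split.
  by rewrite /A /= /pole; case: (b).
case: y yb => [x _|b' b'b]; first exact: Ob Opole x.
by suff -> : b' = b by []; case: b' b b'b {Opole} => -[].
Qed.

Lemma open_core_pole b : open (core (pole b)).
Proof.
apply/open_suspE; split.
  rewrite (_ : [set x | _] = setT); first exact: openT.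
  by apply/seteqP; split=> // x _; apply/core_poleP.
by move=> b' _ x; apply/core_poleP.
Qed.

Lemma core_equator b x : core (pole b) (equator x).
Proof. by apply/core_poleP. Qed.

Lemma core_both y : core (pole true) y -> core (pole false) y -> exists x, y = inl x.
Proof.
by move=> /core_poleP yt /core_poleP yf; case: y yt yf => [x|[]] //=; exists x.
Qed.

(** The Mayer-Vietoris cover: each member cones off to its pole, and the two meet exactly in the
    equator. *)
Definition hemispheres : set (set (susp X)) := [set core (pole b) | b in setT].

Lemma hemispheres_open A : hemispheres A -> open A.
Proof. by move=> [b _ <-]; exact: open_core_pole. Qed.

Lemma hemispheres_cover x : exists2 A, hemispheres A & A x.
Proof.
case: x => [x|b].
  by exists (core (pole true)); [exists true|exact: core_equator].
by exists (core (pole b)); [exists b|exact: core_refl].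
Qed.

End SuspTopology.

Section SuspMap.
Variables (X Y : topologicalType) (f : continuousType X Y).

Definition susp_map_fun (y : susp X) : susp Y :=
  match y with inl x => inl (f x) | inr b => inr b end.

Lemma susp_map_continuous : continuous susp_map_fun.
Proof.
apply/continuousP => O /open_suspE[oO Ob]; apply/open_suspE; split.
  by have /continuousP fc := @cts_fun _ _ f; exact: (fc _ oO).
by move=> b /= Opole x; exact: Ob Opole (f x).
Qed.

Definition susp_map : continuousType (susp X) (susp Y) := mkcts susp_map_continuous.

End SuspMap.

Lemma subr_shuffle (V : zmodType) (p q u v e : V) :
  p + q - (u + v + e) = - (e + (u - p) + (v - q)).
Proof.
rewrite -[e + _ + _]addrA [u - p + _]addrACA -opprD [e + _]addrC [RHS]opprD.
by rewrite [- (u + v - _)]opprB -[RHS]addrA -opprD.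
Qed.

(** * The suspension isomorphism *)

Section Suspension.
Context {R : realType} {k : fieldType}.

Lemma in_cycle_pred (Z : topologicalType) m (c : chain R k Z m) : boundary c = 0 ->
  c \in cycle_pred (@boundary R k Z m).
Proof. by move=> c0; rewrite unfold_in; apply/eqP. Qed.

Lemma cycles_boundary0 (Z : topologicalType) m (z : cycles (@boundary R k Z m)) :
  boundary (val z) = 0.
Proof. by case: z => z /= /eqP. Qed.

Section Space.
Variable X : topologicalType.
Local Notation chain := (chain R k).

Lemma incore_equator b m (s : sing R X m) : incore (pole X b) (sing_map (equator X) s).
Proof. by move=> t; exact: core_equator. Qed.

Lemma supported_equator b m (c : chain X m) :
  supported (@incore R _ (pole X b) m) (chain_map (equator X) c).
Proof.
apply: (@supported_free_map _ _ _ (fun=> True)) => // s _; exact: incore_equator.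
Qed.

Lemma equator_lift m (s : sing R (susp X) m) : incore (pole X true) s ->
  incore (pole X false) s -> exists s' : sing R X m, s = sing_map (equator X) s'.
Proof.
move=> st sf; have /choice[g gE] t : exists x, s t = inl x by exact: core_both.
have gc : continuous g.
  apply/continuousP => O oO.
  (* The image of an open set of [X] is open in the suspension, since it contains no pole. *)
  have -> : g @^-1` O = s @^-1` [set y | exists2 x, O x & y = inl x].
    apply/seteqP; split=> t /=; rewrite gE; first by exists (g t).
    by move=> [x Ox [->]].
  have /continuousP := @cts_fun _ _ s; apply; apply/open_suspE; split.
    rewrite (_ : [set x | _] = O) //; apply/seteqP; split=> x /=.
      by move=> [x' Ox' [->]].
    by exists x.
  by move=> b [].
by exists (mkcts gc : continuousType (Delta R m) X); apply/continuousEP => t; rewrite gE.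
Qed.

Lemma equator_chain_lift m (c : chain (susp X) m) :
  supported (@incore R _ (pole X true) m) c ->
  supported (@incore R _ (pole X false) m) c ->
  exists c' : chain X m, c = chain_map (equator X) c'.
Proof.
move=> ct cf.
apply: (@chain_ind _ _ (fun s => incore (pole X true) s /\ incore (pole X false) s)
  (fun c => exists c' : chain X m, c = chain_map (equator X) c')) (supported_in ct cf).
- by exists 0; rewrite linear0.
- by move=> a x y [x' ->] [y' ->]; exists (a *: x' + y'); rewrite linearP.
move=> s [st sf]; have [s' ->] := equator_lift st sf.
by exists (gen s'); rewrite [RHS]free_map_gen.
Qed.

Lemma chain_map_equator_inj m : injective (@chain_map R k _ _ (equator X) m).
Proof.
apply: free_map_inj => s s' /continuousEP ss'; apply/continuousEP => t.
by have [] := ss' t.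
Qed.

(** The difference of the two cones on a chain anticommutes with the boundary. Negation swaps the
    poles, so letting [b] alternate with the degree absorbs the sign and gives a genuine chain
    map. *)
Definition schain b m : chain X m -> chain (susp X) m.+1 :=
  (ccone (pole X b) (m := m) \o chain_map (equator X) (m := m)) \-
  (ccone (pole X (~~ b)) (m := m) \o chain_map (equator X) (m := m)).
HB.instance Definition _ b m := GRing.Linear.on (@schain b m).

Lemma schainE b m (c : chain X m) : schain b c =
  ccone (pole X b) (chain_map (equator X) c) - ccone (pole X (~~ b)) (chain_map (equator X) c).
Proof. by []. Qed.

Lemma boundary_schain b m (c : chain X m.+1) :
  boundary (schain b c) = schain (~~ b) (boundary c).
Proof.
rewrite !schainE boundaryB !boundary_ccone; try exact: supported_equator.
rewrite -!(chain_map_boundary (equator X) c) negbK opprB addrC.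
by rewrite addrA subrK.
Qed.

(** Only positive degrees of [X] occur, so homology need not be reduced. *)
Definition susp_iso m : sing_homology R k X m.+1 -> sing_homology R k (susp X) m.+2 :=
  @homology_map k _ _ _ _ _ _ (@boundary R k X m.+2) (@boundary R k X m.+1)
    (@boundary R k (susp X) m.+3) (@boundary R k (susp X) m.+2)
    (@schain true m.+1) (@schain false m) (fun c => esym (boundary_schain true c)).

Let f2P m c : @schain true m.+1 (@boundary R k X m.+2 c) =
  @boundary R k (susp X) m.+3 (@schain false m.+2 c).
Proof. by rewrite (boundary_schain false). Qed.

Lemma susp_iso_linear m : linear (@susp_iso m).
Proof. exact: (@homology_map_linear k _ _ _ _ _ _ _ _ _ _ (@schain false m.+2) _ _ (@f2P m)). Qed.

HB.instance Definition _ m := GRing.isLinear.Build k (sing_homology R k X m.+1)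
  (sing_homology R k (susp X) m.+2) *:%R (@susp_iso m) (@susp_iso_linear m).

Lemma susp_isoE m (z : cycles (@boundary R k X m.+1))
    (z' : cycles (@boundary R k (susp X) m.+2)) : schain true (val z) = val z' ->
  susp_iso (hclass (@boundary R k X m.+2) z) = hclass (@boundary R k (susp X) m.+3) z'.
Proof.
move=> zz'; rewrite /susp_iso.
rewrite (@homology_mapE k _ _ _ _ _ _ _ _ _ _ (@schain false m.+2) _ _ (@f2P m)).
by congr hclass; apply/val_inj.
Qed.

Lemma small_hemispheresP m (c : chain (susp X) m) :
  supported (@small R _ (@hemispheres X) m) c ->
  exists c1 c2, [/\ c = c1 + c2, supported (@incore R _ (pole X true) m) c1
    & supported (@incore R _ (pole X false) m) c2].
Proof.
move=> cs; apply: supported_split => s /cs[_ [b _ <-] sb].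
by case: b sb => sb; [left|right].
Qed.

Lemma small_incore b m (c : chain (susp X) m) : supported (@incore R _ (pole X b) m) c ->
  supported (@small R _ (@hemispheres X) m) c.
Proof. by apply: supportedW => s sb; exists (core (pole X b)) => //; exists b. Qed.

Lemma susp_iso_inj m : injective (@susp_iso m).
Proof.
move=> x y; rewrite -[x]hreprK -[y]hreprK; set z := repr x; set z' := repr y.
have cyc (w : cycles (@boundary R k X m.+1)) :
    schain true (val w) \in cycle_pred (@boundary R k (susp X) m.+2).
  by apply: in_cycle_pred; rewrite boundary_schain cycles_boundary0 linear0.
rewrite (@susp_isoE m z (Cycles (cyc z))) // (@susp_isoE m z' (Cycles (cyc z'))) //.
move=> /hclass_eq[c /=]; rewrite -(linearB (@schain true m.+1)) /=.
set w := val z - val z' => wc; apply/hclass_eq; rewrite -/w.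
have w0 : boundary w = 0 by rewrite /w boundaryB !cycles_boundary0 subrr.
(* The suspension of [w] is a difference of two cones, each in one hemisphere, so the chain that
   bounds it can be made small. *)
have [e es] : exists e : chain (susp X) m.+4,
    supported (@small R _ (@hemispheres X) m.+3) (c - boundary e).
  apply: small_chains; [exact: hemispheres_open|exact: hemispheres_cover|].
  rewrite -wc schainE; apply: supportedB;
    apply: small_incore; apply: supported_ccone; exact: supported_equator.
have [y1 [y2 [ceE y1N y2S]]] := small_hemispheresP es.
have y12 : boundary y1 + boundary y2 = schain true w.
  by rewrite -boundaryD -ceE boundaryB boundary_boundary subr0.
(* The identity [y12] gives two expressions for [v], one in each hemisphere, so [v] comes from the
   equator. Its boundary is that of a cone on the cycle [w], namely [w] itself. *)
pose v := ccone (pole X true) (chain_map (equator X) w) - boundary y1.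
have vS : v = ccone (pole X false) (chain_map (equator X) w) + boundary y2.
  by apply/eqP; rewrite /v subr_eq addrAC -addrA y12 schainE addrC subrK.
have [v' v'E] : exists v' : chain X m.+2, v = chain_map (equator X) v'.
  apply: equator_chain_lift.
    by apply: supportedB; [apply: supported_ccone; exact: supported_equator|
      exact: supported_incore_boundary].
  by rewrite vS; apply: supportedD; [apply: supported_ccone; exact: supported_equator|
    exact: supported_incore_boundary].
exists v'; apply: (@chain_map_equator_inj m.+1).
rewrite -[RHS]/(chain_map (equator X) (boundary v')) chain_map_boundary
  -v'E /v boundaryB boundary_boundary subr0.
rewrite boundary_ccone; last exact: supported_equator.
by rewrite -(chain_map_boundary (equator X) w) w0 !linear0 addr0.
Qed.

Lemma susp_iso_surj m y : exists x, @susp_iso m x = y.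
Proof.
rewrite -[y]hreprK; set w := repr y.
have w0 := cycles_boundary0 w.
have [e es] : exists e : chain (susp X) m.+3,
    supported (@small R _ (@hemispheres X) m.+2) (val w - boundary e).
  apply: small_chains; [exact: hemispheres_open|exact: hemispheres_cover|].
  by rewrite w0; exact: supported0.
have [u [v [weE uN vS]]] := small_hemispheresP es.
have uv : boundary u = - boundary v.
  apply/eqP; rewrite -subr_eq0 opprK -boundaryD -weE boundaryB boundary_boundary subr0.
  by rewrite w0.
(* The boundary of [u] is minus that of [v], so it lies in both hemispheres; it is the cycle of [X]
   to be suspended. *)
have [z zE] : exists z : chain X m.+1, boundary u = chain_map (equator X) z.
  apply: equator_chain_lift; first exact: supported_incore_boundary.
  by rewrite uv; apply: supportedN; exact: supported_incore_boundary.
have z0 : z \in cycle_pred (@boundary R k X m.+1).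
  apply: in_cycle_pred; apply: (@chain_map_equator_inj m).
  by rewrite -[LHS]/(chain_map _ (boundary z)) chain_map_boundary -zE boundary_boundary linear0.
have cyc : schain true z \in cycle_pred (@boundary R k (susp X) m.+2).
  by apply: in_cycle_pred; rewrite boundary_schain (eqP z0) linear0.
exists (hclass (@boundary R k X m.+2) (Cycles z0)).
rewrite (@susp_isoE m (Cycles z0) (Cycles cyc)) //.
(* Modulo boundaries, the cone on d u is [u] and the cone on d v is [v], so the suspension of [z]
   becomes u + v, which differs from [w] by d e. *)
apply/hclass_eq; exists (- (e + ccone (pole X true) u + ccone (pole X false) v)).
rewrite /= schainE -zE {2}uv !linearN /= opprK !boundaryD !boundary_ccone //.
have -> : val w = u + v + boundary e by rewrite -weE subrK.
exact: subr_shuffle.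
Qed.

End Space.

Lemma susp_iso_natural (X Y : topologicalType) (f : continuousType X Y) m
    (x : sing_homology R k X m.+1) :
  sing_homology_map (susp_map f) (susp_iso x) = susp_iso (sing_homology_map f x).
Proof.
rewrite -[x]hreprK; set z := repr x.
have cyc (Z : topologicalType) (w : cycles (@boundary R k Z m.+1)) :
    schain true (val w) \in cycle_pred (@boundary R k (susp Z) m.+2).
  by apply: in_cycle_pred; rewrite boundary_schain cycles_boundary0 linear0.
have fz : chain_map f (val z) \in cycle_pred (@boundary R k Y m.+1).
  by apply: in_cycle_pred; rewrite -chain_map_boundary cycles_boundary0 linear0.
rewrite (@susp_isoE X m z (Cycles (cyc X z))) //.
rewrite (@sing_homology_mapE R k X Y f m.+1 z (Cycles fz)) //.
rewrite (@susp_isoE Y m (Cycles fz) (Cycles (cyc Y (Cycles fz)))) //.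
apply: sing_homology_mapE; rewrite /= !schainE linearB /=.
rewrite !ccone_map; try exact: supported_equator.
have -> : chain_map (susp_map f) (chain_map (equator X) (val z)) =
    chain_map (equator Y) (chain_map f (val z)).
  by rewrite /chain_map !free_map_comp; apply: eq_free_map => s; apply/continuousEP.
by [].
Qed.

End Suspension.

(** * A space with prescribed first homology *)

Lemma subrBB (W : zmodType) (x y z : W) : (x - z) - (y - z) = x - y.
Proof. by rewrite opprB addrA subrK. Qed.

Lemma subrDBB (W : zmodType) (x y z u v : W) :
  (x - z + u) - (y - z + v) = x - y + (u - v).
Proof. by rewrite opprD addrACA subrBB. Qed.

Section Cells.
Variable V : zmodType.

(* The face poset of the quotient by V of the join V * V * V: three vertices, an
   edge per label in V for each pair of vertices, and a triangle [Tr a b] with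
   edges labelled a, b and a + b.  Open sets are the subcomplexes. *)
Inductive cell : Type :=
| Vx0 | Vx1 | Vx2
| E01 of V | E12 of V | E02 of V
| Tr of V & V.

HB.instance Definition _ := gen_eqMixin cell.
HB.instance Definition _ := gen_choiceMixin cell.

Definition cle (q p : cell) : Prop :=
  match p, q with
  | Vx0, Vx0 | Vx1, Vx1 | Vx2, Vx2 => True
  | E01 a, E01 c | E12 a, E12 c | E02 a, E02 c => c = a
  | E01 _, Vx0 | E01 _, Vx1 | E12 _, Vx1 | E12 _, Vx2 | E02 _, Vx0 | E02 _, Vx2 => True
  | Tr a b, Tr c d => c = a /\ d = b
  | Tr a b, E01 c => c = a
  | Tr a b, E12 c => c = b
  | Tr a b, E02 c => c = a + b
  | Tr _ _, _ => True
  | _, _ => False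
  end.

Lemma cle_refl p : cle p p.
Proof. by case: p. Qed.

Lemma cle_trans r q p : cle q r -> cle r p -> cle q p.
Proof.
case: p => [|||a|a|a|a b]; case: r => [|||c|c|c|c d] //=;
  case: q => [|||u|u|u|u v] //=; intuition congruence.
Qed.

(* The V-coordinate of the face q of p, once p is lifted to V * V * V with its
   first vertex at 0. *)
Definition pot (p q : cell) : V :=
  match p, q with
  | E01 a, Vx1 | E12 a, Vx2 | E02 a, Vx2 => a
  | Tr a b, Vx1 | Tr a b, E12 _ => a
  | Tr a b, Vx2 => a + b
  | _, _ => 0
  end.

(** A lift of [p] also lifts its face [r], translated by the coordinate [pot p r] of the first
    vertex of [r]. *)
Lemma pot_cocycle r q p : cle q r -> cle r p -> pot p q = pot r q + pot p r.
Proof.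
case: p => [|||a|a|a|a b]; case: r => [|||c|c|c|c d] //=;
  case: q => [|||u|u|u|u v] //= qr rp; repeat (case: qr => qr ?); repeat (case: rp => rp ?);
  subst; by rewrite ?add0r ?addr0 // addrC.
Qed.

Lemma pot_refl p : pot p p = 0.
Proof. by case: p. Qed.

Definition cell_open (O : set cell) : Prop := forall p, O p -> forall q, cle q p -> O q.

Lemma cell_openT : cell_open setT.
Proof. by []. Qed.

Lemma cell_openI : setI_closed cell_open.
Proof. by move=> A B oA oB p [Ap Bp] q qp; split; [exact: oA qp|exact: oB qp]. Qed.

Lemma cell_open_bigU (I : Type) (f : I -> set cell) :
  (forall i, cell_open (f i)) -> cell_open (\bigcup_i f i).
Proof. by move=> fo p [i _ fp] q qp; exists i => //; exact: fo qp. Qed.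

HB.instance Definition _ := isOpenTopological.Build cell
  cell_openT cell_openI cell_open_bigU.

Lemma open_cellE (O : set cell) : open O <-> cell_open O.
Proof. by []. Qed.

Lemma core_cellP (p q : cell) : core p q <-> cle q p.
Proof.
split=> [h|qp O /open_cellE oO Op]; last exact: oO qp.
apply: (h [set q | cle q p]); last exact: cle_refl.
by apply/open_cellE => r rp s sr; exact: cle_trans sr rp.
Qed.

Lemma open_core_cell (p : cell) : open (core p).
Proof.
by apply/open_cellE => r /core_cellP rp s sr; apply/core_cellP; exact: cle_trans sr rp.
Qed.

Definition cell_cores : set (set cell) := [set core p | p in setT].

Lemma cell_cores_open A : cell_cores A -> open A.
Proof. by move=> [p _ <-]; exact: open_core_cell. Qed.

Lemma cell_cores_cover (x : cell) : exists2 A, cell_cores A & A x.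
Proof. by exists (core x); [exists x|exact: core_refl]. Qed.

Section Labels.
Variables (W : zmodType) (P : cell -> cell -> W).
Hypothesis P_tri : forall p r q, cle r p -> cle q r -> P r q = P p q - P p r.

(** [P] is a cochain on pairs of incident cells, closed by [P_tri]; this is its value on the loop
    out along [E01 a] and back along [E01 0]. In the application [P p q] is the class of a path from
    [p] to [q]. *)
Definition loop_label (a : V) : W :=
  (P (E01 a) Vx1 - P (E01 a) Vx0) - (P (E01 0) Vx1 - P (E01 0) Vx0).

Let e01 a := P (E01 a) Vx1 - P (E01 a) Vx0.
Let e12 a := P (E12 a) Vx2 - P (E12 a) Vx1.
Let e02 a := P (E02 a) Vx2 - P (E02 a) Vx0.

Let sub3 (x y z : W) : x + y - (x - z) = z + y.
Proof. by rewrite opprB addrC addrA subrK. Qed.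

Let P_refl p : P p p = 0.
Proof. by rewrite (P_tri (cle_refl p) (cle_refl p)) subrr. Qed.

Let e01_tri a b : e01 a = P (Tr a b) Vx1 - P (Tr a b) Vx0.
Proof. by rewrite /e01 !(@P_tri (Tr a b) (E01 a)) // subrBB. Qed.

Let e12_tri a b : e12 b = P (Tr a b) Vx2 - P (Tr a b) Vx1.
Proof. by rewrite /e12 !(@P_tri (Tr a b) (E12 b)) // subrBB. Qed.

Let e02_tri a b : e02 (a + b) = P (Tr a b) Vx2 - P (Tr a b) Vx0.
Proof. by rewrite /e02 !(@P_tri (Tr a b) (E02 (a + b))) // subrBB. Qed.

Let e02D a b : e02 (a + b) = e01 a + e12 b.
Proof. by rewrite (e01_tri a b) (e12_tri a b) e02_tri [RHS]addrC addrA subrK. Qed.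

Let e12E b : e12 b = e12 0 + loop_label b.
Proof.
rewrite -[loop_label b]/(e01 b - e01 0) addrA; apply/eqP; rewrite eq_sym subr_eq.
by rewrite addrC [X in _ == X]addrC -!e02D addr0 add0r.
Qed.

Let e01E a : e01 a = e01 0 + loop_label a.
Proof. by rewrite -[loop_label a]/(e01 a - e01 0) addrC subrK. Qed.

Let e02E a : e02 a = e01 0 + e12 0 + loop_label a.
Proof. by rewrite -[a in LHS]addr0 e02D e01E addrAC. Qed.

(** The triangle [Tr a b] forces e02 (a + b) = e01 a + e12 b. Taking one label to be 0 shows that,
    up to constants, all three kinds of edges carry the value [loop_label]; additivity follows by
    comparing [Tr a b] with [Tr (a + b) 0], which share an edge. *)
Lemma loop_labelD a b : loop_label (a + b) = loop_label a + loop_label b.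
Proof.
have := e02D (a + b) 0; rewrite addr0 e02D (e12E b) (e01E a) (e01E (a + b)).
by rewrite addrACA [RHS]addrAC => /addrI ->.
Qed.

Lemma loop_label0 : loop_label 0 = 0.
Proof. by rewrite /loop_label subrr. Qed.

(** A potential for [P] based at [Vx0]: vertices are reached along edges labelled 0, and the other
    cells through their vertex [Vx0], except that [E12 a] lacks it and is reached through [Vx1]. *)
Definition vertex_label (p : cell) : W :=
  match p with
  | Vx0 => 0
  | Vx1 => e01 0
  | Vx2 => e01 0 + e12 0
  | E12 a => e01 0 - P (E12 a) Vx1
  | _ => - P p Vx0
  end.

Let move_right (x y z : W) : x - y = z -> x = z + y.
Proof. by move=> <-; rewrite subrK. Qed.

(** A closed cochain is thus a coboundary plus an additive function of the [V]-coordinate: in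
    effect, the first cohomology with values in [W] consists of the additive maps from [V] to
    [W]. *)
Lemma path_label p q : cle q p ->
  P p q = vertex_label q - vertex_label p + loop_label (pot p q).
Proof.
have [->|qp'] := pselect (q = p); first by rewrite pot_refl loop_label0 addr0 subrr P_refl.
case: p qp' => [|||a|a|a|a b]; case: q => [|||c|c|c|c d] //= qp' qp;
  rewrite ?loop_label0 ?addr0 ?sub0r ?opprK //; try (by exfalso; apply: qp'; intuition congruence).
- by rewrite addrAC; apply: move_right; exact: e01E.
- by rewrite subKr.
- by rewrite sub3 -addrA [RHS]addrC; apply: move_right; exact: e12E.
- by rewrite addrAC; apply: move_right; exact: e02E.
- by rewrite addrAC; apply: move_right; rewrite -(e01_tri a b); exact: e01E.
- by rewrite addrAC; apply: move_right; rewrite -e02_tri; exact: e02E.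
- by rewrite (@P_tri (Tr a b) (E01 c) Vx0) // opprB subrK.
- rewrite (@P_tri (Tr a b) (E12 c) Vx1) // opprB addrAC (addrAC (e01 0)) -e01E.
  by rewrite (e01_tri a b) addrAC subrK addrC subrK.
- by rewrite (@P_tri (Tr a b) (E02 c) Vx0) // opprB subrK.
Qed.

End Labels.

End Cells.

(** * Connectedness of the 1-simplex *)

Section Delta1Connected.
Context {R : realType}.

(** The retraction of the line onto [0, 1], written with norms so that continuity is immediate. It
    parametrizes Delta^1 by the whole line, whose connectedness is then available. *)
Let clamp (u : R) : R := (`|u| - `|u - 1| + 1) / 2.

Let clamp_itv u : 0 <= clamp u <= 1.
Proof.
have h : `| `|u| - `|u - 1| | <= 1.
  by apply: le_trans (ler_dist_dist _ _) _; rewrite opprB addrC subrK normr1.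
rewrite /clamp divr_ge0 /=;
  [|by move: h; rewrite ler_norml => /andP[h _]; rewrite -lerBlDr sub0r|by []].
by rewrite ler_pdivrMr // mul1r -[2]/(1 + 1) lerD2r; move: h; rewrite ler_norml => /andP[].
Qed.

Let clampE u : 0 <= u <= 1 -> clamp u = u.
Proof.
move=> /andP[u0 u1]; rewrite /clamp ger0_norm // ler0_norm ?subr_le0 //.
by rewrite opprK addrA subrK -mulr2n -(mulr_natr u) mulfK.
Qed.

Let clamp_continuous : continuous clamp.
Proof.
move=> u; apply: (@continuousM R R (fun u => `|u| - `|u - 1| + 1) (cst 2^-1) u).
  apply: (@continuousD R R^o R (fun u => `|u| - `|u - 1|) (cst 1) u).
    apply: (@continuousB R R^o R (fun u => `|u|) (fun u => `|u - 1|) u).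
      exact: norm_continuous.
    apply: (@continuous_comp _ _ _ (fun u : R => u - 1) (fun u : R => `|u|)).
      by apply: (@continuousB R R^o R id (cst 1) u) => //; exact: cst_continuous.
    exact: norm_continuous.
  exact: cst_continuous.
exact: cst_continuous.
Qed.

Let edge_vec (u : R) : 'rV[R]_2 := \row_i (if i == ord0 then 1 - clamp u else clamp u).

Let edge_vec_simplex u : edge_vec u \in simplex (R := R) (m := 1).
Proof.
have /andP[u0 u1] := clamp_itv u; apply/mem_set; split=> [i|].
  by rewrite mxE; case: ifP; rewrite ?subr_ge0.
by rewrite big_ord_recl big_ord1 !mxE /= subrK.
Qed.

Let edge (u : R) : Delta R 1 := exist _ (edge_vec u) (edge_vec_simplex u).

Let edge_continuous : continuous edge.
Proof.
move=> u; apply: into_Delta_continuous; apply: cvg_rowP => i.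
have -> : (fun u => sval (edge u) ord0 i) =
    (fun u => if i == ord0 then 1 - clamp u else clamp u).
  by apply/funext => y; rewrite /= mxE.
case: (i == ord0); last exact: clamp_continuous.
apply: (@continuousB R R^o R (cst 1) clamp u); first exact: cst_continuous.
exact: clamp_continuous.
Qed.

Lemma Delta1_locally_constant (T : Type) (g : Delta R 1 -> T) :
  (forall t, \forall y \near t, g y = g t) -> forall t t', g t = g t'.
Proof.
move=> gc; suff E t : g t = g (edge 0) by move=> t t'; rewrite !E.
have tE : t = edge (sval t ord0 (lift ord0 ord0)).
  have [t0 t1] := set_mem (svalP t).
  have t01 : sval t ord0 ord0 = 1 - sval t ord0 (lift ord0 ord0).
    by rewrite -t1 big_ord_recl big_ord1 addrK.
  apply: Delta_eq => i; rewrite /= mxE clampE; last first.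
    by rewrite t0 /= -subr_ge0 -t01 t0.
  case: ifPn => [/eqP ->//|i0]; congr (sval t _ _); apply/val_inj.
  by case: i i0 => -[|[|]].
pose B := [set u | g (edge u) = g (edge 0)].
(* A set saturated for [g] along the edge is open because [g] is locally constant; this applies to
   [B] and to its complement. *)
have oB (v : R) (C : set R) : (forall u, C u -> forall w, g (edge w) = g (edge u) -> C w) ->
    open C.
  move=> CP; rewrite openE => u Cu; apply: (@filterS _ (nbhs u) (nbhs_filter u) _ _ (CP u Cu)).
  exact: edge_continuous (gc (edge u)).
have BT : B = setT.
  apply: (@connected_intervalP R setT).2 => //.
  - by exists 0.
  - exists B; last by rewrite setTI.
    by apply: (oB 0) => u Bu w gw; rewrite /B /= gw.
  - exists B; last by rewrite setTI.
    rewrite -[B]setCK; apply: open_closedC; apply: (oB 0) => u Bu w gw Bw; apply: Bu.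
    by rewrite /B /= -gw.
have : B (sval t ord0 (lift ord0 ord0)) by rewrite BT.
by rewrite /B /= -tE.
Qed.

End Delta1Connected.

Lemma face_vertex (R : realType) m (j : 'I_m.+2) (i : 'I_m.+1) :
  face R j (vertex i) = vertex (lift j i).
Proof.
apply: Delta_eq => l; rewrite /= !mxE.
case: (unliftP j l) => [l' ->|->] /=; last by rewrite (negPf (neq_lift _ _)) ?andbF.
by rewrite mxE (inj_eq lift_inj).
Qed.

Lemma sface_vertex (R : realType) (Y : topologicalType) m (s : sing R Y m.+1) j i :
  sface j s (vertex i) = s (vertex (lift j i)).
Proof. by rewrite -face_vertex. Qed.

Lemma sing0E (R : realType) (Y : topologicalType) (s : sing R Y 0) :
  s = cst (s (vertex ord0)).
Proof.
apply/continuousEP => t /=; congr (s _); apply: Delta_eq => i; rewrite [i]ord1.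
have [_] := set_mem (svalP t); rewrite big_ord1 => ->.
by rewrite /= mxE eqxx.
Qed.

(** * First homology of the cell space *)

Section CellHomology.
Context {R : realType} {k : fieldType} (V : lmodType k).
Local Notation X := (cell V).
Local Notation chain := (chain R k X).

Let v0 : Delta R 1 := vertex ord0.
Let v1 : Delta R 1 := vertex (lift ord0 ord0).

Definition pnt (q : X) : chain 0 := gen (cst q : sing R X 0).

Lemma boundary_gen1 (s : sing R X 1) : boundary (gen s) = pnt (s v1) - pnt (s v0).
Proof.
rewrite boundary_gen !big_ord_recl big_ord0 addr0 scale1r expr1 scaleN1r.
rewrite [sface ord0 s]sing0E [sface (lift ord0 ord0) s]sing0E !sface_vertex.
by have -> : lift (lift ord0 ord0) ord0 = ord0 :> 'I_2 by exact/val_inj.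
Qed.

Definition potdiff (p : X) (s : sing R X 1) : V := pot p (s v1) - pot p (s v0).

(** Near [t] the path stays among the faces of [s t], where by [pot_cocycle] the functions [pot p]
    and [pot p'] vary equally; their difference is locally constant along [s], hence constant. *)
Lemma potdiff_indep p p' (s : sing R X 1) : incore p s -> incore p' s ->
  potdiff p s = potdiff p' s.
Proof.
move=> sp sp'; suff E t t' : pot p (s t) - pot p' (s t) = pot p (s t') - pot p' (s t').
  rewrite /potdiff -[pot p (s v1)](subrK (pot p' (s v1))) (E v1 v0).
  by rewrite addrAC [_ - _ - _]addrAC subrr sub0r addrC.
apply: (@Delta1_locally_constant R V (fun t => pot p (s t) - pot p' (s t))) => {t'}t.
have : \forall y \near t, core (s t) (s y).
  apply: (@cts_fun _ _ s); apply: open_nbhs_nbhs; split; first exact: open_core_cell.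
  exact: core_refl.
apply: (@filterS _ (nbhs t) (nbhs_filter t)) => y /core_cellP yt.
have /core_cellP tp := sp t; have /core_cellP tp' := sp' t.
by rewrite (pot_cocycle yt tp) (pot_cocycle yt tp') opprD addrACA subrr add0r.
Qed.

(** The change of [V]-coordinate along a path inside one closed cell. Other paths get 0, so [angle]
    is a cocycle only on small chains, which suffices by [small_chains]. *)
Definition angle_fun (s : sing R X 1) : V :=
  match pselect (exists p, incore p s) with
  | left h => potdiff (projT1 (cid h)) s
  | right _ => 0
  end.

Lemma angle_funE p (s : sing R X 1) : incore p s -> angle_fun s = potdiff p s.
Proof.
move=> sp; rewrite /angle_fun; case: pselect => [h|[]]; last by exists p.
by apply: potdiff_indep => //; case: cid.
Qed.

Definition angle : chain 1 -> V := lext angle_fun.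
HB.instance Definition _ := GRing.Linear.on angle.

(** The three edges of a small triangle lie in one closed cell [p], where their angles are
    differences of values of [pot p] and cancel. *)
Lemma angle_boundary (c : chain 2) :
  supported (@small R X (@cell_cores V) 2) c -> angle (boundary c) = 0.
Proof.
apply: (@chain_ind _ _ _ (fun c : chain 2 => angle (boundary c) = 0)) => [|a x y xE yE|s].
- by rewrite !linear0.
- by rewrite (linearP (@boundary R k X 2)) (linearP angle) /= xE yE scaler0 addr0.
move=> [_ [p _ <-] sp]; rewrite boundary_gen (linear_comb angle) !big_ord_recl big_ord0 /=.
rewrite /angle !lext_gen !(@angle_funE p); try by move=> t; exact: sp.
rewrite /potdiff /v0 /v1 !sface_vertex.
have -> : lift (lift ord0 ord0) (lift ord0 ord0) = lift ord0 (lift ord0 ord0) :> 'I_3.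
  exact/val_inj.
have -> : lift (lift ord0 ord0) ord0 = ord0 :> 'I_3 by exact/val_inj.
have -> : lift (lift ord0 (lift ord0 ord0)) (lift ord0 ord0) = lift ord0 ord0 :> 'I_3.
  exact/val_inj.
have -> : lift (lift ord0 (lift ord0 ord0)) ord0 = ord0 :> 'I_3 by exact/val_inj.
rewrite /bump /= addr0 !exprS expr0 !mulr1 mulrNN mulr1 scaleN1r !scale1r opprB.
by rewrite [X in _ + X]addrC !addrA !subrK subrr.
Qed.

(** The path from a cell to its face that is [p] at the start and [q] everywhere else. *)
Definition pth (p q : X) : chain 1 := gen (tcone p (cst q : sing R X 0)).

Lemma incore_cst p q : cle q p -> incore p (cst q : sing R X 0).
Proof. by move=> qp t; apply/core_cellP. Qed.

Lemma incore_pth p q r : cle q p -> cle p r -> incore r (tcone p (cst q : sing R X 0)).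
Proof.
move=> qp pr t; rewrite tconeE; last exact: incore_cst.
by apply/core_cellP; case: ifP => _ //; exact: cle_trans pr.
Qed.

Lemma pth_ccone p q : pth p q = ccone p (pnt q).
Proof. by rewrite ccone_gen. Qed.

Lemma boundary_pth p q : cle q p -> boundary (pth p q) = pnt q - pnt p.
Proof. by move=> qp; rewrite pth_ccone boundary_ccone0 //; exact: incore_cst. Qed.

Lemma angle_pth p q : cle q p -> angle (pth p q) = pot p q.
Proof.
move=> qp; rewrite [LHS]lext_gen (@angle_funE p); last exact: incore_pth (cle_refl p).
rewrite /potdiff !tconeE; try exact: incore_cst.
rewrite /= !mxE /= eqxx (_ : _ == 1 = false) ?pot_refl ?subr0 //.
by rewrite eq_sym oner_eq0.
Qed.

Lemma null_cycle (c : chain 1) : c \in cycle_pred (\0 : {linear chain 1 -> chain 1}).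
Proof. by rewrite unfold_in. Qed.

(* 1-chains modulo boundaries, as the homology of C_2 -> C_1 -> 0 *)
Definition chain_quot : lmodType k :=
  homology (@boundary R k X 2) (\0 : {linear chain 1 -> chain 1}).

Definition cls (c : chain 1) : chain_quot := hclass (@boundary R k X 2) (Cycles (null_cycle c)).

Lemma cls_linear : linear cls.
Proof.
move=> a c c'; rewrite /cls -[a *: hclass _ _]/(hscale a _) -hclassZ -hclassD.
by congr hclass; exact/val_inj.
Qed.
HB.instance Definition _ := GRing.isLinear.Build k (chain 1) chain_quot *:%R cls cls_linear.

Lemma cls_eq c c' : cls c = cls c' <-> exists e : chain 2, c - c' = boundary e.
Proof. exact: hclass_eq. Qed.

(** Coning the edge off to [p] gives a triangle whose other two sides are standard paths. *)
Lemma cls_incore p (s : sing R X 1) : incore p s ->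
  cls (gen s) = cls (pth p (s v1)) - cls (pth p (s v0)).
Proof.
move=> sp; rewrite -(linearB cls) /=; apply/cls_eq; exists (ccone p (gen s)).
rewrite boundary_ccone; last exact: supported_gen.
by rewrite boundary_gen1 (linearB (@ccone R k X p 0)) /= !pth_ccone.
Qed.

Lemma cls_pth_triangle p r q : cle r p -> cle q r ->
  cls (pth r q) = cls (pth p q) - cls (pth p r).
Proof.
move=> rp qr; rewrite [LHS](@cls_incore p); last exact: incore_pth.
rewrite !tconeE; try exact: incore_cst.
by rewrite /= !mxE /= eqxx (_ : _ == 1 = false) // eq_sym oner_eq0.
Qed.

Definition loop (a : V) : chain 1 :=
  (pth (E01 a) (Vx1 V) - pth (E01 a) (Vx0 V)) - (pth (E01 0) (Vx1 V) - pth (E01 0) (Vx0 V)).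

Let label := loop_label (fun p q => cls (pth p q)).

Lemma cls_loop a : cls (loop a) = label a.
Proof. by rewrite /loop !(linearB cls). Qed.

Lemma boundary_loop a : boundary (loop a) = 0.
Proof.
rewrite /loop !boundaryB !boundary_pth //.
by rewrite (subrBB (pnt (Vx1 V)) (pnt (Vx0 V)) (pnt (E01 a)))
  (subrBB (pnt (Vx1 V)) (pnt (Vx0 V)) (pnt (E01 0))) subrr.
Qed.

Lemma angle_loop a : angle (loop a) = a.
Proof. by rewrite /loop !(linearB angle) /= !angle_pth // !subr0. Qed.

Definition endpoint_label : chain 0 -> chain_quot :=
  lext (fun s : sing R X 0 => vertex_label (fun p q => cls (pth p q)) (s (vertex ord0))).
HB.instance Definition _ := GRing.Linear.on endpoint_label.

Hypothesis prime_field : forall (U W : lmodType k) (f : U -> W),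
  {morph f : x y / x + y} -> scalable f.

(** The triangles impose additivity only; the passage to scalars is where the prime field acts. *)
Lemma label_linear : linear label.
Proof.
have labelD : {morph label : x y / x + y}.
  by move=> x y; rewrite [LHS]loop_labelD //; exact: cls_pth_triangle.
by move=> a x y; rewrite labelD (prime_field labelD).
Qed.
HB.instance Definition _ := GRing.isLinear.Build k V chain_quot *:%R label label_linear.

(** Modulo boundaries, a small 1-chain is determined by its endpoints and its angle: [path_label]
    applied to the classes of standard paths. For a cycle only the angle remains, which yields
    surjectivity of [loop_class]. *)
Lemma cls_small (c : chain 1) : supported (@small R X (@cell_cores V) 1) c ->
  cls c = endpoint_label (boundary c) + label (angle c).
Proof.
apply: (@chain_ind _ _ _ (fun c : chain 1 =>
    cls c = endpoint_label (boundary c) + label (angle c))) => [|a x y xE yE|s].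
- by rewrite !linear0 addr0.
- rewrite (linearP cls) (linearP (@boundary R k X 1)) (linearP angle) /= xE yE.
  rewrite (linearP endpoint_label) (linearP label) /= scalerDr.
  by rewrite [LHS]addrACA.
move=> [_ [p _ <-] sp]; rewrite (cls_incore sp) boundary_gen1 (linearB endpoint_label) /=.
rewrite /endpoint_label !lext_gen [angle _]lext_gen (angle_funE sp) /potdiff (linearB label) /=.
have tri := cls_pth_triangle.
have cl t : cle (s t) p by apply/core_cellP; exact: sp.
rewrite (path_label tri (cl v1)) (path_label tri (cl v0)).
exact: subrDBB.
Qed.

Lemma loop_cycle a : loop a \in cycle_pred (@boundary R k X 1).
Proof. by apply: in_cycle_pred; exact: boundary_loop. Qed.

Definition loop_class (a : V) : sing_homology R k X 1 :=
  hclass (@boundary R k X 2) (Cycles (loop_cycle a)).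

Lemma loop_class_linear : linear loop_class.
Proof.
move=> a x y; rewrite /loop_class -[a *: hclass _ _]/(hscale a _) -hclassZ -hclassD.
by apply/hclass_eq; apply/cls_eq; rewrite (linearP cls) /= !cls_loop linearP.
Qed.

Lemma small_loop a : supported (@small R X (@cell_cores V) 1) (loop a).
Proof.
have small_pth p q : cle q p -> supported (@small R X (@cell_cores V) 1) (pth p q).
  move=> qp; apply: supported_gen; exists (core p); first by exists p.
  exact: incore_pth (cle_refl p).
by apply: supportedB; apply: supportedB; exact: small_pth.
Qed.

(** [angle] recovers the vector. Loops are small, so a chain bounding a difference of loops can be
    made small, and then [angle] kills its boundary. *)
Lemma loop_class_inj : injective loop_class.
Proof.
move=> a b /hclass_eq[c /= cE].
have [e es] : exists e : chain 3, supported (@small R X (@cell_cores V) 2) (c - boundary e).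
  apply: small_chains; [exact: cell_cores_open|exact: cell_cores_cover|].
  by rewrite -[boundary c]cE; apply: supportedB; exact: small_loop.
have := angle_boundary es; rewrite boundaryB boundary_boundary subr0.
by rewrite -[boundary c]cE (linearB angle) /= !angle_loop => /subr0_eq.
Qed.

Lemma loop_class_surj x : exists a, loop_class a = x.
Proof.
rewrite -[x]hreprK; set z := repr x; have z0 := cycles_boundary0 z.
have [e es] : exists e : chain 2, supported (@small R X (@cell_cores V) 1) (val z - boundary e).
  apply: small_chains; [exact: cell_cores_open|exact: cell_cores_cover|].
  by rewrite z0; exact: supported0.
have := cls_small es; set a := angle _; rewrite boundaryB boundary_boundary z0 subr0.
rewrite (linear0 endpoint_label) add0r -cls_loop => /cls_eq[e' e'E].
exists a; apply/hclass_eq; exists (- e - e'); rewrite /= boundaryB boundaryN -e'E.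
by rewrite !opprB [RHS]addrCA addKr.
Qed.

End CellHomology.

Section CellMap.
Context {k : fieldType} (V W : lmodType k) (f : {linear V -> W}).

Definition cell_map_fun (p : cell V) : cell W :=
  match p with
  | Vx0 => Vx0 _ | Vx1 => Vx1 _ | Vx2 => Vx2 _
  | E01 a => E01 (f a) | E12 a => E12 (f a) | E02 a => E02 (f a)
  | Tr a b => Tr (f a) (f b)
  end.

Lemma cell_map_continuous : continuous cell_map_fun.
Proof.
apply/continuousP => O /open_cellE oO; apply/open_cellE => p Op q qp.
apply: oO Op _ _; case: p q qp => [|||a|a|a|a b] [|||c|c|c|c d] //=.
all: try by move=> ->; rewrite ?linearD.
by move=> [-> ->].
Qed.

Definition cell_map : continuousType (cell V) (cell W) := mkcts cell_map_continuous.

End CellMap.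

Lemma loop_class_natural (R : realType) (k : fieldType) (V W : lmodType k)
    (f : {linear V -> W}) (a : V) :
  sing_homology_map (cell_map f) (loop_class a) = loop_class (f a) :> sing_homology R k _ 1.
Proof.
apply: sing_homology_mapE => /=.
have E p q : cle q p -> chain_map (cell_map f) (pth p q) =
    pth (cell_map f p) (cell_map f q) :> chain R k _ 1.
  move=> qp; rewrite [LHS]free_map_gen; congr gen.
  rewrite tcone_map; last exact: incore_cst.
  by congr tcone; apply/continuousEP.
have f0 : cell_map f (E01 0) = E01 0 by rewrite /= /mkcts /= linear0.
by rewrite /loop !(linearB (@chain_map R k _ _ (cell_map f) 1)) /= !E // f0.
Qed.
(** * Realizing vector spaces as homology *)

Section MooreFunctor.
Context {R : realType} {k : fieldType}.
Hypothesis prime_field : forall (U W : lmodType k) (f : U -> W),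
  {morph f : x y / x + y} -> scalable f.

(** Index [i] realizes [V] in degree [i.+1]; homology in the other degrees is left uncontrolled. *)
Fixpoint moore (V : lmodType k) (i : nat) : topologicalType :=
  match i with
  | 0 => cell V
  | i'.+1 => susp (moore V i')
  end.

Fixpoint moore_map (V W : lmodType k) (f : {linear V -> W}) (i : nat) :
    continuousType (moore V i) (moore W i) :=
  match i with
  | 0 => cell_map f
  | i'.+1 => susp_map (moore_map f i')
  end.

Lemma moore_map_id (V : lmodType k) (f : {linear V -> V}) i : f =1 id -> moore_map f i =1 id.
Proof.
move=> f1; elim: i => [|i IHi] /=; first by case=> [|||a|a|a|a b]; rewrite /mkcts //= ?f1.
by case=> [x|b]; rewrite /mkcts //= IHi.
Qed.

Lemma moore_map_comp (V W Z : lmodType k) (f : {linear V -> W}) (g : {linear W -> Z})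
    (h : {linear V -> Z}) i : g \o f =1 h -> moore_map g i \o moore_map f i =1 moore_map h i.
Proof.
move=> gf; elim: i => [|i IHi] /=.
  by case=> [|||a|a|a|a b]; rewrite /mkcts //= -?gf.
by case=> [x|b]; rewrite /mkcts //= -IHi.
Qed.

Fixpoint moore_class (V : lmodType k) (i : nat) :
    V -> sing_homology R k (moore V i) i.+1 :=
  match i with
  | 0 => @loop_class R k V
  | i'.+1 => fun v => @susp_iso R k (moore V i') i' (moore_class i' v)
  end.

Lemma moore_class_linear V i : linear (@moore_class V i).
Proof.
elim: i => [|i IHi]; first exact: loop_class_linear.
by move=> a x y /=; rewrite IHi linearP.
Qed.

Lemma moore_class_inj V i : injective (@moore_class V i).
Proof.
elim: i => [|i IHi]; first exact: loop_class_inj.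
by move=> x y /= /susp_iso_inj /IHi.
Qed.

Lemma moore_class_surj V i x : exists v, @moore_class V i v = x.
Proof.
elim: i x => [|i IHi] x; first exact: loop_class_surj.
by have [y <-] := susp_iso_surj x; have [v <-] := IHi y; exists v.
Qed.

Lemma moore_class_natural (V W : lmodType k) (f : {linear V -> W}) i v :
  sing_homology_map (moore_map f i) (moore_class i v) = moore_class i (f v).
Proof.
elim: i => [|i IHi] /=; first exact: loop_class_natural.
by rewrite susp_iso_natural IHi.
Qed.

End MooreFunctor.

(** * Maps of diagrams and of persistence modules *)

Section DiagramMaps.
Context {R : realType} {n : nat} {k : fieldType}.
Local Notation vec := 'rV[R]_n.
Local Notation vdiagram := (vdiagram R n k).

Lemma dtrans_irr (D : vdiagram) a b (h h' : vle a b) x : dtrans D h x = dtrans D h' x.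
Proof. by rewrite (bool_irrelevance h h'). Qed.

Lemma dtrans_merge (D : vdiagram) a b c (ab : vle a b) (bc : vle b c) (ac : vle a c) x :
  dtrans D bc (dtrans D ab x) = dtrans D ac x.
Proof. exact: (dtrans_comp ab bc ac x). Qed.

Section Shifted.
Variables (D D' : vdiagram) (v : vec).
Variable phi : forall a, {linear D a -> D' (a + v)}.
Hypothesis phi_natural : forall a b (ab : vle a b) x,
  phi b (dtrans D ab x) = dtrans D' (vle_add2r v ab) (phi a x).

(** The indices [b - v + v] and [b] are equal but not convertible; a transition map between them
    serves as transport. *)
Definition dmap_fun (f : forall a, D a) (b : vec) : D' b :=
  dtrans D' (vle_eq (subrK v b)) (phi (b - v) (f (b - v))).

Lemma dmap_funE (f : forall a, D a) a b (h : vle (a + v) b) : a + v = b ->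
  dmap_fun f b = dtrans D' h (phi a (f a)).
Proof.
move=> ab; have ba : b - v = a by rewrite -ab addrK.
by subst a; rewrite /dmap_fun; exact: dtrans_irr.
Qed.

Lemma dmap_fin (f : dsum D) : finite_set [set b | dmap_fun f b != 0].
Proof.
apply: sub_finite_set (finite_image (fun a => a + v) (dsum_fin f)) => b /= fb.
exists (b - v); last by rewrite subrK.
by apply: contra_neq fb => fb; rewrite /dmap_fun fb !linear0.
Qed.

Definition dmap (f : dsum D) : dsum D' := Dsum (dmap_fin f).

Lemma dmap_pull (u : expo R n) (f : forall a, D a) b :
  dmap_fun (dpull u f) b = dpull u (dmap_fun f) b.
Proof.
rewrite {1}/dmap_fun {1}/dpull phi_natural [RHS]/dpull.
have E : b - v - expo_val u + v = b - expo_val u by rewrite addrAC subrK.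
rewrite (dmap_funE f (vle_eq E) E).
exact: etrans (dtrans_merge _ _ _ _) (esym (dtrans_merge _ _ (vle_trans (vle_eq E)
  (vle_subr b (expoP u))) _)).
Qed.

Lemma dmap_linear : linear (dmap : dsum_persmod D -> dsum_persmod D').
Proof.
move=> p f g; apply: dsumP => b.
rewrite -[LHS]/(dmap_fun (fun b => dscale_fun p f b + g b) b).
rewrite -[RHS]/(dscale_fun p (dmap_fun f) b + dmap_fun g b) {1}/dmap_fun !linearD /=.
congr (_ + _); rewrite /dscale_fun !linear_sum; apply: eq_bigr => u _.
by rewrite !linearZ /= -dmap_pull.
Qed.

Lemma dmap_gr a (f : dsum_persmod D) : pgr (dsum_persmod D) a f ->
  pgr (dsum_persmod D') (a + v) (dmap f).
Proof.
move=> fa b ba; rewrite /= /dmap_fun fa ?linear0 //.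
by apply: contra_neq ba => <-; rewrite subrK.
Qed.

End Shifted.

Section Interleaving.
Variables (D D' : vdiagram) (e : {nonneg R}).
Variables (phi : forall a, {linear D a -> D' (a + epsv e)})
  (psi : forall a, {linear D' a -> D (a + epsv e)}).
Hypotheses
  (phi_natural : forall a b (ab : vle a b) x,
    phi b (dtrans D ab x) = dtrans D' (vle_add2r (epsv e) ab) (phi a x))
  (psi_natural : forall a b (ab : vle a b) x,
    psi b (dtrans D' ab x) = dtrans D (vle_add2r (epsv e) ab) (psi a x))
  (psi_phi : forall a x, psi (a + epsv e) (phi a x) = dtrans D (vle_epsv2 a e) x).

HB.instance Definition _ := GRing.isLinear.Build (Bring R n k) (dsum_persmod D)
  (dsum_persmod D') *:%R (dmap phi) (dmap_linear phi_natural).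

Definition dmor : pmor (dsum_persmod D) (pshift (dsum_persmod D') e) :=
  @Pmor _ _ _ (dsum_persmod D) (pshift (dsum_persmod D') e) (dmap phi)
    (fun a x => @dmap_gr D D' (epsv e) phi a x).

Lemma epsv_double (a : vec) : a + epsv e + epsv e = a + epsv (2 * e%:num)%:nng.
Proof. by rewrite epsvD; congr (_ + _); apply/rowP => i; rewrite !mxE /= mulr2n mulrDl mul1r. Qed.

Lemma psmoothE (x : dsum_persmod D) a :
  (psmooth (dsum_persmod D) (2 * e%:num)%:nng x : dsum D) (a + epsv e + epsv e) =
  dtrans D (vle_epsv2 a e) (x a).
Proof.
rewrite /= /psmooth_fun
  -[epsv (2 * e%:num)%:nng]/(expo_val (Expo (epsv_ge0 (2 * e%:num)%:nng))) xpowE.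
rewrite [LHS]dscaleU scale1r (@dpull_eq _ _ _ _ _ _ a _ (vle_epsv2 a e)) //.
by rewrite epsv_double addrK.
Qed.

Lemma dmap_dmap (x : dsum D) : dmap psi (dmap phi x) =
  psmooth (dsum_persmod D) (2 * e%:num)%:nng x.
Proof.
apply: dsumP => b; pose a := b - epsv e - epsv e.
have ab : a + epsv e + epsv e = b by rewrite /a !subrK.
rewrite -ab psmoothE /= (dmap_funE (v := epsv e) psi _ (vle_refl _)) // dtrans_id.
by rewrite (dmap_funE (v := epsv e) phi _ (vle_refl _)) // dtrans_id psi_phi.
Qed.

End Interleaving.

Lemma dsum_interleaved (D D' : vdiagram) (e : {nonneg R})
    (phi : forall a, {linear D a -> D' (a + epsv e)})
    (psi : forall a, {linear D' a -> D (a + epsv e)}) :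
  (forall a b (ab : vle a b) x,
    phi b (dtrans D ab x) = dtrans D' (vle_add2r (epsv e) ab) (phi a x)) ->
  (forall a b (ab : vle a b) x,
    psi b (dtrans D' ab x) = dtrans D (vle_add2r (epsv e) ab) (psi a x)) ->
  (forall a x, psi (a + epsv e) (phi a x) = dtrans D (vle_epsv2 a e) x) ->
  (forall a x, phi (a + epsv e) (psi a x) = dtrans D' (vle_epsv2 a e) x) ->
  pinterleaved e (dsum_persmod D) (dsum_persmod D').
Proof.
move=> phiN psiN psi_phi phi_psi; exists (dmor phiN), (dmor psiN).
by split=> x; exact: dmap_dmap.
Qed.

Section Isomorphism.
Variables (D D' : vdiagram) (phi : forall a, {linear D a -> D' a}).
Hypothesis phi_natural : forall a b (ab : vle a b) x,
  phi b (dtrans D ab x) = dtrans D' ab (phi a x).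

Lemma dimap_fin (f : dsum D) : finite_set [set b | phi b (f b) != 0].
Proof.
apply: sub_finite_set (dsum_fin f) => b /=; apply: contra_neq => ->.
exact: linear0.
Qed.

Definition dimap (f : dsum D) : dsum D' := Dsum (dimap_fin f).

Lemma dimap_linear : linear (dimap : dsum_persmod D -> dsum_persmod D').
Proof.
move=> p f g; apply: dsumP => b.
rewrite -[LHS]/(phi b (dscale_fun p f b + g b)) linearD /=.
rewrite -[RHS]/(dscale_fun p (dimap f) b + phi b (g b)); congr (_ + _).
rewrite /dscale_fun linear_sum; apply: eq_bigr => u _.
by rewrite linearZ /= /dpull phi_natural.
Qed.

HB.instance Definition _ := GRing.isLinear.Build (Bring R n k) (dsum_persmod D)
  (dsum_persmod D') *:%R dimap dimap_linear.

Lemma dimap_gr a (f : dsum_persmod D) : pgr (dsum_persmod D) a f ->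
  pgr (dsum_persmod D') a (dimap f).
Proof. by move=> fa b ba; rewrite /= fa // linear0. Qed.

Definition dimor : pmor (dsum_persmod D) (dsum_persmod D') :=
  @Pmor _ _ _ (dsum_persmod D) (dsum_persmod D') dimap dimap_gr.

End Isomorphism.

Lemma dsum_iso (D D' : vdiagram) (phi : forall a, {linear D a -> D' a}) :
  (forall a b (ab : vle a b) x, phi b (dtrans D ab x) = dtrans D' ab (phi a x)) ->
  (forall a, injective (phi a)) -> (forall a y, exists x, phi a x = y) ->
  piso (dsum_persmod D) (dsum_persmod D').
Proof.
move=> phiN phi_inj phi_surj.
have psiP a : {g : D' a -> D a | cancel g (phi a)}.
  by have [g gP] := choice (phi_surj a); exists g.
pose psi_fun a := sval (psiP a).
have psiK a : cancel (psi_fun a) (phi a) := svalP (psiP a).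
have phiK a : cancel (phi a) (psi_fun a) by move=> x; apply: (phi_inj a); rewrite psiK.
have psi_lin a : linear (psi_fun a) by exact: can2_linear (phiK a) (psiK a).
pose psi_mix a := GRing.isLinear.Build k (D' a) (D a) *:%R (psi_fun a) (psi_lin a).
pose psi a : {linear D' a -> D a} := HB.pack (psi_fun a) (psi_mix a).
have psiN a b (ab : vle a b) x : psi b (dtrans D' ab x) = dtrans D ab (psi a x).
  by apply: (phi_inj b); rewrite /= psiK phiN psiK.
exists (dimor phiN), (dimor psiN).
by split=> x; apply: dsumP => a; [exact: phiK|exact: psiK].
Qed.

Section Components.
Variables (D D' : vdiagram) (e : {nonneg R}).
Variable f : pmor (dsum_persmod D) (pshift (dsum_persmod D') e).

Definition component_fun (a : vec) (x : D a) : D' (a + epsv e) :=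
  (f (dincl x) : dsum D') (a + epsv e).

Lemma dincl_linear (E : vdiagram) a c (x y : E a) :
  dincl (c *: x + y) = Bconst c *: (dincl x : dsum_persmod E) + dincl y.
Proof.
apply: dsumP => b; rewrite -[RHS]/((Bconst c *: (dincl x : dsum E)) b + dincl y b).
rewrite BconstE /=; have [->|ba] := eqVneq b a.
  by rewrite !dincl_funE.
by rewrite !dincl_fun0 // scaler0 addr0.
Qed.

Lemma component_linear a : linear (@component_fun a).
Proof.
move=> c x y; rewrite /component_fun dincl_linear linearP /=.
by rewrite -[LHS]/((Bconst c *: (f (dincl x) : dsum D')) _ + _) BconstE.
Qed.
HB.instance Definition _ a :=
  GRing.isLinear.Build k (D a) (D' (a + epsv e)) *:%R (@component_fun a) (@component_linear a).

Definition component a : {linear D a -> D' (a + epsv e)} := @component_fun a.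

(** This is linearity over the monomial x^(b - a), which acts on a summand as the transition map by
    [dincl_act]. *)
Lemma component_natural a b (ab : vle a b) x :
  component b (dtrans D ab x) = dtrans D' (vle_add2r (epsv e) ab) (component a x).
Proof.
rewrite /= /component_fun -dincl_act linearZ /=.
have v0 : vle 0 (b - a).
  by have /vleP h := ab; apply/vleP => i; rewrite !mxE subr_ge0.
rewrite -[b - a]/(expo_val (Expo v0)) xpowE [LHS]dscaleU scale1r.
rewrite (@dpull_eq _ _ _ _ (Expo v0) _ (a + epsv e) _ (vle_add2r (epsv e) ab)) //=.
by rewrite opprB addrA addrAC [b + _]addrC addrK addrC.
Qed.

(** A graded morphism sends a homogeneous element to a homogeneous one, so one component carries all
    of the image, and identities between composites pass to components. *)
Lemma dincl_component a (x : D a) : dincl (component a x) = f (dincl x) :> dsum D'.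
Proof.
have gr : pgr (dsum_persmod D) a (dincl x) by move=> b ba; exact: dincl_fun0.
apply: dsumP => b; have [->|ba] := eqVneq b (a + epsv e); first by rewrite /= dincl_funE.
by rewrite /= dincl_fun0 //; have := pmor_gr f gr; rewrite /= => ->.
Qed.

End Components.

Lemma component_interleaved (D D' : vdiagram) (e : {nonneg R})
    (f : pmor (dsum_persmod D) (pshift (dsum_persmod D') e))
    (g : pmor (dsum_persmod D') (pshift (dsum_persmod D) e)) :
  (forall x, g (f x) = psmooth (dsum_persmod D) (2 * e%:num)%:nng x) ->
  forall a x, component g (a + epsv e) (component f a x) = dtrans D (vle_epsv2 a e) x.
Proof.
move=> gf a x; rewrite -[LHS]/((g (dincl (component f a x)) : dsum D) _).
by rewrite dincl_component gf psmoothE /= dincl_funE.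
Qed.

End DiagramMaps.

(** * Stability and optimality *)

Section Stability.
Context (R : realType) (n : nat) (k : fieldType) (i : nat).

Lemma homology_interleaved (X Y : filtration R n) e : finterleaved e X Y ->
  pinterleaved e (persistent_homology k i X) (persistent_homology k i Y).
Proof.
move=> [f [g fg]].
pose phi a : {linear hom_diagram k i X a -> hom_diagram k i Y (a + epsv e)} :=
  @sing_homology_map R k _ _ (f a) i.
pose psi a : {linear hom_diagram k i Y a -> hom_diagram k i X (a + epsv e)} :=
  @sing_homology_map R k _ _ (g a) i.
apply: (@dsum_interleaved R n k (hom_diagram k i X) (hom_diagram k i Y) e phi psi).
- move=> a b ab x.
  pose h : continuousType (X a) (fshift Y e b) := Defs.ftrans (fshift Y e) ab \o f a.
  exact: etrans
    (@sing_homology_map_comp R k _ _ _ (Defs.ftrans X ab) (f b) h i (fmor_trans f ab) x)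
    (esym (@sing_homology_map_comp R k _ _ _ (f a) (Defs.ftrans (fshift Y e) ab) h i
      (fun=> erefl) x)).
- move=> a b ab x.
  pose h : continuousType (Y a) (fshift X e b) := Defs.ftrans (fshift X e) ab \o g a.
  exact: etrans
    (@sing_homology_map_comp R k _ _ _ (Defs.ftrans Y ab) (g b) h i (fmor_trans g ab) x)
    (esym (@sing_homology_map_comp R k _ _ _ (g a) (Defs.ftrans (fshift X e) ab) h i
      (fun=> erefl) x)).
- move=> a x; exact: (@sing_homology_map_comp R k _ _ _ _ _ _ i (fg a).1).
- move=> a x; exact: (@sing_homology_map_comp R k _ _ _ _ _ _ i (fg a).2).
Qed.

End Stability.

Section Realizability.
Context (R : realType) (n : nat) (k : fieldType) (i : nat).
Hypothesis prime_field : forall (U W : lmodType k) (f : U -> W),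
  {morph f : x y / x + y} -> scalable f.
Implicit Type D : vdiagram R n k.

Definition moore_filtration D : filtration R n :=
  @Filtration R n (fun a => moore (D a) i) (fun a b ab => moore_map (dtrans D ab) i)
    (fun a aa => moore_map_id (dtrans_id aa))
    (fun a b c ab bc ac => moore_map_comp (dtrans_comp ab bc ac)).

Lemma moore_filtration_homology D :
  piso (dsum_persmod D) (persistent_homology k i.+1 (moore_filtration D)).
Proof.
pose phi_fun a : D a -> hom_diagram k i.+1 (moore_filtration D) a := @moore_class R k (D a) i.
pose phi_mix a := GRing.isLinear.Build k (D a) (hom_diagram k i.+1 (moore_filtration D) a)
  *:%R (phi_fun a) (@moore_class_linear R k prime_field (D a) i).
pose phi a : {linear D a -> hom_diagram k i.+1 (moore_filtration D) a} :=
  HB.pack (phi_fun a) (phi_mix a).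
apply: (@dsum_iso R n k D (hom_diagram k i.+1 (moore_filtration D)) phi).
- by move=> a b ab x; symmetry; exact: moore_class_natural.
- by move=> a; exact: moore_class_inj.
- by move=> a; exact: moore_class_surj.
Qed.

Lemma moore_fmor_natural D D' e (phi : forall a, {linear D a -> D' (a + epsv e)}) :
  (forall a b (ab : vle a b) x,
    phi b (dtrans D ab x) = dtrans D' (vle_add2r (epsv e) ab) (phi a x)) ->
  forall a b (ab : vle a b),
    moore_map (phi b) i \o Defs.ftrans (moore_filtration D) ab =1
    Defs.ftrans (fshift (moore_filtration D') e) ab \o moore_map (phi a) i.
Proof.
move=> phiN a b ab x.
have c1 := @moore_map_comp k _ _ _ (dtrans D ab) (phi b) (phi b \o dtrans D ab) i.
rewrite [LHS]c1 //.
by symmetry; apply: moore_map_comp => y; symmetry; exact: phiN.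
Qed.

Lemma moore_filtration_interleaved D D' e :
  pinterleaved e (dsum_persmod D) (dsum_persmod D') ->
  finterleaved e (moore_filtration D) (moore_filtration D').
Proof.
move=> [f [g [gf fg]]].
exists (@Fmor _ _ (moore_filtration D) (fshift (moore_filtration D') e)
  (fun a => moore_map (component f a) i) (moore_fmor_natural (component_natural f))).
exists (@Fmor _ _ (moore_filtration D') (fshift (moore_filtration D) e)
  (fun a => moore_map (component g a) i) (moore_fmor_natural (component_natural g))).
move=> a; split.
  by apply: moore_map_comp => x; exact: (component_interleaved gf).
by apply: moore_map_comp => x; exact: (component_interleaved fg).
Qed.

End Realizability.

Lemma rat_additive_scalable (U W : lmodType rat) (f : U -> W) :
  {morph f : x y / x + y} -> scalable f.
Proof.
move=> fD; apply: rat_linear => x y.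
by apply/eqP; rewrite eq_sym subr_eq -fD subrK.
Qed.

Lemma Fp_additive_scalable (p : nat) (U W : lmodType 'F_p) (f : U -> W) :
  {morph f : x y / x + y} -> scalable f.
Proof.
move=> fD a x; have f0 : f 0 = 0 by apply: (@addrI _ (f 0)); rewrite -fD !addr0.
rewrite -[a]natr_Zp !scaler_nat; elim: (a : nat) => [|m IHm].
  by rewrite !mulr0n.
by rewrite !mulrS fD IHm.
Qed.

(** Classes are predicates, so extensionality turns an isomorphism into an equality, which can be
    rewritten under an arbitrary pseudometric. *)
Lemma isoclass_of_eq (R : realType) (n : nat) (k : fieldType) (M N : persmod R n k) :
  piso M N -> isoclass_of M = isoclass_of N.
Proof.
move=> MN; rewrite /isoclass_of.
have E : piso M = piso N.
  apply/funext => P; apply/propext; split=> h; last exact: piso_trans h.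
  exact: piso_trans (piso_sym MN) h.
by move: (ex_intro _ M _); rewrite E => h; congr IsoClass; exact: Prop_irrelevance.
Qed.

Theorem theorem3p2p11 (R : realType) (n i : nat) (k : fieldType)
    (i_gt0 : (0 < i)%N)
    (k_prime : k = (rat : fieldType) \/ exists2 p : nat, prime p & k = ('F_p : fieldType)) :
  rs_optimal (R5 R n k i) (dI R n k).
Proof.
have prime_field (U W : lmodType k) (f : U -> W) :
    {morph f : x y / x + y} -> scalable f.
  case: k_prime U W f => [->|[p _ ->]] U W f.
    exact: rat_additive_scalable.
  exact: Fp_additive_scalable.
split=> [[] X Y /=|d dS _ _ [[] [X <-]] [[] [Y <-]] /=].
  rewrite [leLHS]dIE; apply: le_ereal_inf => _ [e XY <-]; exists e => //.
  exact: homology_interleaved.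
rewrite [leRHS]dIE; apply: le_ereal_inf_tmp => _ [e XY <-].
(* Positivity makes the degree a successor, the form in which [moore_filtration] realizes
   modules. *)
case: i i_gt0 d dS X Y XY => // i _ d dS X Y XY.
(* The realizations have the same homology classes as [X] and [Y], so the distance is unchanged;
   unlike [X] and [Y], they inherit the interleaving of the modules. *)
rewrite (isoclass_of_eq (moore_filtration_homology i prime_field (hom_diagram k i.+1 X))).
rewrite (isoclass_of_eq (moore_filtration_homology i prime_field (hom_diagram k i.+1 Y))).
apply: le_trans (dS tt _ _) _.
apply: ereal_inf_lbound; exists e => //.
exact: moore_filtration_interleaved.
Qed.
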